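(* Let $p$ be an odd prime and, for a positive integer $n$ coprime to $p$, let $\gamma(\mathcal{C}_n)$ be the $p$-rank of the curve $\mathcal{C}_n: y^2=x^n+1$ over $\overline{\mathbb{F}}_p$. If $r$ is a positive integer, then (i) $\gamma(\mathcal{C}_{p^r-1}) = \left(\frac{p+1}{2}\right)^r-2$; (ii) $\gamma(\mathcal{C}_{2(p^r+1)}) = \left(\frac{p+1}{2}\right)^r$; (iii) $\gamma(\mathcal{C}_{2(p^r-1)}) = \left(\frac{p+1}{2}\right)^r-2$; (iv) $\gamma(\mathcal{C}_{p^{2r}+p^r+1}) = \left(\frac{(p+3)(p+1)}{8}\right)^r$; (v) $\gamma(\mathcal{C}_{2(p^{2r}+p^r+1)}) = 2\left(\frac{(p+3)(p+1)}{8}\right)^r$; (vi) $\gamma(\mathcal{C}_{p^{3r}-p^{2r}+p^r-1})=\left(\frac{(p^2+2p+3)(p+1)}{12}\right)^r-2$.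
   Context: A ''curve'' given by an affine equation over $\overline{\mathbb{F}}_p$ means the nonsingular, projective, irreducible curve whose function field is defined by that equation. The $p$-rank $\gamma(\mathcal{X})$ of a curve $\mathcal{X}$ with Jacobian $J$ is the integer such that $J[p](\overline{\mathbb{F}}_p)\cong(\mathbb{Z}/p\mathbb{Z})^{\gamma(\mathcal{X})}$; a curve of genus $0$ has $p$-rank $0$. *)

(* Defs.v *)
From HB Require Import structures.
From mathcomp Require Import all_boot all_order all_algebra.
From mathcomp Require Import ring_quotient fraction qfpoly boolp.
From mathcomp.multinomials Require Import freeg.

Set Implicit Arguments.
Unset Strict Implicit.
Unset Printing Implicit Defensive.

Import Order.TTheory GRing.Theory Num.Theory.
Local Open Scope ring_scope.

(* Let F be the function field of a nonsingular projective curve X over an    *)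
(* algebraically closed field k, with constants embedded by kF. The points of *)
(* X are the places of F / k, represented by their normalised discrete        *)
(* valuations. The value at 0 is fixed to be 0 instead of +oo, so that a      *)
(* place is determined by its valuation; it carries no information.           *)
Section Jacobian.
Variables (k F : fieldType) (kF : {rmorphism k -> F}).

Record valuation_axioms (v : F -> int) : Prop := ValuationAxioms {
  val_zero : v 0 = 0;
  val_mul : forall f g, f != 0 -> g != 0 -> v (f * g) = v f + v g;
  val_add : forall f g, f != 0 -> g != 0 -> f + g != 0 ->
    Num.min (v f) (v g) <= v (f + g);
  val_const : forall c, c != 0 -> v (kF c) = 0;
  val_uniformizer : exists2 t, t != 0 & v t = 1
}.

Record place := Place { ord : F -> int; ordP : valuation_axioms ord }.

HB.instance Definition _ := gen_eqMixin place.
HB.instance Definition _ := gen_choiceMixin place.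

Definition degree0 : pred {freeg place} := fun D => deg D == 0.

Lemma degree0_zmod_closed : zmod_closed degree0.
Proof.
split=> [|D E]; rewrite !unfold_in ?deg0 // => /eqP dD /eqP dE.
by rewrite degB dD dE.
Qed.

HB.instance Definition _ :=
  GRing.isZmodClosed.Build {freeg place} degree0 degree0_zmod_closed.

Record Div0 := MkDiv0 { divisor :> {freeg place}; divisorP : degree0 divisor }.

HB.instance Definition _ := [isSub for divisor].
HB.instance Definition _ := [Choice of Div0 by <:].
HB.instance Definition _ := [SubChoice_isSubZmodule of Div0 by <:].

Definition principal : pred Div0 := fun D =>
  `[< exists2 f : F, f != 0 & forall P : place, coeff P D = ord P f >].

Lemma principal_zmod_closed : zmod_closed principal.
Proof.
have v1 (P : place) : ord P 1 = 0.
  by rewrite -(rmorph1 kF) (val_const (ordP P)) ?oner_neq0.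
split=> [|D E]; rewrite !unfold_in.
  by apply/asboolP; exists 1; rewrite ?oner_neq0 // => P; rewrite coeff0 v1.
move=> /asboolP[f f0 Df] /asboolP[g g0 Eg]; apply/asboolP.
exists (f / g); first by rewrite mulf_neq0 ?invr_eq0.
move=> P; rewrite coeffB Df Eg (val_mul (ordP P)) ?invr_eq0 //; congr (_ + _).
apply/eqP; rewrite eq_sym -addr_eq0 addrC -(val_mul (ordP P)) ?invr_eq0 //.
by rewrite divff // v1.
Qed.

HB.instance Definition _ :=
  GRing.isZmodClosed.Build Div0 principal principal_zmod_closed.

(* The group J(k) of k-points of the Jacobian of X. *)
Definition Pic0 : zmodType :=
  Quotient.quot (GRing.ZmodClosed.clone Div0 principal _).

(* J[p](k) is isomorphic to (Z / p Z) ^ g, for p prime. *)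
Definition has_p_rank (p g : nat) : Prop :=
  exists phi : {additive 'rV['F_p]_g -> Pic0},
    injective phi /\ forall x : Pic0, x *+ p = 0 <-> exists u, phi u = x.

End Jacobian.

(* The curve y ^ 2 = x ^ n + 1: here 'X is the variable y, over k(x).         *)
Section HyperellipticCurve.
Variables (k : fieldType) (n : nat).

Definition curve_poly : {poly {fraction {poly k}}} :=
  'X^2 - (FracField.tofrac ('X^n + 1 : {poly k}))%:P.

Hypothesis irr : monic_irreducible_poly curve_poly.

Definition function_field : fieldType := {poly %/ curve_poly with irr}.

Definition constants : {rmorphism k -> function_field} :=
  in_alg {poly %/ curve_poly with irr} \o @FracField.tofrac {poly k} \o polyC.

End HyperellipticCurve.

Definition curve_has_p_rank (k : fieldType) (p n g : nat) : Prop :=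
  exists irr : monic_irreducible_poly (curve_poly k n),
    has_p_rank (constants irr) p g.

(* Main.v *)
Require Import Defs.
From HB Require Import structures.
From mathcomp Require Import all_boot all_order all_algebra.
From mathcomp Require Import separable ring_quotient fraction qpoly qfpoly boolp.
From mathcomp.multinomials Require Import freeg.
From mathcomp Require Import zify ring.

(** Let J be the Jacobian of y ^ 2 = q, where q = x ^ n + 1. A class of J[p] is
    that of a divisor E with p E = div f for some function f, and df / f is then
    a regular differential. As d (g ^ p) = 0, it only depends on the class;
    conversely df / f determines f up to p-th powers, hence the class of E. So
    the p-torsion is in bijection with the regular logarithmic differentials
    ([torsion_classes]), and the p-rank is g if there are p ^ g of them
    ([elementary_abelian_basis]).

    By Jacobson's formula, u dx is logarithmic if and only if
    D^(p-1) u + u ^ p = 0, where D = d/dx ([jacobson], [dlogP]); this means that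
    u dx is fixed by the Cartier operator. The regular differentials are the
    a dx / y with a a polynomial such that 2 * size a < n ([regular_form],
    [regular_poly]). This requires all the places of the function field, which
    are constructed from the two specialisations above a point of the line, or
    from the single one if q has odd order at that point ([local_place],
    [fibre]). On these differentials the condition becomes a relation between
    coefficients: as q ^ ((p - 1) / 2) is a combination of powers of x ^ n, the
    coefficient of index l - 1 is tied to the one of index (p l mod n) - 1 only
    ([cartier_fixed]). Such a semilinear system is solved one cycle of
    multiplication by p at a time, a cycle of length m having p ^ m solutions if
    it stays in the range 0 < l < n / 2, and one otherwise
    ([semilinear_solutions]). Hence the p-rank is the number of l in Z/n all of
    whose multiples p ^ j l have a residue strictly between 0 and n / 2
    ([stable_p_rank]).

    If n e = p ^ N - 1, then l / n has a purely periodic expansion in base p,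
    whose period consists of the N digits of l e, and multiplication by p rotates
    this period. So the condition on l is that all digits of l e are at most
    h = (p - 1) / 2, with l e different from 0 and (p ^ N - 1) / 2
    ([stable_digits]). In the six cases N is r, 2 r, 3 r or 4 r, and the digits
    are split in blocks of length r. Divisibility by e becomes a linear condition
    on the blocks, as p ^ r is 1 or -1 modulo e, and there are no carries, so that
    it is a condition on each column of digits separately ([layer_eq]). Up to the
    two excluded values, the number of stable l is then the r-th power of a number
    of columns with entries between 0 and h: the x; those with x + y = h; those
    with x = y; those with x + y + z = 2 h; the sum of the powers for
    x + y + z = h and x + y + z = 2 h; and those with x + z = y + t. *)

Set Implicit Arguments.
Unset Strict Implicit.
Unset Printing Implicit Defensive.

Import Order.TTheory GRing.Theory Num.Theory.
Local Open Scope ring_scope.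

(** * Valuations *)

Section Valuations.
Variables (k F : fieldType) (kF : {rmorphism k -> F}).
Implicit Types (P : place kF) (f g t : F) (m l : int).

Lemma place_ext P P' : ord P =1 ord P' -> P = P'.
Proof.
case: P P' => [v hv] [v' hv'] /= /funext vv'.
by case: _ / vv' in hv' *; rewrite (Prop_irrelevance hv hv').
Qed.

(** As the value at 0 is fixed to be 0, [ord P f >= m] does not express
    that f lies in the m-th power of the maximal ideal when f = 0. *)
Definition vge P m f := (f == 0) || (m <= ord P f).

Lemma vgeE P m f : f != 0 -> vge P m f = (m <= ord P f).
Proof. by rewrite /vge => /negPf->. Qed.

Lemma vge_ord P f : vge P (ord P f) f.
Proof. by rewrite /vge lexx orbT. Qed.

Lemma vge0 P m : vge P m 0.
Proof. by rewrite /vge eqxx. Qed.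

Lemma place_ord0 P : ord P 0 = 0.
Proof. exact: val_zero (ordP P). Qed.

Lemma ordM P f g : f != 0 -> g != 0 -> ord P (f * g) = ord P f + ord P g.
Proof. by move=> f0 g0; rewrite (val_mul (ordP P) f0 g0). Qed.

Lemma ord_const P c : ord P (kF c) = 0.
Proof.
have [->|c0] := eqVneq c 0; first by rewrite rmorph0 place_ord0.
exact: (val_const (ordP P) c0).
Qed.

Lemma place_ord1 P : ord P 1 = 0.
Proof. by rewrite -(rmorph1 kF) ord_const. Qed.

Lemma ordN P f : ord P (- f) = ord P f.
Proof.
have [->|f0] := eqVneq f 0; first by rewrite oppr0.
rewrite -mulN1r ordM ?oppr_eq0 ?oner_neq0 //.
by rewrite -(rmorph1 kF) -(rmorphN kF) ord_const add0r.
Qed.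

Lemma ordV P f : ord P f^-1 = - ord P f.
Proof.
have [->|f0] := eqVneq f 0; first by rewrite invr0 place_ord0 oppr0.
apply/eqP; rewrite -addr_eq0 addrC -ordM ?invr_eq0 //.
by rewrite divff ?place_ord1.
Qed.

Lemma ordF P f g : f != 0 -> g != 0 -> ord P (f / g) = ord P f - ord P g.
Proof. by move=> f0 g0; rewrite ordM ?invr_eq0 // ordV. Qed.

Lemma ordX P f i : f != 0 -> ord P (f ^+ i) = ord P f * i%:Z.
Proof.
move=> f0; elim: i => [|i IH]; first by rewrite expr0 place_ord1 mulr0.
by rewrite exprS ordM ?expf_neq0 // IH; lia.
Qed.

Lemma ordXz P f (j : int) : f != 0 -> ord P (f ^ j) = ord P f * j.
Proof.
move=> f0; case: j => i; first exact: ordX.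
by rewrite NegzE -exprnN ordV ordX // mulrN.
Qed.

Lemma vge_trans P m l f : m <= l -> vge P l f -> vge P m f.
Proof. by rewrite /vge => ml /orP[->//|lf]; rewrite (le_trans ml lf) orbT. Qed.

Lemma vgeM P m l f g : vge P m f -> vge P l g -> vge P (m + l) (f * g).
Proof.
rewrite /vge mulf_eq0; have [//|f0] := eqVneq f 0.
have [//|g0] := eqVneq g 0 => /= mf lg.
by rewrite ordM // lerD.
Qed.

Lemma vgeD P m f g : vge P m f -> vge P m g -> vge P m (f + g).
Proof.
rewrite /vge; have [->|f0] := eqVneq f 0; first by rewrite add0r.
have [->|g0] := eqVneq g 0; first by rewrite addr0 (negPf f0).
have [//|fg0] := eqVneq (f + g) 0 => /= mf mg.
by apply: le_trans (val_add (ordP P) f0 g0 fg0); rewrite le_min mf.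
Qed.

Lemma vgeN P m f : vge P m (- f) = vge P m f.
Proof. by rewrite /vge oppr_eq0 ordN. Qed.

Lemma vgeB P m f g : vge P m f -> vge P m g -> vge P m (f - g).
Proof. by move=> mf mg; rewrite vgeD ?vgeN. Qed.

Lemma vge_const P c : vge P 0 (kF c).
Proof. by rewrite /vge ord_const lexx orbT. Qed.

Lemma vgeMl P m f g : vge P 0 f -> vge P m g -> vge P m (f * g).
Proof. by move=> f0 mg; rewrite -[m]add0r vgeM. Qed.

Lemma vgeMr P m f g : vge P m f -> vge P 0 g -> vge P m (f * g).
Proof. by move=> mf g0; rewrite -[m]addr0 vgeM. Qed.

Lemma vge_mul P m f g : f != 0 -> vge P m (f * g) = vge P (m - ord P f) g.
Proof.
move=> f0; rewrite /vge mulf_eq0 (negPf f0) /=.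
by have [//|g0] := eqVneq g 0; rewrite /= ordM // lerBlDl.
Qed.

(** The ultrametric inequality is an equality between unequal values. *)
Lemma ordD P f g : f != 0 -> vge P (ord P f + 1) g ->
  f + g != 0 /\ ord P (f + g) = ord P f.
Proof.
move=> f0 fg.
have fg0 : f + g != 0.
  apply/negP => /eqP fg0; have fE : f = - g by apply/eqP; rewrite -addr_eq0 fg0.
  by have := fg; rewrite -vgeN -fE vgeE //; lia.
split=> //.
have h1 : vge P (ord P f) (f + g).
  by apply: vgeD (vge_ord P f) _; apply: vge_trans fg; lia.
rewrite vgeE // in h1; apply/eqP; rewrite eq_le h1 andbT leNgt; apply/negP => lt.
have : vge P (ord P f + 1) (f + g - g).
  by apply: vgeB fg; rewrite vgeE //; lia.
by rewrite addrK vgeE //; lia.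
Qed.

Definition has_value P f (c : k) := vge P 1 (f - kF c).

Lemma has_value0 P f : has_value P f 0 = vge P 1 f.
Proof. by rewrite /has_value rmorph0 subr0. Qed.

Lemma has_value_ord0 P f c : has_value P f c -> c != 0 ->
  f != 0 /\ ord P f = 0.
Proof.
move=> fc c0; rewrite -[f](subrK (kF c)) addrC -(ord_const P c).
by apply: ordD; rewrite ?fmorph_eq0 // ord_const.
Qed.

Lemma has_value_vge P f c : has_value P f c -> vge P 0 f.
Proof.
move=> fc; rewrite -[f](subrK (kF c)).
by apply: vgeD (vge_const _ _); apply: vge_trans fc.
Qed.

Lemma has_valueD P f g c d : has_value P f c -> has_value P g d ->
  has_value P (f + g) (c + d).
Proof. by move=> fc gd; rewrite /has_value rmorphD opprD addrACA vgeD. Qed.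

Lemma has_valueN P f c : has_value P f c -> has_value P (- f) (- c).
Proof. by move=> fc; rewrite /has_value rmorphN -opprD vgeN. Qed.

Lemma has_valueM P f g c d : has_value P f c -> has_value P g d ->
  has_value P (f * g) (c * d).
Proof.
move=> fc gd; rewrite /has_value rmorphM.
have -> : f * g - kF c * kF d = f * (g - kF d) + (f - kF c) * kF d by ring.
by apply: vgeD; [apply: vgeMl gd; apply: has_value_vge fc
                |apply: vgeMr fc (vge_const _ _)].
Qed.

Lemma has_value_const P c : has_value P (kF c) c.
Proof. by rewrite /has_value subrr vge0. Qed.

Lemma has_value_inj P f c d : has_value P f c -> has_value P f d -> c = d.
Proof.
move=> fc /has_valueN fd; have := has_valueD fc fd; rewrite subrr.
rewrite /has_value sub0r vgeN; have [/subr0_eq//|cd0] := eqVneq (c - d) 0.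
by rewrite vgeE ?fmorph_eq0 // ord_const.
Qed.

End Valuations.

(** The relation E is the graph of a specialisation at a point: a morphism to k
    from some ring of functions that are regular there. Every nonzero function is
    a power of t times a quotient of two functions of this ring that do not
    vanish at the point. This is all that is needed to see that the point is a
    place with uniformiser t, and to compute orders. *)
Record local_ring (k F : fieldType) (kF : {rmorphism k -> F})
    (E : F -> k -> Prop) (t : F) : Prop := LocalRing {
  spec_const : forall c, E (kF c) c;
  spec_add : forall f g c d, E f c -> E g d -> E (f + g) (c + d);
  spec_mul : forall f g c d, E f c -> E g d -> E (f * g) (c * d);
  spec_zero : forall c, E 0 c -> c = 0;
  unif_neq0 : t != 0;
  spec_unif : E t 0;
  unit_fact : forall f, f != 0 -> exists (j : int) b d (beta delta : k),
    [/\ E b beta, E d delta, beta != 0, delta != 0 & f * d = t ^ j * b]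
}.

Section LocalRing.
Variables (k F : fieldType) (kF : {rmorphism k -> F}).
Variables (E : F -> k -> Prop) (t : F).
Hypothesis ET : local_ring kF E t.

Lemma spec_inj f c d : E f c -> E f d -> c = d.
Proof.
move=> fc fd; apply/eqP; rewrite -subr_eq0; apply/eqP/(spec_zero ET).
rewrite -(subrr f) -mulN1r -(mulN1r d); apply: (spec_add ET) fc _.
apply: (spec_mul ET) fd; rewrite -(rmorph1 kF) -(rmorphN kF).
exact: (spec_const ET).
Qed.

Lemma spec_unifX (i : nat) : E (t ^+ i) (0 ^+ i).
Proof.
elim: i => [|i IH]; first by rewrite !expr0 -(rmorph1 kF); exact: spec_const ET _.
by rewrite !exprS; apply: (spec_mul ET) => //; exact: (spec_unif ET).
Qed.

(* The sign of the exponent of t: a function of the ring has no pole, and it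
   vanishes if the exponent is positive. *)
Let spec_exp f c (j : int) b d beta delta : E f c -> E b beta -> E d delta ->
  beta != 0 -> delta != 0 -> f * d = t ^ j * b -> 0 <= j /\ (c = 0 -> 0 < j).
Proof.
move=> fc bb dd b0 d0 eq; have [i jE] : exists i : nat, j = i \/ j = - i%:Z.
  by case: j {eq} => i; [exists i; left|exists i.+1; right; rewrite NegzE].
case: jE => jE; rewrite {}jE in eq *.
  split=> // cE; case: i eq => [|i] //; rewrite expr0z mul1r => eq.
  have := spec_mul ET fc dd; rewrite eq cE mul0r => /(spec_inj bb) b0'.
  by rewrite b0' eqxx in b0.
case: i eq => [|i] eq; first split=> // cE.
  move: eq; rewrite oppr0 expr0z mul1r => eq.
  have := spec_mul ET fc dd; rewrite eq cE mul0r => /(spec_inj bb) b0'.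
  by rewrite b0' eqxx in b0.
have {}eq : t ^+ i.+1 * (f * d) = b.
  by rewrite eq mulrA -exprnN mulfV ?mul1r // expf_neq0 ?(unif_neq0 ET).
have := spec_mul ET (spec_unifX i.+1) (spec_mul ET fc dd).
by rewrite eq exprS !mul0r => /(spec_inj bb) b0'; rewrite b0' eqxx in b0.
Qed.

Let wd f j b d beta delta j' b' d' beta' delta' :
  E b beta -> E d delta -> beta != 0 -> delta != 0 -> f * d = t ^ j * b ->
  E b' beta' -> E d' delta' -> beta' != 0 -> delta' != 0 ->
  f * d' = t ^ j' * b' -> j' <= j.
Proof.
move=> bb dd b0 d0 eq bb' dd' b0' d0' eq'.
have h : (b' * d) * 1 = t ^ (j - j') * (b * d').
  have tj' : t ^ j' != 0 by rewrite expfz_neq0 ?(unif_neq0 ET).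
  have tE : t ^ j = t ^ j' * t ^ (j - j').
    by rewrite -expfzDr ?(unif_neq0 ET) // [j' + _]addrC subrK.
  apply: (mulfI tj'); rewrite mulr1 [RHS]mulrA -tE [LHS]mulrA -eq' [RHS]mulrA -eq.
  by ring.
have E1 : E 1 1 by rewrite -(rmorph1 kF); exact: (spec_const ET).
have [] := spec_exp (spec_mul ET bb' dd) (spec_mul ET bb dd') E1 _ _ h.
- by rewrite mulf_neq0.
- exact: oner_neq0.
by rewrite subr_ge0.
Qed.

Let v f : int := if pselect (f != 0) is left f0 then sval (cid (unit_fact ET f0))
                 else 0.

Let vP f j b d beta delta : f != 0 ->
  E b beta -> E d delta -> beta != 0 -> delta != 0 -> f * d = t ^ j * b ->
  v f = j.
Proof.
move=> f0 bb dd b0 d0 eq; rewrite /v; case: pselect => // f0'.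
case: cid => j' /= [b' [d' [beta' [delta' [bb' dd' b0' d0' eq']]]]].
by apply/eqP; rewrite eq_le (wd bb dd _ _ eq bb' dd' _ _ eq') //
  (wd bb' dd' _ _ eq' bb dd _ _ eq).
Qed.

Lemma spec_vge0 f c j b d beta delta : E f c ->
  E b beta -> E d delta -> beta != 0 -> delta != 0 -> f * d = t ^ j * b ->
  0 <= j.
Proof. by move=> fc bb dd b0 d0 eq; case: (spec_exp fc bb dd b0 d0 eq). Qed.

Lemma local_place :
  exists P : place kF, forall f c, E f c -> has_value P f c.
Proof.
have E1 : E 1 1 by rewrite -(rmorph1 kF); exact: (spec_const ET).
have n01 : (1 : k) != 0 := oner_neq0 _.
suff va : valuation_axioms kF v.
  exists (Place va) => f c fc; rewrite /has_value.
  have gc : E (f - kF c) 0.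
    rewrite -(subrr c) -(rmorphN kF); apply: (spec_add ET) fc _.
    exact: (spec_const ET).
  have [->|g0] := eqVneq (f - kF c) 0; first exact: vge0.
  rewrite vgeE //=; have [j [b [d [beta [delta [bb dd b0 d0 eq]]]]]] := unit_fact ET g0.
  rewrite (vP g0 bb dd b0 d0 eq).
  by have [_ /(_ erefl)] := spec_exp gc bb dd b0 d0 eq; lia.
split.
- by rewrite /v; case: pselect => // z0; case/eqP: (z0).
- move=> f g f0 g0.
  have [j [b [d [beta [delta [bb dd b0 d0 eq]]]]]] := unit_fact ET f0.
  have [j' [b' [d' [beta' [delta' [bb' dd' b0' d0' eq']]]]]] := unit_fact ET g0.
  rewrite (vP f0 bb dd b0 d0 eq) (vP g0 bb' dd' b0' d0' eq').
  apply: (vP _ (spec_mul ET bb bb') (spec_mul ET dd dd')); rewrite ?mulf_neq0 //.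
  by rewrite mulrACA eq eq' expfzDr ?(unif_neq0 ET) //; ring.
- move=> f g.
  wlog : f g / v f <= v g.
    move=> H f0 g0 fg0; case/orP: (le_total (v f) (v g)) => /H.
      by move/(_ f0 g0 fg0).
    by rewrite minC addrC; apply; rewrite // addrC.
  move=> fg f0 g0 fg0; rewrite min_l //.
  have [j [b [d [beta [delta [bb dd b0 d0 eq]]]]]] := unit_fact ET f0.
  have [j' [b' [d' [beta' [delta' [bb' dd' b0' d0' eq']]]]]] := unit_fact ET g0.
  have [l [e [h [eps [eta [ee hh e0 h0 eq2]]]]]] := unit_fact ET fg0.
  rewrite (vP f0 bb dd b0 d0 eq) (vP g0 bb' dd' b0' d0' eq') in fg *.
  rewrite (vP fg0 ee hh e0 h0 eq2).
  have [i ji] : exists i : nat, j' = j + i.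
    by exists `|j' - j|%N; rewrite gez0_abs ?subr_ge0 //; ring.
  have cc := spec_add ET (spec_mul ET bb dd')
               (spec_mul ET (spec_unifX i) (spec_mul ET bb' dd)).
  rewrite -subr_ge0; apply: (spec_vge0 cc (spec_mul ET ee (spec_mul ET dd dd')) hh).
  + by rewrite !mulf_neq0.
  + exact: h0.
  have tj : t ^ j != 0 by rewrite expfz_neq0 ?(unif_neq0 ET).
  have tE : t ^ l = t ^ j * t ^ (l - j).
    by rewrite -expfzDr ?(unif_neq0 ET) // [j + _]addrC subrK.
  apply: (mulfI tj); rewrite [RHS]mulrA -tE [LHS]mulrA.
  have -> : t ^ j * (b * d' + t ^+ i * (b' * d)) = (f + g) * (d * d').
    have -> : t ^ j * (b * d' + t ^+ i * (b' * d)) =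
              (t ^ j * b) * d' + (t ^ j * t ^+ i * b') * d by ring.
    by rewrite -[t ^+ i]/(t ^ i) -expfzDr ?(unif_neq0 ET) // -ji -eq -eq'; ring.
  by rewrite mulrAC eq2; ring.
- move=> c c0; apply: (vP _ (spec_const ET c) E1 c0 n01).
    by rewrite fmorph_eq0.
  by rewrite mulr1 mul1r.
- exists t; first exact: (unif_neq0 ET).
  apply: (vP (unif_neq0 ET) E1 E1 n01 n01).
  by rewrite expr1z.
Qed.

End LocalRing.

Section LocalRingPlace.
Variables (k K F : fieldType) (kK : {rmorphism k -> K}) (kF : {rmorphism k -> F}).
Variables (E : K -> k -> Prop) (t : K).
Hypothesis ET : local_ring kK E t.
Variable (iota : {rmorphism K -> F}) (P : place kF).
Hypothesis EP : forall f c, E f c -> has_value P (iota f) c.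

Lemma local_ord f j b d beta delta : f != 0 ->
    E b beta -> E d delta -> beta != 0 -> delta != 0 -> f * d = t ^ j * b ->
  ord P (iota f) = ord P (iota t) * j.
Proof.
move=> f0 /EP bb /EP dd b0 d0 /(congr1 iota).
have [ib0 ob] := has_value_ord0 bb b0; have [id0 od] := has_value_ord0 dd d0.
have it0 : iota t != 0 by rewrite fmorph_eq0 (unif_neq0 ET).
rewrite !rmorphM fmorphXz => /(congr1 (ord P)).
rewrite !ordM ?expfz_neq0 ?fmorph_eq0 ?(unif_neq0 ET) // ?ob ?od ?addr0 //.
  by move=> ->; rewrite ordXz.
by rewrite -(fmorph_eq0 iota).
by rewrite -(fmorph_eq0 iota).
Qed.

Lemma local_unif_gt0 : 0 < ord P (iota t).
Proof.
have := EP (spec_unif ET).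
by rewrite has_value0 vgeE ?fmorph_eq0 ?(unif_neq0 ET) //; lia.
Qed.

End LocalRingPlace.

Lemma int_unit_gt0 (a b : int) : 0 < a -> 1 = a * b -> a = 1.
Proof.
move=> a0 ab; have b0 : 0 < b by rewrite -(pmulr_rgt0 _ a0) -ab.
have a1 : 1 <= a by rewrite -gtz0_ge1.
have b1 : 1 <= b by rewrite -gtz0_ge1.
apply/eqP; rewrite eq_le a1 andbT [leRHS]ab.
by rewrite ler_peMr // ltW.
Qed.

Section LocalRingUniq.
Variables (k F : fieldType) (kF : {rmorphism k -> F}).
Variables (E : F -> k -> Prop) (t : F).
Hypothesis ET : local_ring kF E t.
Variable P : place kF.
Hypothesis EP : forall f c, E f c -> has_value P f c.

(** The order of any function is a multiple of that of t, and 1 is an order. *)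
Lemma local_ord_unif : ord P t = 1.
Proof.
have [s s0 s1] := val_uniformizer (ordP P).
have [j [b [d [beta [delta [bb dd b0 d0 eq]]]]]] := unit_fact ET s0.
have := local_ord (iota := idfun) ET EP s0 bb dd b0 d0 eq.
rewrite /= s1 => /(int_unit_gt0 _); apply.
exact: (local_unif_gt0 (iota := idfun) ET EP).
Qed.

Lemma local_ord1 f j b d beta delta : f != 0 ->
    E b beta -> E d delta -> beta != 0 -> delta != 0 -> f * d = t ^ j * b ->
  ord P f = j.
Proof.
move=> f0 bb dd b0 d0 eq.
by rewrite (local_ord (iota := idfun) ET EP f0 bb dd b0 d0 eq) local_ord_unif mul1r.
Qed.

Lemma local_place_uniq P' : (forall f c, E f c -> has_value P' f c) -> P' = P.
Proof.
move=> EP'; apply: place_ext => f.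
have [->|f0] := eqVneq f 0; first by rewrite !place_ord0.
have [j [b [d [beta [delta [bb dd b0 d0 eq]]]]]] := unit_fact ET f0.
have := local_ord (iota := idfun) ET EP' f0 bb dd b0 d0 eq => /= ->.
rewrite (local_ord1 f0 bb dd b0 d0 eq).
have [s s0 s1] := val_uniformizer (ordP P').
have [l [b' [d' [beta' [delta' [bb' dd' b0' d0' eq']]]]]] := unit_fact ET s0.
have := local_ord (iota := idfun) ET EP' s0 bb' dd' b0' d0' eq'.
rewrite /= s1 => /(int_unit_gt0 _) ->; first by rewrite mul1r.
exact: (local_unif_gt0 (iota := idfun) ET EP').
Qed.

(** The residue field is k. *)
Lemma local_value f : vge P 0 f -> exists c, has_value P f c.
Proof.
have [-> _|f0] := eqVneq f 0; first by exists 0; rewrite has_value0 vge0.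
rewrite vgeE //.
have [j [b [d [beta [delta [bb dd b0 d0 eq]]]]]] := unit_fact ET f0.
have ordf := local_ord1 f0 bb dd b0 d0 eq.
rewrite ordf le_eqVlt => /orP[/eqP j0|j0]; last first.
  by exists 0; rewrite has_value0 vgeE // ordf; lia.
move: eq; rewrite -j0 expr0z mul1r => eq.
exists (beta / delta); have [dF od] := has_value_ord0 (EP dd) d0.
have : has_value P (d * (f - kF (beta / delta))) 0.
  rewrite mulrBr mulrC eq -(subrr beta); apply: has_valueD (EP bb) _.
  apply: has_valueN; rewrite -{2}[beta](divfK d0) [_ * delta]mulrC.
  exact: has_valueM (EP dd) (has_value_const _ _).
by rewrite has_value0 vge_mul // od subr0.
Qed.

End LocalRingUniq.

(** * Places of a rational function field *)

Lemma quot_powers (K : fieldType) (x a b : K) i j : x != 0 -> b != 0 ->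
  (x ^+ i * a) / (x ^+ j * b) * b = x ^ (i%:Z - j%:Z) * a.
Proof.
move=> x0 b0; rewrite expfzDr // -exprnN -[x ^ i]/(x ^+ i).
by field; rewrite b0 expf_neq0.
Qed.

Lemma shift_num (K : fieldType) (x a b : K) i : x != 0 -> b != 0 ->
  a / b * 1 = x^-1 ^ i%:Z * (a * x ^+ i / b).
Proof.
move=> x0 b0; rewrite -[_ ^ i%:Z]/(_ ^+ i) exprVn.
by field; rewrite b0 expf_neq0.
Qed.

Lemma shift_den (K : fieldType) (x a b : K) i : x != 0 -> b != 0 ->
  a / b * 1 = x^-1 ^ (- i%:Z) * (a / (b * x ^+ i)).
Proof.
move=> x0 b0; rewrite -exprnN exprVn invrK.
by field; rewrite b0 expf_neq0.
Qed.

Lemma size_mul_pred (R : idomainType) (p q : {poly R}) : p != 0 -> q != 0 ->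
  (size (p * q)).-1 = ((size p).-1 + (size q).-1)%N.
Proof.
by move=> p0 q0; rewrite size_mul //; move: p0 q0; rewrite -!size_poly_gt0; lia.
Qed.

Lemma size_mulXn (R : idomainType) (p : {poly R}) i : p != 0 ->
  size (p * 'X^i) = (i + size p)%N.
Proof. by move=> p0; rewrite size_Mmonic ?monicXn // size_polyXn; lia. Qed.

Section RationalPlaces.
Variables (k : closedFieldType) (K : fieldType) (tf : {rmorphism {poly k} -> K}).
Local Notation "x %:F" := (tf x).
Hypothesis tf_inj : injective tf.
Hypothesis fracP : forall f : K, exists n d, d != 0 /\ f = n%:F / d%:F.
Implicit Types (f g : K) (p q n d : {poly k}).

Lemma tf_eq p q : (p%:F == q%:F) = (p == q).
Proof. exact: (inj_eq tf_inj). Qed.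

Lemma tf_eq0 p : (p%:F == 0) = (p == 0).
Proof. by rewrite -(rmorph0 tf) tf_eq. Qed.

Definition cst : {rmorphism k -> K} := tf \o polyC.

Lemma frac_coprime f : exists n d, [/\ d != 0, coprimep n d & f = n%:F / d%:F].
Proof.
have [n [d [d0 ->]]] := fracP f.
have g0 : gcdp n d != 0 by rewrite gcdp_eq0 negb_and d0 orbT.
exists (n %/ gcdp n d), (d %/ gcdp n d).
have dE := divpK (dvdp_gcdr n d); have nE := divpK (dvdp_gcdl n d).
split.
- by apply: contraNneq d0 => z; rewrite -dE z mul0r.
- by rewrite coprimep_div_gcd // d0 orbT.
have nF : n%:F = (n %/ gcdp n d)%:F * (gcdp n d)%:F by rewrite -rmorphM nE.
have dF : d%:F = (d %/ gcdp n d)%:F * (gcdp n d)%:F by rewrite -rmorphM dE.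
by rewrite [n%:F]nF [d%:F]dF invfM mulrACA divff ?mulr1 ?tf_eq0.
Qed.

Definition spec_at (a : k) f c := exists2 p, f = p%:F & c = p.[a].

Lemma poly_fact (a : k) p : p != 0 ->
  exists2 q, p = ('X - a%:P) ^+ mup a p * q & q.[a] != 0.
Proof.
move=> p0; have : ('X - a%:P) ^+ mup a p %| p by rewrite -mup_geq.
case/dvdpP => q pE; exists q; first by rewrite mulrC.
apply/negP => /factor_theorem [q' qE].
have : ('X - a%:P) ^+ (mup a p).+1 %| p.
  by rewrite [X in _ %| X]pE qE exprS -mulrA dvdp_mulIr.
by rewrite -mup_geq // ltnn.
Qed.

Lemma local_ring_at a : local_ring cst (spec_at a) ('X - a%:P)%:F.
Proof.
split.
- by move=> c; exists c%:P; rewrite ?hornerC.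
- by move=> f g c d [p -> ->] [q -> ->]; exists (p + q); rewrite ?hornerD ?rmorphD.
- by move=> f g c d [p -> ->] [q -> ->]; exists (p * q); rewrite ?hornerM ?rmorphM.
- by move=> c [p /esym/eqP]; rewrite tf_eq0 => /eqP -> ->; rewrite horner0.
- by rewrite tf_eq0 polyXsubC_eq0.
- by exists ('X - a%:P); rewrite ?hornerXsubC ?subrr.
move=> f f0; have [n [d [d0 fE]]] := fracP f.
have n0 : n != 0 by apply: contraNneq f0 => n0; rewrite fE n0 rmorph0 mul0r.
have [n1 nE n1a] := poly_fact a n0; have [d1 dE d1a] := poly_fact a d0.
exists ((mup a n)%:Z - (mup a d)%:Z), n1%:F, d1%:F, n1.[a], d1.[a].
split=> //; [by exists n1|by exists d1|].
have x0 : ('X - a%:P)%:F != 0 :> K by rewrite tf_eq0 polyXsubC_eq0.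
have d10 : d1%:F != 0 :> K.
  by rewrite tf_eq0; apply: contraNneq d1a => ->; rewrite horner0.
have nF : n%:F = ('X - a%:P)%:F ^+ mup a n * n1%:F.
  by rewrite -rmorphXn -rmorphM -nE.
have dF : d%:F = ('X - a%:P)%:F ^+ mup a d * d1%:F.
  by rewrite -rmorphXn -rmorphM -dE.
rewrite fE nF dF; exact: quot_powers x0 d10.
Qed.

Lemma tf_mulXn n i : (n * 'X^i)%:F = n%:F * 'X%:F ^+ i :> K.
Proof. by rewrite rmorphM; congr (_ * _); apply: rmorphXn. Qed.

(** The specialisation at infinity reads off the ratio of the coefficients at
    the degree of the denominator. *)
Definition spec_inf f c := exists n d, [/\ d != 0, f = n%:F / d%:F,
  (size n <= size d)%N & c = n`_(size d).-1 / lead_coef d].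

Lemma coefM_top n d (i j : nat) : (size n <= i.+1)%N -> (size d <= j.+1)%N ->
  (n * d)`_(i + j) = n`_i * d`_j.
Proof.
move=> sn sd; rewrite coefM (bigD1 (inord i)) //= inordK ?ltnS ?leq_addr //.
rewrite addKn big1 ?addr0 // => l; rewrite -val_eqE /= inordK ?ltnS ?leq_addr // => li.
have [lt|ge] := ltnP i l; first by rewrite nth_default ?mul0r // (leq_trans sn).
rewrite [d`__]nth_default ?mulr0 // (leq_trans sd) //.
by have := ltn_ord l; lia.
Qed.

Lemma local_ring_inf : local_ring cst spec_inf ('X%:F)^-1.
Proof.
have X0 : 'X%:F != 0 :> K by rewrite tf_eq0 polyX_eq0.
have lE d : d != 0 -> (size d).-1.+1 = size d.
  by move=> d0; rewrite prednK // size_poly_gt0.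
split.
- move=> c; exists c%:P, 1; rewrite oner_neq0 size_poly1 size_polyC_leq1.
  by rewrite rmorph1 !divr1 coefC lead_coef1 divr1.
- move=> f g c c' [n [d [d0 -> sn ->]]] [n' [d' [d0' -> sn' ->]]].
  exists (n * d' + n' * d), (d * d'); split; first by rewrite mulf_neq0.
  + by rewrite addf_div ?tf_eq0 // rmorphD !rmorphM.
  + rewrite (leq_trans (size_polyD _ _)) // geq_max [size (d * d')%R]size_mul //.
    apply/andP; split; apply: leq_trans (size_polyMleq _ _) _.
      by rewrite -!subn1 leq_sub2r // leq_add2r.
    by rewrite addnC -!subn1 leq_sub2r // leq_add2l.
  rewrite lead_coefM addf_div ?lead_coef_eq0 //; congr (_ / _).
  have -> : (size (d * d')%R).-1 = ((size d).-1 + (size d').-1)%N.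
    exact: size_mul_pred.
  rewrite coefD coefM_top ?lE // lead_coefE; congr (_ + _).
  by rewrite addnC coefM_top ?lE // lead_coefE.
- move=> f g c c' [n [d [d0 -> sn ->]]] [n' [d' [d0' -> sn' ->]]].
  exists (n * n'), (d * d'); split; first by rewrite mulf_neq0.
  + by rewrite mulf_div !rmorphM.
  + rewrite (leq_trans (size_polyMleq _ _)) // [size (d * d')%R]size_mul //.
    by rewrite -!subn1 leq_sub2r // leq_add.
  rewrite lead_coefM mulf_div; congr (_ / _).
  have -> : (size (d * d')%R).-1 = ((size d).-1 + (size d').-1)%N.
    exact: size_mul_pred.
  by rewrite coefM_top ?lE.
- move=> c [n [d [d0 /esym/eqP]]]; rewrite mulf_eq0 invr_eq0 !tf_eq0.
  by rewrite (negPf d0) orbF => /eqP -> _ ->; rewrite coef0 mul0r.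
- by rewrite invr_eq0.
- exists 1, 'X; rewrite polyX_eq0 rmorph1 mul1r size_poly1 size_polyX.
  by rewrite coef1 mul0r.
move=> f f0; have [n [d [d0 fE]]] := fracP f.
have n0 : n != 0 by apply: contraNneq f0 => n0; rewrite fE n0 rmorph0 mul0r.
have E1 : spec_inf 1 1.
  exists 1, 1; rewrite oner_neq0 rmorph1 divr1; split=> //.
  by rewrite lead_coef1 size_poly1 coef1 divr1.
have key n' d' : n' != 0 -> d' != 0 -> size n' = size d' ->
    exists2 beta, spec_inf (n'%:F / d'%:F) beta & beta != 0.
  move=> n0' d0' sE; exists (lead_coef n' / lead_coef d').
    by exists n', d'; rewrite d0' sE; split=> //; rewrite -sE.
  by rewrite mulf_neq0 ?invr_eq0 ?lead_coef_eq0.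
have dF0 : d%:F != 0 :> K by rewrite tf_eq0.
have [le|/ltnW le] := leqP (size n) (size d).
  have [|||beta bE b0] := key (n * 'X ^+ (size d - size n)) d => //.
    by rewrite mulf_neq0 ?expf_neq0 ?polyX_eq0.
    by rewrite size_mulXn // subnK.
  exists (size d - size n)%N%:Z, ((n * 'X ^+ (size d - size n))%:F / d%:F), 1, beta, 1.
  split=> //; first exact: oner_neq0.
  rewrite fE tf_mulXn; exact: (shift_num _ _ X0 dF0).
have [|||beta bE b0] := key n (d * 'X ^+ (size n - size d)) => //.
  by rewrite mulf_neq0 ?expf_neq0 ?polyX_eq0.
  by rewrite size_mulXn // subnK.
exists (- (size n - size d)%N%:Z), (n%:F / (d * 'X ^+ (size n - size d))%:F), 1,
  beta, 1.
split=> //; first exact: oner_neq0.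
rewrite fE tf_mulXn; exact: (shift_den _ _ X0 dF0).
Qed.

(** [None] is the point at infinity. *)
Definition spec (i : option k) := if i is Some a then spec_at a else spec_inf.
Definition unif (i : option k) : K :=
  if i is Some a then ('X - a%:P)%:F else ('X%:F)^-1.

Lemma local_ring_spec i : local_ring cst (spec i) (unif i).
Proof. by case: i => [a|]; [exact: local_ring_at|exact: local_ring_inf]. Qed.

Definition placeK i : place cst := sval (cid (local_place (local_ring_spec i))).

Lemma placeKP i f c : spec i f c -> has_value (placeK i) f c.
Proof. by rewrite /placeK; case: cid => P /= h /h. Qed.

Lemma ord_unif i : ord (placeK i) (unif i) = 1.
Proof. exact: (local_ord_unif (local_ring_spec i) (@placeKP i)). Qed.

Lemma placeK_value i f : vge (placeK i) 0 f -> exists c, has_value (placeK i) f c.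
Proof. exact: (local_value (local_ring_spec i) (@placeKP i)). Qed.

Lemma ord_at a p : p != 0 -> ord (placeK (Some a)) p%:F = mup a p.
Proof.
move=> p0; have [q pE qa] := poly_fact a p0.
apply: (local_ord1 (local_ring_spec (Some a)) (@placeKP (Some a))
  (b := q%:F) (d := 1) (beta := q.[a]) (delta := 1)); rewrite ?tf_eq0 //.
- by exists q.
- by exists 1; rewrite ?hornerC ?rmorph1.
- exact: oner_neq0.
- by rewrite mulr1 {1}pE rmorphM rmorphXn.
Qed.

Lemma ord_inf p : p != 0 -> ord (placeK None) p%:F = - (size p).-1%:Z.
Proof.
move=> p0.
apply: (local_ord1 (local_ring_spec None) (@placeKP None)
  (b := p%:F / ('X ^+ (size p).-1)%:F) (d := 1) (beta := lead_coef p) (delta := 1)).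
- by rewrite tf_eq0.
- exists p, ('X ^+ (size p).-1); rewrite monic_neq0 ?monicXn // size_polyXn lead_coefXn.
  by rewrite divr1 prednK ?size_poly_gt0 // leqnn.
- exists 1, 1; rewrite oner_neq0 rmorph1 divr1; split=> //.
  by rewrite lead_coef1 size_poly1 coef1 divr1.
- by rewrite lead_coef_eq0.
- exact: oner_neq0.
- have XE : ('X ^+ (size p).-1)%:F = 'X%:F ^+ (size p).-1 :> K by exact: rmorphXn.
  have X0 : 'X%:F != 0 :> K by rewrite tf_eq0 polyX_eq0.
  rewrite mulr1 /unif -exprnN exprVn invrK XE mulrCA divff ?mulr1 //.
  exact: expf_neq0.
Qed.

Lemma ordK_frac i n d : n != 0 -> d != 0 ->
  ord (placeK i) (n%:F / d%:F) = ord (placeK i) n%:F - ord (placeK i) d%:F.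
Proof. by move=> n0 d0; rewrite ordF ?tf_eq0. Qed.

Lemma vge_at_poly a p : vge (placeK (Some a)) 0 p%:F.
Proof.
have [->|p0] := eqVneq p 0; first by rewrite rmorph0 vge0.
by rewrite vgeE ?tf_eq0 // ord_at.
Qed.

Lemma sum_mup p (s : seq k) : p != 0 -> uniq s ->
  (forall a, root p a -> a \in s) -> (\sum_(a <- s) mup a p)%N = (size p).-1.
Proof.
move=> p0 us rs; have [r pE] := closed_field_poly_normal p.
have l0 : lead_coef p != 0 by rewrite lead_coef_eq0.
have mE a : mup a p = count_mem a r.
  rewrite pE -mul_polyC mupMr ?mu_prod_XsubC //.
  by rewrite rootC.
have -> : (size p).-1 = size r.
  by rewrite {1}pE size_scale // size_prod_XsubC.
rewrite (eq_bigr _ (fun a _ => mE a)).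
have sub : {subset r <= s}.
  by move=> a ar; apply: rs; rewrite pE rootZ // root_prod_XsubC.
rewrite (eq_bigr (fun a => \sum_(z <- r | z == a) 1)%N) => [|a _]; last first.
  by rewrite sum1_count.
rewrite (exchange_big_dep xpredT) //= -sum1_size.
rewrite [LHS]big_seq [RHS]big_seq; apply: eq_bigr => z zr.
rewrite -[LHS]big_filter.
have -> : [seq i <- s | z == i] = [seq i <- s | pred1 z i].
  by apply: eq_filter => i; rewrite /= eq_sym.
by rewrite filter_pred1_uniq ?sub // big_seq1.
Qed.

(** The product formula: a rational function has as many zeros as poles. *)
Lemma sum_ordK f : f != 0 -> exists s : seq k,
  (forall a, a \notin s -> ord (placeK (Some a)) f = 0) /\
  forall s', uniq s' -> {subset s <= s'} ->
    \sum_(a <- s') ord (placeK (Some a)) f + ord (placeK None) f = 0.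
Proof.
move=> f0; have [n [d [d0 fE]]] := fracP f.
have n0 : n != 0 by apply: contraNneq f0 => n0; rewrite fE n0 rmorph0 mul0r.
have [r [sn sd]] : exists r : seq k, {subset root n <= r} /\ {subset root d <= r}.
  have [sn nE] := closed_field_poly_normal n.
  have [sd dE] := closed_field_poly_normal d.
  exists (sn ++ sd); split=> a; rewrite -topredE /= mem_cat.
    by rewrite nE rootZ ?lead_coef_eq0 // root_prod_XsubC => ->.
  by rewrite dE rootZ ?lead_coef_eq0 // root_prod_XsubC => ->; rewrite orbT.
exists r; split=> [a ar|s us rs].
  rewrite fE ordK_frac // !ord_at // !mupNroot //.
    by apply: contra ar => /sd.
  by apply: contra ar => /sn.
rewrite fE ordK_frac // !ord_inf //.
under eq_bigr => a _ do rewrite ordK_frac // !ord_at //.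
rewrite sumrB -!(big_morph Posz PoszD (erefl _)) !sum_mup //; first by lia.
  by move=> a /sd/rs.
by move=> a /sn/rs.
Qed.

(** In lowest terms, a zero of the denominator would be a pole. *)
Lemma integralK f : (forall a, vge (placeK (Some a)) 0 f) -> exists p, f = p%:F.
Proof.
move=> fint; have [n [d [d0 cnd fE]]] := frac_coprime f.
have [f0|f0] := eqVneq f 0; first by exists 0; rewrite f0 rmorph0.
have n0 : n != 0 by apply: contraNneq f0 => n0; rewrite fE n0 rmorph0 mul0r.
have [|/closed_rootP [a da]] := eqVneq (size d) 1%N.
  move=> /eqP/size_poly1P[c c0 dE]; exists (c^-1 *: n).
  rewrite fE dE -mul_polyC rmorphM mulrC; congr (_ * _).
  apply: (mulfI (x := c%:P%:F)); first by rewrite tf_eq0 polyC_eq0.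
  by rewrite divff ?tf_eq0 ?polyC_eq0 // -rmorphM -polyCM divff // rmorph1.
have := fint a; rewrite vgeE // fE ordK_frac // !ord_at //.
rewrite [mup a n]mupNroot; last first.
  by apply: contraL cnd => na; apply/coprimepPn; [|exists ('X - a%:P)];
     rewrite ?n0 // dvdp_gcd !dvdp_XsubCl na da -size_poly_eq1 size_XsubC.
by have := XsubC_dvd a d0; rewrite dvdp_XsubCl da; lia.
Qed.

End RationalPlaces.

(** * Derivations *)

Record derivation (F : fieldType) (D : F -> F) : Prop := Derivation {
  derD : forall f g, D (f + g) = D f + D g;
  derM : forall f g, D (f * g) = D f * g + f * D g
}.

Section DerivationTheory.
Variables (F : fieldType) (D : F -> F).
Hypothesis hD : derivation D.
Implicit Types f g c : F.

Lemma der0 : D 0 = 0.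
Proof. by apply: (addrI (D 0)); rewrite -(derD hD) !addr0. Qed.

Lemma der1 : D 1 = 0.
Proof.
by apply: (addrI (D 1)); rewrite addr0 -{3}[1]mulr1 (derM hD) mulr1 mul1r.
Qed.

Lemma derN f : D (- f) = - D f.
Proof. by apply/eqP; rewrite -addr_eq0 -(derD hD) addNr der0. Qed.

Lemma derB f g : D (f - g) = D f - D g.
Proof. by rewrite (derD hD) derN. Qed.

Lemma derX f n : D (f ^+ n) = f ^+ n.-1 * D f *+ n.
Proof.
elim: n => [|n IH]; first by rewrite expr0 der1 mulr0n.
rewrite exprS (derM hD) IH [RHS]mulrS /= mulrC; congr (_ + _).
case: n {IH} => [|n]; first by rewrite !mulr0n mulr0.
by rewrite exprS mulrnAr -mulrA.
Qed.

Lemma derV f : D f^-1 = - D f / f ^+ 2.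
Proof.
have [->|f0] := eqVneq f 0; first by rewrite invr0 der0 oppr0 mul0r.
apply: (mulfI f0); apply: (addrI (D f / f)).
by rewrite -(derM hD) divff // der1; field.
Qed.

Lemma der_char (p : nat) f : p%:R = 0 :> F -> D (f ^+ p) = 0.
Proof. by move=> p0; rewrite derX -mulr_natr p0 mulr0. Qed.

Lemma derMc f c : D c = 0 -> D (f * c) = D f * c.
Proof. by rewrite (derM hD) => ->; rewrite mulr0 addr0. Qed.

Lemma iter_derMc m f c : D c = 0 -> iter m D (f * c) = iter m D f * c.
Proof. by move=> c0; elim: m => //= m ->; rewrite derMc. Qed.

Lemma dlogM f g : f != 0 -> g != 0 -> D (f * g) / (f * g) = D f / f + D g / g.
Proof. by move=> f0 g0; rewrite (derM hD); field; rewrite f0 g0. Qed.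

Lemma dlogV f : f != 0 -> D f^-1 / f^-1 = - (D f / f).
Proof. by move=> f0; rewrite derV invrK; field. Qed.

Lemma dlogXz f (m : int) : f != 0 -> D (f ^ m) / f ^ m = (D f / f) *~ m.
Proof.
move=> f0; have nat_case (i : nat) : D (f ^+ i) / f ^+ i = (D f / f) *+ i.
  elim: i => [|i IH]; first by rewrite expr0 der1 mul0r.
  by rewrite exprS dlogM ?expf_neq0 // IH mulrS.
case: m => i; first exact: nat_case.
by rewrite NegzE -exprnN dlogV ?expf_neq0 // nat_case mulrNz.
Qed.

End DerivationTheory.

(** A derivation is bounded on the whole valuation ring as soon as it is on the
    specialisable functions, since these generate it up to units. *)
Lemma der_bound (k F : fieldType) (kF : {rmorphism k -> F}) (D : F -> F)
    (E : F -> k -> Prop) (t : F) (P : place kF) (m : int) :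
    derivation D -> local_ring kF E t ->
    (forall f c, E f c -> has_value P f c) ->
    (forall f c, E f c -> vge P m (D f)) ->
  forall f, vge P 0 f -> vge P m (D f).
Proof.
move=> hD ET EP ED f; have [-> _|f0] := eqVneq f 0; first by rewrite (der0 hD) vge0.
have [j [b [d [beta [delta [bb dd b0 d0 eq]]]]]] := unit_fact ET f0.
have ordf := local_ord1 ET EP f0 bb dd b0 d0 eq.
have [dF od] := has_value_ord0 (EP _ _ dd) d0.
rewrite vgeE // ordf => j0.
have tE : forall i, vge P m (D (t ^+ i * b)).
  elim=> [|i IH]; first by rewrite expr0 mul1r (ED _ _ bb).
  rewrite exprS -mulrA (derM hD) vgeD //.
    apply: vgeMr (ED _ _ (spec_unif ET)) _.
    apply: (@has_value_vge _ _ _ _ _ (0 ^+ i * beta)); apply: EP.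
    by apply: (spec_mul ET) bb; apply: (spec_unifX ET).
  by apply: vgeMl IH; apply: (has_value_vge (EP _ _ (spec_unif ET))).
have : vge P m (d * D f).
  have -> : d * D f = D (f * d) - f * D d by rewrite (derM hD); ring.
  rewrite vgeB //; first by rewrite eq; case: (j) j0 => [i _|//]; exact: tE.
  by apply: vgeMl (ED _ _ dd); rewrite vgeE // ordf.
by rewrite vge_mul // od subr0.
Qed.

(** * The derivation d/dx of k(x) *)

Lemma size_deriv_mul (R : nzRingType) (u v : {poly R}) :
  u != 0 -> (0 < size v)%N -> (size (u^`() * v)%R <= (size u + size v).-2)%N.
Proof.
move=> u0 v0; apply: leq_trans (size_polyMleq _ _) _.
have := lt_size_deriv u0; lia.
Qed.

Section RationalDerivation.
Variables (k : closedFieldType) (K : fieldType) (tf : {rmorphism {poly k} -> K}).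
Local Notation "x %:F" := (tf x).
Hypothesis tf_inj : injective tf.
Hypothesis fracP : forall f : K, exists n d, d != 0 /\ f = n%:F / d%:F.
Local Notation tf_eq0 := (tf_eq0 tf_inj).
Local Notation tf_eq := (tf_eq tf_inj).
Local Notation placeK := (placeK tf_inj fracP).
Implicit Types (f g : K) (q n d : {poly k}).

Definition DK f : K :=
  let n := sval (cid (fracP f)) in let d := sval (cid (svalP (cid (fracP f)))) in
  (n^`() * d - n * d^`())%:F / d%:F ^+ 2.

Lemma DK_frac n d : d != 0 ->
  DK (n%:F / d%:F) = (n^`() * d - n * d^`())%:F / d%:F ^+ 2.
Proof.
move=> d0; rewrite /DK; case: cid => n1 /= h; case: cid => d1 /= [d10].
have F0 := fun q (q0 : q != 0) => etrans (congr1 negb (tf_eq0 q)) q0.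
move/eqP; rewrite eqr_div ?F0 // -!rmorphM tf_eq => /eqP e.
have e' := congr1 (@deriv k) e; rewrite !derivM in e'.
apply/eqP; rewrite eqr_div ?expf_neq0 ?F0 // -!rmorphXn -!rmorphM tf_eq.
rewrite -subr_eq0 -oppr_eq0; apply/eqP.
transitivity (d * d1 * ((n^`() * d1 + n * d1^`()) - (n1^`() * d + n1 * d^`()))
   - (d^`() * d1 + d * d1^`()) * (n * d1 - n1 * d)); first by ring.
by rewrite e' e !subrr !mulr0 subrr.
Qed.

Lemma DK_poly q : DK q%:F = q^`()%:F.
Proof.
rewrite -[q%:F]divr1 -(rmorph1 tf) DK_frac ?oner_neq0 //.
by rewrite derivC mulr0 subr0 mulr1 rmorph1 expr1n divr1.
Qed.

Lemma derivation_DK : derivation DK.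
Proof.
have F0 := fun q (q0 : q != 0) => etrans (congr1 negb (tf_eq0 q)) q0.
split=> f g; have [n [d [d0 ->]]] := fracP f; have [n' [d' [d0' ->]]] := fracP g.
  rewrite addf_div ?F0 // -!rmorphM -rmorphD !DK_frac ?mulf_neq0 //.
  rewrite derivD !derivM !(rmorphM, rmorphD, rmorphB).
  by field; rewrite !F0.
rewrite mulf_div -!rmorphM !DK_frac ?mulf_neq0 //.
rewrite !derivM !(rmorphM, rmorphD, rmorphB).
by field; rewrite !F0.
Qed.

Lemma iter_DK_poly m q : iter m DK q%:F = q^`(m)%:F.
Proof. by elim: m => [|m IH] //=; rewrite IH DK_poly. Qed.

(** dx has a double pole at infinity and no other zero or pole. *)
Definition pole_dx (i : option k) : int := if i is Some _ then 0 else 2.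

Lemma DK_bound i f : vge (placeK i) 0 f -> vge (placeK i) (pole_dx i) (DK f).
Proof.
apply: (der_bound derivation_DK (local_ring_spec tf_inj fracP i) (@placeKP _ _ _
  tf_inj fracP i)) => {}f c.
case: i => [a|] /=.
  by case=> q -> _; rewrite DK_poly vge_at_poly.
move=> fc; have fv : has_value (placeK None) f c := placeKP tf_inj fracP (i := None) fc.
have -> : DK f = DK (f - cst tf c).
  by rewrite (derB derivation_DK) /= DK_poly derivC rmorph0 subr0.
have := fv; rewrite /has_value; case: (fracP (f - cst tf c)) => n [d [d0 ->]].
have [->|n0] := eqVneq n 0.
  by rewrite rmorph0 mul0r (der0 derivation_DK) vge0.
rewrite DK_frac // vgeE ?mulf_neq0 ?invr_eq0 ?tf_eq0 //.
rewrite ordK_frac // !ord_inf //.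
set w := n^`() * d - n * d^`().
have [->|w0] := eqVneq w 0; first by rewrite rmorph0 mul0r vge0.
move=> h; rewrite vgeE ?mulf_neq0 ?invr_eq0 ?expf_neq0 ?tf_eq0 //.
rewrite -rmorphXn ordK_frac ?expf_neq0 // !ord_inf ?expf_neq0 // size_exp.
have sd : (0 < size d)%N by rewrite size_poly_gt0.
have sn : (0 < size n)%N by rewrite size_poly_gt0.
suff : (size w <= (size n + size d).-1.-1)%N.
  by move: h sd sn; set a := size n; set b := size w; set e := size d; lia.
rewrite (leq_trans (size_polyD _ _)) // geq_max size_polyN size_deriv_mul //=.
by rewrite mulrC [(size n + _)%N]addnC size_deriv_mul.
Qed.

Lemma DK_unif i : DK (unif tf i) != 0 /\
  ord (placeK i) (DK (unif tf i)) = pole_dx i.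
Proof.
case: i => [a|] /=.
  by rewrite DK_poly derivXsubC rmorph1 place_ord1 oner_neq0.
have X0 : 'X%:F != 0 :> K by rewrite tf_eq0 polyX_eq0.
rewrite (derV derivation_DK) DK_poly derivX rmorph1 mulN1r ordN ordV ordX //.
rewrite oppr_eq0 invr_eq0 expf_neq0 //.
by rewrite ord_inf ?polyX_eq0 // size_polyX.
Qed.

Variable p : nat.
Hypothesis charp : p \in [pchar k].

Let p_gt0 : (0 < p)%N := prime_gt0 (pcharf_prime charp).

Lemma charK : p%:R = 0 :> K.
Proof. by rewrite -(rmorph_nat (cst tf)) (pcharf0 charp) rmorph0. Qed.

Lemma p_root (c : k) : exists b, b ^+ p = c.
Proof.
have [|b] := closed_rootP ('X^p - c%:P : {poly k}) _.
  by rewrite size_XnsubC // eqSS -lt0n.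
by rewrite rootE !hornerE subr_eq0 => /eqP <-; exists b.
Qed.

Lemma coef_expp q i : (q ^+ p)`_i = if (p %| i)%N then q`_(i %/ p) ^+ p else 0.
Proof.
have charP : p \in [pchar {poly k}] by rewrite pchar_poly.
have -> : q ^+ p = \sum_(j < size q) (q`_j ^+ p) *: 'X^(j * p).
  rewrite -{1}[q]coefK poly_def -(pFrobenius_autE charP) rmorph_sum /=.
  by apply: eq_bigr => j _; rewrite pFrobenius_autE exprZn -exprM.
rewrite coef_sum; case: ifP => [/dvdnP[j ->]|ndvd]; last first.
  rewrite big1 // => j _; rewrite coefZ coefXn; case: eqP => [iE|]; rewrite ?mulr0 //.
  by rewrite iE dvdn_mull in ndvd.
rewrite mulnK //; have [lt|ge] := ltnP j (size q).
  rewrite (bigD1 (Ordinal lt)) //= coefZ coefXn eqxx mulr1 big1 ?addr0 // => l.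
  rewrite -val_eqE /= coefZ coefXn eqn_pmul2r // eq_sym => /negPf ->.
  by rewrite mulr0.
rewrite nth_default // expr0n eqn0Ngt p_gt0 /= big1 // => l _.
rewrite coefZ coefXn eqn_pmul2r //; case: eqP => [jl|]; rewrite ?mulr0 //.
by have := ltn_ord l; rewrite -jl ltnNge ge.
Qed.

(** A polynomial with zero derivative only has exponents divisible by p, and
    its coefficients have p-th roots in k. *)
Lemma poly_der0 q : q^`() = 0 -> exists r, q = r ^+ p.
Proof.
move=> q0; exists (\poly_(j < size q) sval (cid (p_root q`_(j * p)))).
apply/polyP => i; rewrite coef_expp; case: ifP => [/dvdnP[j ->]|ndvd].
  rewrite mulnK // coef_poly; case: ifP => [_|/negbT]; first by case: cid.
  rewrite -leqNgt => le; rewrite expr0n eqn0Ngt p_gt0 /= nth_default //.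
  by rewrite (leq_trans le) // leq_pmulr.
case: i ndvd => [|i ndvd]; first by rewrite dvdn0.
have := congr1 (fun r : {poly k} => r`_i) q0;
  rewrite coef_deriv coef0 -mulr_natr => /eqP.
by rewrite mulf_eq0 -(dvdn_pcharf charp) ndvd orbF => /eqP.
Qed.

(** With d ^ (p - 1) the denominator becomes a p-th power, which derivations
    treat as a constant: this reduces DK to the derivation of polynomials. *)
Lemma frac_expp f : exists q c, c != 0 /\ f = q%:F / c ^+ p.
Proof.
have [n [d [d0 ->]]] := fracP f.
exists (n * d ^+ p.-1), d%:F; rewrite tf_eq0; split=> //.
rewrite -{2}(prednK p_gt0) exprS rmorphM rmorphXn.
by field; rewrite expf_neq0 tf_eq0.
Qed.

Lemma DK_ker f : DK f = 0 -> exists g, f = g ^+ p.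
Proof.
have [q [c [c0 ->]]] := frac_expp f => /eqP.
rewrite (derMc derivation_DK); last first.
  by rewrite -exprVn (der_char derivation_DK) // charK.
rewrite mulf_eq0 invr_eq0 expf_eq0 (negPf c0) andbF orbF DK_poly tf_eq0.
move=> /eqP/poly_der0[r ->]; exists (r%:F / c).
by rewrite exprMn exprVn rmorphXn.
Qed.

Lemma derivnp0 q : q^`(p) = 0.
Proof.
apply/polyP => i; rewrite coef_derivn coef0.
rewrite -mulr_natr (_ : _%:R = 0) ?mulr0 //; apply/eqP.
rewrite -(dvdn_pcharf charp) -bin_ffact dvdn_mull // dvdn_fact // p_gt0 leqnn //.
Qed.

Lemma iter_DKp f : iter p DK f = 0.
Proof.
have [q [c [c0 ->]]] := frac_expp f.
rewrite (iter_derMc derivation_DK); last first.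
  by rewrite -exprVn (der_char derivation_DK) // charK.
by rewrite iter_DK_poly derivnp0 rmorph0 mul0r.
Qed.

End RationalDerivation.

(** * Logarithmic derivatives in characteristic p *)

Section LogarithmicDerivatives.
Variables (F : fieldType) (D : F -> F) (p : nat).
Hypotheses (hD : derivation D) (charF : p \in [pchar F]).

Definition twist (h f : F) := D f + h * f.

(** If D f = h * f, this is D^m f / f. *)
Definition bell (h : F) m := iter m (twist h) 1.

Lemma bell_dlog h f m : D f = h * f -> bell h m * f = iter m D f.
Proof.
move=> Df; elim: m => [|m IH]; first by rewrite mul1r.
by rewrite /= -IH (derM hD) Df /twist; ring.
Qed.

Section Jacobson.
Variable h : F.

Let T (P : {poly F}) := map_poly D P + 'X * (h *: P).
(* The polynomial in t whose value at a constant t is bell (t * h) m. *)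
Let pbell m := iter m T 1.

Let coef_mapD (P : {poly F}) i : (map_poly D P)`_i = D P`_i.
Proof. by rewrite coef_map_id0 // (der0 hD). Qed.

Let coefT P i : (T P)`_i = D P`_i + (if i is j.+1 then h * P`_j else 0).
Proof. by rewrite coefD coefXM coef_mapD; case: i => [|i] //=; rewrite coefZ. Qed.

Let TD P R : T (P + R) = T P + T R.
Proof.
apply/polyP => i; rewrite [RHS]coefD !coefT coefD (derD hD).
by case: i => [|i]; rewrite ?coefD; ring.
Qed.

Let TZ c P : T (c *: P) = D c *: P + c *: T P.
Proof.
apply/polyP => i; rewrite [RHS]coefD !coefZ !coefT coefZ (derM hD).
by case: i => [|i]; rewrite ?coefZ; ring.
Qed.

Let T0 : T 0 = 0.
Proof. by apply/polyP => -[|i]; rewrite coefT !coef0 (der0 hD) ?mulr0 addr0. Qed.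

Let T_sum m (f : 'I_m -> {poly F}) : T (\sum_i f i) = \sum_i T (f i).
Proof. exact: (big_morph T TD T0). Qed.

Let derivT P : (T P)^`() = T P^`() + h *: P.
Proof.
apply/polyP => i; rewrite coef_deriv coefT [RHS]coefD coefT coefZ coef_deriv mulrnDl.
have DMn c m : D (c *+ m) = D c *+ m.
  by elim: m => [|m IH]; rewrite ?mulr0n ?(der0 hD) // !mulrS (derD hD) IH.
rewrite DMn -addrA; congr (_ + _).
by case: i => [|i]; rewrite ?add0r ?mulr1n // coef_deriv mulrnAr -mulrSr.
Qed.

Let deriv_pbell m : (pbell m)^`() =
  \sum_(i < m) ((iter i D h *+ 'C(m, i.+1)) *: pbell (m - i.+1)).
Proof.
elim: m => [|m IH]; first by rewrite big_ord0 /= derivC.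
rewrite [pbell m.+1]/(T (pbell m)) derivT IH T_sum.
transitivity (\sum_(i < m.+1) (iter i D h *+ 'C(m, i.+1)) *: pbell (m - i)
            + \sum_(i < m.+1) (iter i D h *+ 'C(m, i)) *: pbell (m - i)); last first.
  rewrite -big_split /=; apply: eq_bigr => i _.
  by rewrite -scalerDl -mulrnDr binS subSS.
rewrite big_ord_recr /= bin_small // mulr0n scale0r addr0.
rewrite [X in _ = _ + X]big_ord_recl /= bin0 subn0 mulr1n addrCA addrC.
congr (_ + _); rewrite -big_split /=; apply: eq_bigr => i _.
have DMn c n : D (c *+ n) = D c *+ n.
  by elim: n => [|n IHn]; rewrite ?mulr0n ?(der0 hD) // !mulrS (derD hD) IHn.
rewrite TZ DMn addrC /bump /= add1n; congr (_ *: _ + _).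
rewrite -[T (pbell _)]/(pbell (m - i.+1).+1); congr (_ *: pbell _).
by rewrite subnSK.
Qed.

Let size_pbell m : (size (pbell m) <= m.+1)%N.
Proof.
elim: m => [|m IH]; first by rewrite size_poly1.
apply/leq_sizeP => -[//|j] mj; rewrite [pbell _]/(T (pbell m)) coefT.
by rewrite !nth_default ?(der0 hD) ?mulr0 ?addr0 // (leq_trans IH) // ltnW.
Qed.

Let lead_pbell m : (pbell m)`_m = h ^+ m.
Proof.
elim: m => [|m IH]; first by rewrite coef1.
rewrite [pbell _]/(T (pbell m)) coefT IH exprS.
by rewrite nth_default ?size_pbell // (der0 hD) add0r.
Qed.

Let const_pbell m : (pbell m.+1)`_0 = 0.
Proof.
elim: m => [|m IH]; first by rewrite [pbell 1]/(T 1) coefT coef1 (der1 hD) addr0.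
by rewrite [pbell _]/(T (pbell m.+1)) coefT IH (der0 hD) addr0.
Qed.

Let pbell1 m : (pbell m).[1] = bell h m.
Proof.
elim: m => [|m IH]; first by rewrite hornerC.
rewrite [pbell _]/(T (pbell m)) [bell h _]/(twist h (bell h m)) -IH.
rewrite !hornerE /twist; congr (_ + _).
rewrite (horner_coef_wide _ (n := size (pbell m))) ?size_poly //.
rewrite horner_coef (big_morph D (derD hD) (der0 hD)); apply: eq_bigr => i _.
by rewrite coef_mapD !expr1n !mulr1.
Qed.

(** Jacobson's formula, for the operators D and multiplication by h. The left
    side at t * h is a polynomial in t with leading term h^p t^p, whose
    derivative is the constant D^(p-1) h. *)
Lemma jacobson : bell h p = iter p.-1 D h + h ^+ p.
Proof.
have p_prime := pcharf_prime charF; have p1 := prime_gt1 p_prime.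
have dE : (pbell p)^`() = (iter p.-1 D h)%:P.
  rewrite deriv_pbell; case: p p1 p_prime charF => // q q1 q_prime charq.
  rewrite big_ord_recr /= binn subnn mulr1n alg_polyC big1 ?add0r // => i _.
  rewrite -mulr_natr (_ : _%:R = 0) ?mulr0 ?scale0r //; apply/eqP.
  by rewrite -(dvdn_pcharf charq) prime_dvd_bin //= ltnS ltn_ord.
have cE i : (pbell p)`_i.+1 *+ i.+1 = if i == 0%N then iter p.-1 D h else 0.
  by rewrite -coef_deriv dE coefC.
rewrite -pbell1; have -> : pbell p = (iter p.-1 D h) *: 'X + h ^+ p *: 'X^p.
  apply/polyP => i; rewrite coefD !coefZ coefX coefXn.
  have [->|odd_part] := eqVneq i p.
    by rewrite lead_pbell mulr1 gtn_eqF ?mulr0 ?add0r.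
  rewrite mulr0 addr0; case: i odd_part => [|i] odd_part.
    by case: p p1 => // q _; rewrite const_pbell mulr0.
  have [i0|i0] := eqVneq i 0%N.
    by have := cE i; rewrite i0 mulr1n mulr1.
  rewrite (_ : (i.+1 == 1)%N = false) ?mulr0; last by apply/negbTE.
  have [lt|ge] := ltnP i.+1 p; last first.
    by rewrite nth_default // (leq_trans (size_pbell p)) // ltn_neqAle eq_sym odd_part.
  have /eqP := cE i; rewrite (negPf i0) -mulr_natr mulf_eq0 -(dvdn_pcharf charF).
  by rewrite gtnNdvd // orbF => /eqP.
by rewrite !hornerE expr1n mulr1.
Qed.

End Jacobson.

Hypothesis Dp : forall f, iter p D f = 0.

(** As D^p = 0, the operator f |-> D f - h * f is nilpotent on 1 as soon as the
    p-th Bell polynomial of -h vanishes, and so has a kernel. *)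
Lemma dlogP h : odd p ->
  (exists2 f, f != 0 & D f / f = h) <-> iter p.-1 D h + h ^+ p = 0.
Proof.
move=> p_odd; have p0 := prime_gt0 (pcharf_prime charF).
split=> [[f f0 <-]|hp].
  rewrite -jacobson; apply: (mulIf f0).
  by rewrite (bell_dlog (f := f)) ?divfK // Dp mul0r.
have nil : bell (- h) p = 0.
  have iterN m : iter m D (- h) = - iter m D h.
    by elim: m => //= m ->; rewrite (derN hD).
  by rewrite jacobson iterN exprNn -signr_odd p_odd mulN1r -opprD hp oppr0.
have ex : exists m, bell (- h) m == 0 by exists p; rewrite nil.
have [m /eqP m0 min] := ex_minnP ex; case: m m0 min => [|m] m0 min.
  by move/eqP: m0; rewrite oner_eq0.
exists (bell (- h) m); first by apply/negP => /min; rewrite ltnn.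
move: m0; rewrite [bell _ _]/(twist _ (bell (- h) m)) /twist mulNr => /subr0_eq ->.
by rewrite mulfK //; apply/negP => /min; rewrite ltnn.
Qed.

End LogarithmicDerivatives.

(** * Elementary abelian groups *)

Section ElementaryAbelian.
Variables (G : zmodType) (p : nat).
Hypothesis p_prime : prime p.

Lemma mulrn_modn (x : G) m : x *+ p = 0 -> x *+ (m %% p) = x *+ m.
Proof.
move=> xp; rewrite {2}(divn_eq m p) mulrnDr [(_ * p)%N]mulnC mulrnA xp.
by rewrite mul0rn add0r.
Qed.

Lemma mulrn_FpM (x : G) (a b : 'F_p) : x *+ p = 0 -> x *+ (a * b)%R = x *+ (a * b)%N.
Proof. by move=> xp; rewrite /= [X in (_ %% X)%N]Fp_cast // mulrn_modn. Qed.

Section Combination.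
Variables (t : nat) (e : 'I_t -> G).
Hypothesis e_tors : forall i, e i *+ p = 0.

Definition combination (u : 'rV['F_p]_t) : G := \sum_i e i *+ u 0 i.

Lemma combinationB : zmod_morphism combination.
Proof.
have add u v : combination (u + v) = combination u + combination v.
  rewrite -big_split; apply: eq_bigr => i _; rewrite mxE /= -mulrnDr.
  by rewrite [X in (_ %% X)%N]Fp_cast // mulrn_modn.
move=> u v; have := add (u - v) v; rewrite subrK => ->.
by rewrite addrK.
Qed.

Lemma combinationZ (a : 'F_p) u : combination (a *: u) = combination u *+ a.
Proof.
rewrite -sumrMnl; apply: eq_bigr => i _.
by rewrite mxE mulrn_FpM // mulnC mulrnA.
Qed.

Lemma combination_tors u : combination u *+ p = 0.
Proof.
rewrite -sumrMnl big1 // => i _.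
by rewrite -mulrnA mulnC mulrnA e_tors mul0rn.
Qed.

End Combination.

(** A finite p-torsion subgroup with p ^ g elements has a basis with g
    elements: a maximal independent family spans. *)
Lemma elementary_abelian_basis g (L : seq G) :
    uniq L -> (forall x, (x \in L) <-> x *+ p = 0) -> size L = (p ^ g)%N ->
  exists phi : {additive 'rV['F_p]_g -> G},
    injective phi /\ forall x, x *+ p = 0 <-> exists u, phi u = x.
Proof.
move=> uL LP sL; have p1 := prime_gt1 p_prime.
pose indep t := `[< exists e : 'I_t -> G,
  (forall i, e i *+ p = 0) /\ forall u, combination e u = 0 -> u = 0 >].
have bound t e : (forall i : 'I_t, e i *+ p = 0) ->
    (forall u, combination e u = 0 -> u = 0) ->
    uniq [seq combination e u | u : 'rV['F_p]_t] /\
    size [seq combination e u | u : 'rV['F_p]_t] = (p ^ t)%N.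
  move=> et ei; split; last by rewrite size_image card_mx card_Fp // mul1n.
  rewrite map_inj_uniq ?enum_uniq // => u v uv; apply/eqP; rewrite -subr_eq0.
  by apply/eqP/ei; rewrite combinationB // uv subrr.
have sub t e : (forall i : 'I_t, e i *+ p = 0) ->
    {subset [seq combination e u | u : 'rV['F_p]_t] <= L}.
  by move=> et x /mapP[u _ ->]; apply/LP; apply: combination_tors.
have ex : exists t, indep t.
  exists 0%N; apply/asboolP; exists (fun=> 0); split=> [i|u _]; first by rewrite mul0rn.
  by apply/rowP => -[].
have ub t : indep t -> (t <= g)%N.
  move=> /asboolP[e [et ei]]; have [u1 s1] := bound t e et ei.
  by rewrite -(leq_exp2l _ _ p1) -sL -s1; apply: uniq_leq_size (sub t e et).
have [t /asboolP[e [et ei]] max] := ex_maxnP ex ub.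
have span x : x *+ p = 0 -> exists u, combination e u = x.
  move=> xp; apply: contrapT => nspan; suff /max : indep t.+1 by rewrite ltnn.
  apply/asboolP; pose e' i := if unlift ord0 i is Some j then e j else x.
  have et' i : e' i *+ p = 0 by rewrite /e'; case: unlift.
  exists e'; split=> // u; rewrite /combination big_ord_recl /= {1}/e' unlift_none.
  pose v : 'rV['F_p]_t := \row_j u 0 (fintype.lift ord0 j).
  have -> : \sum_(i < t) e' (fintype.lift ord0 i) *+ u 0 (fintype.lift ord0 i) =
    combination e v.
    by apply: eq_bigr => i _; rewrite /e' liftK mxE.
  have [u0|u0] := eqVneq (u 0 ord0) 0.
    rewrite u0 mulr0n add0r => /ei v0; apply/rowP => i; rewrite mxE.
    case: (unliftP ord0 i) => [j ->|->] //.
    by have /rowP/(_ j) := v0; rewrite !mxE.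
  move=> xv; case: nspan; exists (0 - (u 0 ord0)^-1 *: v).
  have comb0 : combination e 0 = 0 by rewrite -(subrr v) combinationB // subrr.
  rewrite combinationB // comb0 combinationZ // sub0r.
  have -> : combination e v = - (x *+ u 0 ord0).
    by apply/eqP; rewrite -addr_eq0 addrC xv.
  by rewrite mulNrn opprK -mulrnA -mulrn_FpM // divff.
have tg : t = g.
  have [u1 s1] := bound t e et ei.
  apply/eqP; rewrite -(eqn_exp2l _ _ p1) -sL -s1 eqn_leq (uniq_leq_size u1 (sub t e
    et)).
  apply: uniq_leq_size uL _ => x /LP/span[u <-]; apply: map_f.
  by rewrite mem_enum.
case: g / tg {bound sL ub} => //;
  pose additive_comb := GRing.isZmodMorphism.Build _ _ _ (combinationB et).
pose phi : {additive 'rV['F_p]_t -> G} := HB.pack (combination e) additive_comb.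
exists phi; split=> [u v uv|x]; last by split=> [/span//|[u <-]];
  apply: combination_tors.
apply/eqP; rewrite -subr_eq0; apply/eqP/ei.
rewrite combinationB //; apply/eqP; rewrite subr_eq0; exact/eqP.
Qed.

End ElementaryAbelian.

(** * Divisor classes *)

Section DivisorClasses.
Variables (k F : fieldType) (kF : {rmorphism k -> F}).

Definition class_of (D : Div0 kF) : Pic0 kF := (\pi_(Pic0 kF) D)%qT.

Lemma class_ofP (x : Pic0 kF) : exists D, class_of D = x.
Proof. by exists (repr x); rewrite /class_of reprK. Qed.

Lemma class_of_eq D E : class_of D = class_of E <->
  exists2 f : F, f != 0 & forall P : place kF, coeff P (divisor (D - E)) = ord P f.
Proof.
have : (D - E \in GRing.ZmodClosed.clone (Div0 kF) (@principal k F kF) _) =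
  `[< exists2 f : F, f != 0 & forall P : place kF, coeff P (divisor (D - E)) =
    ord P f >] by [].
rewrite Quotient.idealrBE => h; split=> [/eqP e|e].
  by apply/asboolP; rewrite -h.
by apply/eqP; rewrite /class_of h; apply/asboolP.
Qed.

Lemma class_ofMn D m : class_of (D *+ m) = class_of D *+ m.
Proof. exact: raddfMn. Qed.

Lemma class_of0 : class_of 0 = 0.
Proof. exact: raddf0. Qed.

End DivisorClasses.

(** * Quadratic extensions *)

Lemma uniq_flatten_map (I T : eqType) (s : seq I) (t : I -> seq T) : uniq s ->
  (forall i, uniq (t i)) -> (forall i j x, x \in t i -> x \in t j -> i = j) ->
  uniq (flatten (map t s)).
Proof.
move=> us ut inj; elim: s us => //= i s IH /andP[si /IH us].
rewrite cat_uniq ut us andbT /=; apply/hasPn => x /flatten_mapP[j js xj].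
by apply: contra si => xi; rewrite (inj i j x xi xj).
Qed.

(** The polynomial is separable, as n is prime to p. *)
Lemma mup_XnD1 (k : fieldType) (p n : nat) b : p \in [pchar k] -> ~~ (p %| n)%N ->
  (0 < n)%N -> (mup b ('X^n + 1 : {poly k}) < 2)%N.
Proof.
move=> charp pn n_gt0.
have q_neq0 : ('X^n + 1 : {poly k}) != 0.
  by rewrite -size_poly_gt0 -polyC1 size_XnaddC.
rewrite ltnNge mup_geq //; apply/negP => /dvdpP[r qE].
have qb : root ('X^n + 1) b by rewrite qE rootM root_exp_XsubC eqxx orbT.
have qb' : root ('X^n + 1)^`() b.
  rewrite qE derivM deriv_exp derivXsubC mul1r rootE !hornerE subrr.
  by rewrite expr0n /=; apply/eqP; ring.
move: qb'; rewrite derivD -polyC1 derivC addr0 derivXn rootE hornerMn hornerXn.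
rewrite -mulr_natr mulf_eq0 expf_eq0 -(dvdn_pcharf charp) (negPf pn) orbF.
case/andP=> n1 /eqP b0; move: qb; rewrite rootE !hornerE b0 expr0n.
by rewrite gtn_eqF // add0r oner_eq0.
Qed.

Section Quadratic.
Variables (k : closedFieldType) (K : fieldType) (tf : {rmorphism {poly k} -> K}).
Local Notation "x %:F" := (tf x).
Hypothesis tf_inj : injective tf.
Hypothesis fracP : forall f : K, exists n d, d != 0 /\ f = n%:F / d%:F.
Local Notation tf_eq0 := (tf_eq0 tf_inj).
Local Notation w := (placeK tf_inj fracP).
Local Notation DK := (DK fracP).
Local Notation unif := (unif tf).
Variable p : nat.
Hypotheses (charp : p \in [pchar k]) (p_odd : odd p).
Variables (F : fieldType) (kF : {rmorphism k -> F}) (iota : {rmorphism K -> F}).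
Hypothesis kFE : forall c, kF c = iota (cst tf c).
Variables (y : F) (Q : K).
Hypothesis y2 : y ^+ 2 = iota Q.
Hypothesis decF : forall f, exists A B, f = iota A + iota B * y.
Hypothesis indF : forall A B, iota A + iota B * y = 0 -> A = 0 /\ B = 0.
Implicit Types (f g : F) (A B : K) (P : place kF) (i : option k).

Let p_prime : prime p := pcharf_prime charp.
Let p_gt0 : (0 < p)%N := prime_gt0 p_prime.

Lemma two_neq0 : 2%:R != 0 :> k.
Proof.
apply/negP; rewrite -(dvdn_pcharf charp) => /dvdn_leq.
by have := prime_gt1 p_prime; case: p p_odd => [|[|[|]]] //= *; auto.
Qed.

Lemma two_neq0F : 2%:R != 0 :> F.
Proof. by rewrite -(rmorph_nat kF) fmorph_eq0 two_neq0. Qed.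

Lemma charF : p%:R = 0 :> F.
Proof. by rewrite -(rmorph_nat kF) (pcharf0 charp) rmorph0. Qed.

Lemma charFE (m : int) : (m%:~R == 0 :> F) = (p %| `|m|)%N.
Proof.
have cF : p \in [pchar F] by rewrite (fmorph_pchar kF).
by case: m => m; rewrite /= ?NegzE ?mulrNz ?oppr_eq0 -pmulrn -(dvdn_pcharf cF).
Qed.

Lemma y_neq0 : y != 0.
Proof.
apply/eqP => y0; have := @indF 0 1; rewrite y0 mulr0 addr0 rmorph0.
by case=> // _ /eqP; rewrite oner_eq0.
Qed.

Lemma Q_neq0 : Q != 0.
Proof. by rewrite -(fmorph_eq0 iota) -y2 expf_neq0 ?y_neq0. Qed.

Lemma indF2 A B A' B' :
  iota A + iota B * y = iota A' + iota B' * y -> A = A' /\ B = B'.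
Proof.
move=> e; have [|/subr0_eq-> /subr0_eq->//] := @indF (A - A') (B - B').
transitivity (iota A + iota B * y - (iota A' + iota B' * y)).
  by rewrite !rmorphB; ring.
by rewrite e subrr.
Qed.

(** ** Conjugation and norm *)

Definition even_part f : K := sval (cid (decF f)).
Definition odd_part f : K := sval (cid (svalP (cid (decF f)))).

Lemma decE f : f = iota (even_part f) + iota (odd_part f) * y.
Proof. by rewrite /odd_part /even_part; case: cid => A /= h; case: cid. Qed.

Lemma even_partE A B : even_part (iota A + iota B * y) = A.
Proof. by have /esym/indF2[-> _] := decE (iota A + iota B * y). Qed.

Lemma odd_partE A B : odd_part (iota A + iota B * y) = B.
Proof. by have /esym/indF2[_ ->] := decE (iota A + iota B * y). Qed.

Definition conj f := iota (even_part f) - iota (odd_part f) * y.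
Definition norm f := even_part f ^+ 2 - odd_part f ^+ 2 * Q.

Lemma conjE A B : conj (iota A + iota B * y) = iota A - iota B * y.
Proof. by rewrite /conj even_partE odd_partE. Qed.

Lemma conj_iota A : conj (iota A) = iota A.
Proof. by have := conjE A 0; rewrite rmorph0 mul0r subr0 addr0. Qed.

Lemma conjD f g : conj (f + g) = conj f + conj g.
Proof.
rewrite (decE f) (decE g) !conjE.
set A := even_part f; set B := odd_part f; set A' := even_part g; set B' := odd_part g.
have -> : iota A + iota B * y + (iota A' + iota B' * y) =
          iota (A + A') + iota (B + B') * y by rewrite !rmorphD; ring.
by rewrite conjE !rmorphD; ring.
Qed.

Lemma mulF A B A' B' : (iota A + iota B * y) * (iota A' + iota B' * y) =
  iota (A * A' + B * B' * Q) + iota (A * B' + A' * B) * y.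
Proof. by rewrite !rmorphD !rmorphM -y2; ring. Qed.

Lemma conjM f g : conj (f * g) = conj f * conj g.
Proof.
rewrite (decE f) (decE g) mulF !conjE.
set A := even_part f; set B := odd_part f; set A' := even_part g; set B' := odd_part g.
by rewrite !rmorphD !rmorphM -y2; ring.
Qed.

Lemma conjK f : conj (conj f) = f.
Proof.
rewrite {2}/conj -mulNr -rmorphN conjE rmorphN mulNr opprK.
by rewrite -decE.
Qed.

Lemma conj_eq0 f : (conj f == 0) = (f == 0).
Proof.
have c0 : conj 0 = 0 by rewrite -(rmorph0 iota) conj_iota.
by apply/eqP/eqP => [h|->//]; rewrite -(conjK f) h c0.
Qed.

Lemma mul_conj f : f * conj f = iota (norm f).
Proof.
by rewrite {1}(decE f) /conj /norm rmorphB !rmorphM -y2; ring.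
Qed.

Lemma add_conj f : f + conj f = iota (even_part f *+ 2).
Proof. by rewrite {1}(decE f) /conj rmorphMn mulr2n; ring. Qed.

Lemma norm_neq0 f : f != 0 -> norm f != 0.
Proof. by move=> f0; rewrite -(fmorph_eq0 iota) -mul_conj mulf_neq0 ?conj_eq0. Qed.

Lemma conj_place_axioms P : valuation_axioms kF (fun f => ord P (conj f)).
Proof.
split.
- by rewrite -(rmorph0 iota) conj_iota rmorph0 place_ord0.
- by move=> f g f0 g0; rewrite conjM ordM ?conj_eq0.
- move=> f g f0 g0 fg0; rewrite conjD; apply: (val_add (ordP P)).
  + by rewrite conj_eq0.
  + by rewrite conj_eq0.
  + by rewrite -conjD conj_eq0.
- by move=> c c0; rewrite kFE conj_iota -kFE ord_const.
- by have [t t0 t1] := val_uniformizer (ordP P); exists (conj t);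
  rewrite ?conj_eq0 ?conjK.
Qed.

Definition conj_place P : place kF := Place (conj_place_axioms P).

Lemma ord_conj_place P f : ord (conj_place P) f = ord P (conj f).
Proof. by []. Qed.

Lemma vge_conj_place P m f : vge (conj_place P) m f = vge P m (conj f).
Proof. by rewrite /vge conj_eq0. Qed.

(** ** The derivation d/dx of the extension *)

(** The generator z = y ^ p = y * Q ^ ((p - 1) / 2) has zero derivative, so that
    the extension of the derivation acts on coordinates. *)
Let h := p./2.
Let z := y ^+ p.

Lemma p_half : p = (2 * h).+1.
Proof. by rewrite /h -{1}(odd_double_half p) p_odd -mul2n. Qed.

Lemma yp : z = y * iota Q ^+ h.
Proof. by rewrite /z p_half exprS exprM y2. Qed.

Lemma z2 : z ^+ 2 = iota (Q ^+ p).
Proof. by rewrite /z rmorphXn -y2 -!exprM mulnC. Qed.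

Definition DF f : F := iota (DK (even_part f)) + iota (DK (odd_part f / Q ^+ h)) * z.

Lemma dec_z f : exists A B, f = iota A + iota B * z.
Proof.
exists (even_part f), (odd_part f / Q ^+ h); rewrite {1}(decE f); congr (_ + _).
rewrite yp fmorph_div rmorphXn.
have q0 : iota Q ^+ h != 0 by rewrite expf_neq0 // fmorph_eq0 Q_neq0.
by field.
Qed.

Lemma DFE A B : DF (iota A + iota B * z) = iota (DK A) + iota (DK B) * z.
Proof.
have -> : iota A + iota B * z = iota A + iota (B * Q ^+ h) * y.
  by rewrite yp rmorphM rmorphXn; ring.
by rewrite /DF even_partE odd_partE mulfK // expf_neq0 ?Q_neq0.
Qed.

Lemma derivation_DF : derivation DF.
Proof.
have hK := derivation_DK tf_inj fracP.
split=> f g; have [A [B ->]] := dec_z f; have [A' [B' ->]] := dec_z g.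
  have -> : iota A + iota B * z + (iota A' + iota B' * z) =
            iota (A + A') + iota (B + B') * z by rewrite !rmorphD; ring.
  by rewrite !DFE !(derD hK) !rmorphD; ring.
have -> : (iota A + iota B * z) * (iota A' + iota B' * z) =
          iota (A * A' + B * B' * Q ^+ p) + iota (A * B' + B * A') * z.
  by rewrite !rmorphD !rmorphM -z2; ring.
rewrite !DFE !(derD hK) (derMc hK (B * B')); last first.
  by rewrite (der_char hK) // (charK tf charp).
rewrite !(derM hK) !rmorphD !rmorphM !rmorphD !rmorphM -z2.
move: (iota A) (iota A') (iota B) (iota B') => a a' b b'.
by move: (iota (DK A)) (iota (DK A')) (iota (DK B)) (iota (DK B')) => *; ring.
Qed.

Lemma DF_iota A : DF (iota A) = iota (DK A).
Proof.
have := DFE A 0; rewrite rmorph0 mul0r addr0 (der0 (derivation_DK tf_inj fracP)).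
by rewrite rmorph0 mul0r addr0.
Qed.

Lemma DF_ker f : DF f = 0 -> exists g, f = g ^+ p.
Proof.
have [A [B ->]] := dec_z f; rewrite DFE yp.
have -> : iota (DK A) + iota (DK B) * (y * iota Q ^+ h) =
          iota (DK A) + iota (DK B * Q ^+ h) * y.
  by rewrite rmorphM rmorphXn; ring.
case/indF => /(DK_ker tf_inj charp)[a ->] /eqP.
rewrite mulf_eq0 expf_eq0 (negPf Q_neq0) andbF orbF => /eqP.
case/(DK_ker tf_inj charp)=> [b ->]; exists (iota a + iota b * y).
have cF : p \in [pchar F] by rewrite (fmorph_pchar kF).
rewrite exprDn_pchar ?pnatE //.
by rewrite exprMn -/z yp !rmorphXn.
Qed.

Lemma iter_DFE m A B :
  iter m DF (iota A + iota B * z) = iota (iter m DK A) + iota (iter m DK B) * z.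
Proof. by elim: m => //= m ->; rewrite DFE. Qed.

Lemma iter_DFp f : iter p DF f = 0.
Proof.
have [A [B ->]] := dec_z f.
by rewrite iter_DFE !iter_DKp // rmorph0 mul0r addr0.
Qed.

(** ** Places of the extension *)

Definition lies_over P i (e : int) :=
  forall A, ord P (iota A) = e * ord (w i) A.

Lemma lies_over_vge P i e m A : 0 <= e -> lies_over P i e ->
  vge (w i) m A -> vge P (e * m) (iota A).
Proof.
move=> e0 PE; rewrite /vge fmorph_eq0 => /orP[->//|mA].
by rewrite PE ler_wpM2l ?orbT.
Qed.

Lemma lies_over_value P i e A c : 0 < e -> lies_over P i e ->
  has_value (w i) A c -> has_value P (iota A) c.
Proof.
move=> e0 PE /(lies_over_vge (ltW e0) PE); rewrite mulr1 rmorphB -kFE.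
by apply: vge_trans; rewrite -gtz0_ge1.
Qed.

Lemma lies_over_poly P i e :
  (forall q, q != 0 -> ord P (iota q%:F) = e * ord (w i) q%:F) ->
  lies_over P i e.
Proof.
move=> PE A; have [n [d [d0 ->]]] := fracP A.
have [->|n0] := eqVneq n 0.
  by rewrite rmorph0 mul0r rmorph0 !place_ord0 mulr0.
rewrite ordK_frac // fmorph_div ordF ?fmorph_eq0 ?tf_eq0 // !PE //.
by rewrite mulrBr.
Qed.

Lemma vge_poly P q : vge P 0 (iota 'X%:F) -> vge P 0 (iota q%:F).
Proof.
move=> X0; elim/poly_ind: q => [|q c IH]; first by rewrite !rmorph0 vge0.
rewrite rmorphD rmorphM rmorphD rmorphM vgeD ?vgeMl //.
by rewrite -[c%:P%:F]/(cst tf c) -kFE vge_const.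
Qed.

(** A place that is trivial on K is trivial on the algebraic extension F: if t
    had order 1, its conjugate would have order -1 by the norm and order at
    least 0 by the trace. *)
Lemma place_nontrivial P : exists2 q, q != 0 & ord P (iota q%:F) != 0.
Proof.
apply: contrapT => triv.
have {}triv q : q != 0 -> ord P (iota q%:F) = 0.
  by move=> q0; apply/eqP/negP => /negP h'; apply: triv; exists q.
have trivK A : ord P (iota A) = 0.
  have : lies_over P None 0 by apply: lies_over_poly => q q0; rewrite triv ?mul0r.
  by move=> ->; rewrite mul0r.
have vK A : vge P 0 (iota A) by rewrite /vge trivK lexx orbT.
have [t t0 t1] := val_uniformizer (ordP P).
have : vge P 0 (conj t).
  have -> : conj t = iota (even_part t *+ 2) - t by rewrite -add_conj; ring.
  by rewrite vgeB // vgeE // t1.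
rewrite vgeE ?conj_eq0 // => c0.
have := trivK (norm t); rewrite -mul_conj ordM ?conj_eq0 // t1.
by move: (ord P _) c0 => c c0; lia.
Qed.

(** The place below P is infinity if x has a pole at P; otherwise it is the
    zero of some x - a, as P is not trivial on k[x]. *)
Lemma lies_overP P : exists i (e : int), 0 < e /\ lies_over P i e.
Proof.
have X0 : iota 'X%:F != 0 by rewrite fmorph_eq0 tf_eq0 polyX_eq0.
have [vX|vX] := boolP (vge P 0 (iota 'X%:F)); last first.
  rewrite vgeE // -ltNge in vX; exists None, (- ord P (iota 'X%:F)).
  split; first by rewrite oppr_gt0.
  apply: lies_over_poly => q q0; rewrite ord_inf // mulrNN.
  elim/poly_ind: q q0 => [|q c IH]; first by rewrite eqxx.
  have [->|q0] := eqVneq q 0.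
    rewrite mul0r add0r => c0; rewrite -[c%:P%:F]/(cst tf c) -kFE ord_const.
    by rewrite size_polyC; case: (c != 0); rewrite mulr0.
  move=> _; rewrite size_MXaddC (negPf q0) /= rmorphD rmorphM rmorphD rmorphM.
  have qF0 : iota q%:F != 0 by rewrite fmorph_eq0 tf_eq0.
  have qX0 := mulf_neq0 qF0 X0.
  have oqX : ord P (iota q%:F * iota 'X%:F) = ord P (iota 'X%:F) * (size q)%:Z.
    rewrite ordM // IH //.
    have -> : (size q)%:Z = (size q).-1%:Z + 1.
      by move: q0; rewrite -size_poly_gt0; set s := size q; lia.
    by ring.
  suff /(ordD qX0)[_ ->] : vge P (ord P (iota q%:F * iota 'X%:F) + 1) (iota c%:P%:F).
    exact: oqX.
  rewrite -[c%:P%:F]/(cst tf c) -kFE oqX; apply: vge_trans (vge_const _ _).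
  have := q0; rewrite -size_poly_gt0; move: (ord P _) vX (size q) => a a0 s s0.
  by case: s s0 => // s _; rewrite intS mulrDr mulr1;
    have := mulr_le0_ge0 (ltW a0) (isT : 0 <= s%:Z); lia.
have [a a0] : exists a, 0 < ord P (iota ('X - a%:P)%:F).
  apply: contrapT => none; have [q q0] := place_nontrivial P.
  have [s qE] := closed_field_poly_normal q; case/eqP.
  rewrite qE -mul_polyC rmorphM rmorphM ordM; last first.
  - rewrite fmorph_eq0 tf_eq0 monic_neq0 ?monic_prod_XsubC //.
  - by rewrite fmorph_eq0 tf_eq0 polyC_eq0 lead_coef_eq0.
  rewrite -[_%:P%:F]/(cst tf _) -kFE ord_const add0r.
  elim: s {qE} => [|a s IH]; first by rewrite big_nil !rmorph1 place_ord1.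
  rewrite big_cons rmorphM rmorphM ordM ?IH ?addr0; last first.
  - by rewrite fmorph_eq0 tf_eq0 monic_neq0 ?monic_prod_XsubC.
  - by rewrite fmorph_eq0 tf_eq0 polyXsubC_eq0.
  have := vge_poly ('X - a%:P) vX.
  rewrite vgeE ?fmorph_eq0 ?tf_eq0 ?polyXsubC_eq0 // le_eqVlt => /orP[/eqP//|pos].
  by case: none; exists a.
exists (Some a), (ord P (iota ('X - a%:P)%:F)); split=> //.
apply: lies_over_poly => q q0; rewrite ord_at //.
have [r qE ra] := poly_fact a q0.
have x0 : iota ('X - a%:P)%:F != 0 by rewrite fmorph_eq0 tf_eq0 polyXsubC_eq0.
have rv : has_value P (iota r%:F) r.[a].
  rewrite /has_value kFE -rmorphB -[cst tf _]/(_%:P%:F) -rmorphB.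
  have : root (r - r.[a]%:P) a by rewrite rootE !hornerE subrr.
  case/factor_theorem => s ->; rewrite rmorphM rmorphM mulrC.
  by apply: vgeMr (vge_poly s vX); rewrite vgeE // -gtz0_ge1.
have [r0 r1] := has_value_ord0 rv ra.
by rewrite {1}qE rmorphM rmorphM !rmorphXn ordM ?expf_neq0 // r1 addr0 ordX.
Qed.

(** The equation is normalised at i, so that the right-hand side of
    yn i ^ 2 = qn i is a unit or a uniformiser. *)
Definition scale i : K := unif i ^ (- (ord (w i) Q %/ 2)%Z).
Definition yn i : F := y * iota (scale i).
Definition qn i : K := Q * scale i ^+ 2.

Lemma unif_neq0K i : unif i != 0.
Proof. exact: unif_neq0 (local_ring_spec tf_inj fracP i). Qed.

Lemma scale_neq0 i : scale i != 0.
Proof. by rewrite expfz_neq0 ?unif_neq0K. Qed.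

Lemma qn_neq0 i : qn i != 0.
Proof. by rewrite mulf_neq0 ?Q_neq0 ?expf_neq0 ?scale_neq0. Qed.

Lemma yn2 i : yn i ^+ 2 = iota (qn i).
Proof. by rewrite exprMn y2 rmorphM rmorphXn. Qed.

Lemma yn_neq0 i : yn i != 0.
Proof. by rewrite mulf_neq0 ?y_neq0 ?fmorph_eq0 ?scale_neq0. Qed.

Lemma ord_scale i : ord (w i) (scale i) = - (ord (w i) Q %/ 2)%Z.
Proof. by rewrite ordXz ?unif_neq0K // ord_unif mul1r. Qed.

Lemma ord_qn i : ord (w i) (qn i) = (ord (w i) Q %% 2)%Z.
Proof.
rewrite ordM ?Q_neq0 ?expf_neq0 ?scale_neq0 // ordX ?scale_neq0 // ord_scale.
by rewrite {1}(divz_eq (ord (w i) Q) 2) mulNr addrAC subrr add0r.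
Qed.

Lemma dec_yn i f : exists A B, f = iota A + iota B * yn i.
Proof.
exists (even_part f), (odd_part f / scale i);
  rewrite {1}(decE f) /yn fmorph_div mulrCA mulrC.
congr (_ + _); have s0 : iota (scale i) != 0 by rewrite fmorph_eq0 scale_neq0.
by field.
Qed.

Lemma ind_yn i A B : iota A + iota B * yn i = 0 -> A = 0 /\ B = 0.
Proof.
have -> : iota B * yn i = iota (B * scale i) * y by rewrite /yn rmorphM; ring.
case/indF => -> /eqP.
by rewrite mulf_eq0 (negPf (scale_neq0 i)) orbF => /eqP ->.
Qed.

Lemma mul_yn i A B A' B' :
  (iota A + iota B * yn i) * (iota A' + iota B' * yn i) =
  iota (A * A' + B * B' * qn i) + iota (A * B' + A' * B) * yn i.
Proof.
move: (yn i) (qn i) (yn2 i) => u q uq.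
by rewrite !rmorphD !rmorphM -uq; ring.
Qed.

Lemma conj_yn i A B : conj (iota A + iota B * yn i) = iota A - iota B * yn i.
Proof.
have -> : iota B * yn i = iota (B * scale i) * y by rewrite /yn rmorphM; ring.
exact: conjE.
Qed.

Lemma DF_yn i : 2%:R * yn i * DF (yn i) = iota (DK (qn i)).
Proof.
by rewrite -DF_iota -yn2 (derX derivation_DF) expr1 -mulr_natr; ring.
Qed.

(** At a place of ramification index e above i, dx has order
    - e * pole_dx i + (e - 1), since the extension is tame. The number below is
    the opposite: u dx is regular at the place if u has at least this order, and
    D t = dt / dx has exactly this order for a uniformiser t. *)
Definition ord_der i (e : int) : int := e * pole_dx i - (e - 1).

Record fibre_point P i (e : int) : Prop := FibrePoint {
  fp_index : e = 1 \/ e = 2;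
  fp_over : lies_over P i e;
  fp_yn : ord P (yn i) = e - 1;
  fp_bound : forall f, vge P 0 f -> vge P (ord_der i e) (DF f);
  fp_unif : exists t, [/\ t != 0, ord P t = 1, DF t != 0 & ord P (DF t) = ord_der i e]
}.

Let unit_part i A : A != 0 ->
  exists2 a, has_value (w i) (A / unif i ^ ord (w i) A) a & a != 0.
Proof.
move=> A0; have u0 := unif_neq0K i.
have o0 : ord (w i) (A / unif i ^ ord (w i) A) = 0.
  by rewrite ordF ?expfz_neq0 // ordXz // ord_unif mul1r subrr.
have n0 : A / unif i ^ ord (w i) A != 0 by rewrite mulf_neq0 ?invr_eq0 ?expfz_neq0.
have [|a av] := @placeK_value _ _ _ tf_inj fracP i (A / unif i ^ ord (w i) A).
  by rewrite vgeE // o0.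
exists a => //; apply/eqP => a0; move: av; rewrite a0 has_value0 vgeE // o0 //.
Qed.

Section Split.
Variables (i : option k) (b : k).
Hypotheses (b0 : b != 0) (qb : has_value (w i) (qn i) (b ^+ 2)).

(** If qn i is a unit at i, each square root b of its value gives a place,
    where yn i specialises to b. *)
Definition spec_split (f : F) (c : k) := exists A B alpha beta,
  [/\ f = iota A + iota B * yn i, has_value (w i) A alpha,
      has_value (w i) B beta & c = alpha + beta * b].

Lemma spec_split_iota A a : has_value (w i) A a -> spec_split (iota A) a.
Proof.
move=> Aa; exists A, 0, a, 0; split; rewrite ?rmorph0 ?mul0r ?addr0 //.
by rewrite has_value0 vge0.
Qed.

Lemma local_ring_split : local_ring kF spec_split (iota (unif i)).
Proof.
split.
- by move=> c; rewrite kFE; apply: spec_split_iota; apply: has_value_const.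
- move=> f g c d [A [B [al [be [-> Aa Bb ->]]]]] [A' [B' [al' [be' [-> Aa' Bb' ->]]]]].
  exists (A + A'), (B + B'), (al + al'), (be + be').
  split; [by rewrite !rmorphD; ring|exact: has_valueD|exact: has_valueD|by ring].
- move=> f g c d [A [B [al [be [-> Aa Bb ->]]]]] [A' [B' [al' [be' [-> Aa' Bb' ->]]]]].
  exists (A * A' + B * B' * qn i), (A * B' + A' * B).
  exists (al * al' + be * be' * b ^+ 2), (al * be' + al' * be).
  split; [exact: mul_yn| | |by ring].
    by apply: has_valueD; apply: has_valueM => //; apply: has_valueM.
  by apply: has_valueD; apply: has_valueM.
- move=> c [A [B [al [be [/esym/ind_yn[-> ->] A0 B0 ->]]]]].
  have v0 : has_value (w i) 0 0 by rewrite has_value0 vge0.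
  by rewrite (has_value_inj A0 v0) (has_value_inj B0 v0) mul0r addr0.
- by rewrite fmorph_eq0 unif_neq0K.
- apply: spec_split_iota; rewrite has_value0 vgeE ?unif_neq0K // ord_unif //.
move=> f f0.
have u0 := unif_neq0K i.
(* Dividing f by a power of the uniformiser makes it primitive. A primitive
   element that vanishes at b does not vanish at - b, so that its norm
   carries its order. *)
have [m [A [B [al [be [fE Aa Bb ab]]]]]] : exists m A B al be,
    [/\ f = iota (unif i ^ m) * (iota A + iota B * yn i),
        has_value (w i) A al, has_value (w i) B be & (al != 0) || (be != 0)].
  have [A [B fE]] := dec_yn i f.
  have pull m : f = iota (unif i ^ m) *
      (iota (A / unif i ^ m) + iota (B / unif i ^ m) * yn i).
    have um0 : iota (unif i ^ m) != 0 by rewrite fmorph_eq0 expfz_neq0.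
    by rewrite fE !fmorph_div; move: (iota (unif i ^ m)) um0 => u um0; field.
  have low m C : ((C == 0) || (m <= ord (w i) C)) ->
      exists c, has_value (w i) (C / unif i ^ m) c.
    move=> h'; apply: placeK_value; rewrite mulrC vge_mul ?invr_eq0 ?expfz_neq0 //.
    by rewrite sub0r ordV opprK ordXz // ord_unif mul1r.
  have [B0|B0] := eqVneq B 0; last have [A0|A0] := eqVneq A 0.
  - have A0 : A != 0.
      by apply: contraNneq f0 => A0; rewrite fE A0 B0 !rmorph0 mul0r addr0.
    have [a av a0] := unit_part i A0;
      exists (ord (w i) A), (A / unif i ^ ord (w i) A), 0, a, 0.
    split; rewrite ?a0 //; last by rewrite has_value0 vge0.
    by rewrite {1}(pull (ord (w i) A)) B0 mul0r.
  - have [a av a0] := unit_part i B0;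
    exists (ord (w i) B), 0, (B / unif i ^ ord (w i) B), 0, a.
    split; rewrite ?a0 ?orbT //; first by rewrite {1}(pull (ord (w i) B)) A0 mul0r.
    by rewrite has_value0 vge0.
  have [le|/ltW le] := leP (ord (w i) A) (ord (w i) B).
    have [a av a0] := unit_part i A0; have [|c cv] := low (ord (w i) A) B.
      by rewrite le orbT.
    exists (ord (w i) A), (A / unif i ^ ord (w i) A), (B / unif i ^ ord (w i) A), a, c.
    by split; rewrite ?a0 // -pull.
  have [a av a0] := unit_part i B0; have [|c cv] := low (ord (w i) B) A.
    by rewrite le orbT.
  exists (ord (w i) B), (A / unif i ^ ord (w i) B), (B / unif i ^ ord (w i) B), c, a.
  by split; rewrite ?a0 ?orbT // -pull.
have E1 : spec_split 1 1.
  by rewrite -(rmorph1 iota); apply: spec_split_iota; rewrite -(rmorph1 (cst tf));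
    apply: has_value_const.
have [c0|c0] := eqVneq (al + be * b) 0; last first.
  exists m, (iota A + iota B * yn i), 1, (al + be * b), 1; rewrite oner_neq0.
  split=> //; first by exists A, B, al, be.
  by rewrite mulr1 fE fmorphXz.
have d0 : al - be * b != 0.
  apply: contraL ab => /eqP d0; have /eqP : 2%:R * al = 0.
    transitivity ((al + be * b) + (al - be * b)); first by ring.
    by rewrite c0 d0 addr0.
  rewrite mulf_eq0 (negPf two_neq0) /= => /eqP al0.
  move: c0; rewrite al0 add0r => /eqP; rewrite mulf_eq0 (negPf b0) orbF => ->.
  by rewrite eqxx.
set g := iota A + iota B * yn i in fE.
have g0 : g != 0 by apply: contraNneq f0 => g0; rewrite fE g0 mulr0.
have n0 := norm_neq0 g0; have [nu nv nu0] := unit_part i n0.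
exists (m + ord (w i) (norm g)), (iota (norm g / unif i ^ ord (w i) (norm g))).
exists (conj g), nu, (al - be * b); split=> //.
- exact: spec_split_iota.
- exists A, (- B), al, (- be); rewrite mulNr; split=> //; last exact: has_valueN.
  by rewrite /g conj_yn rmorphN mulNr.
have um0 : iota (unif i) ^ ord (w i) (norm g) != 0.
  by rewrite expfz_neq0 ?fmorph_eq0.
rewrite fE -mulrA mul_conj fmorph_div !fmorphXz expfzDr ?fmorph_eq0 //.
by move: (iota (unif i) ^ _) um0 => u um0; field.
Qed.

Variable P : place kF.
Hypothesis EP : forall f c, spec_split f c -> has_value P f c.

Lemma fibre_point_split : fibre_point P i 1.
Proof.
have over : lies_over P i 1.
  move=> A; have [->|A0] := eqVneq A 0; first by rewrite rmorph0 !place_ord0 mulr0.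
  have u0 : iota (unif i) ^ ord (w i) A != 0.
    by rewrite expfz_neq0 ?fmorph_eq0 ?unif_neq0K.
  have [a av a0] := unit_part i A0; rewrite mul1r.
  apply: (local_ord1 local_ring_split EP (b := iota (A / unif i ^ ord (w i) A))
    (d := 1) (beta := a) (delta := 1)); rewrite ?fmorph_eq0 ?oner_neq0 //.
  - exact: spec_split_iota.
  - by rewrite -(rmorph1 iota); apply: spec_split_iota;
    rewrite -(rmorph1 (cst tf)); apply: has_value_const.
  - by rewrite fmorph_div fmorphXz; move: (iota (unif i) ^ _) u0 => u u0; field.
have yv : has_value P (yn i) b.
  apply: EP; exists 0, 1, 0, 1; rewrite rmorph0 rmorph1 mul1r add0r mul1r add0r.
  split=> //; first by rewrite has_value0 vge0.
  by rewrite -(rmorph1 (cst tf)); apply: has_value_const.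
have [_ oy] := has_value_ord0 yv b0.
have dE : ord_der i 1 = pole_dx i by rewrite /ord_der; ring.
have iota_bound A : vge (w i) 0 A -> vge P (pole_dx i) (iota (DK A)).
  move=> vA; rewrite -[pole_dx i]mul1r.
  exact: (lies_over_vge (@ler01 int) over (DK_bound vA)).
split=> //; first by left.
  rewrite dE; apply: (der_bound derivation_DF local_ring_split EP) => f c.
  case=> A [B [al [be [-> Aa Bb _]]]].
  rewrite (derD derivation_DF) (derM derivation_DF) !DF_iota.
  have vA := has_value_vge Aa; have vB := has_value_vge Bb.
  have ynb : vge P (pole_dx i) (DF (yn i)).
    have := iota_bound _ (has_value_vge qb); rewrite -DF_yn vge_mul.
      rewrite ordM ?two_neq0F ?yn_neq0 // oy -(rmorph_nat kF) ord_const.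
      by rewrite !subr0.
    by rewrite mulf_neq0 ?two_neq0F ?yn_neq0.
  rewrite vgeD ?iota_bound // vgeD //.
    by rewrite vgeMr ?iota_bound // vgeE ?yn_neq0 // oy.
  by rewrite vgeMl //; apply: (lies_over_vge (m := 0) (@ler01 int) over vB).
have [d0 od] := DK_unif tf_inj fracP i.
exists (iota (unif i)); rewrite DF_iota !fmorph_eq0 d0 unif_neq0K !over !mul1r.
by rewrite dE od ord_unif.
Qed.

End Split.

Section Ramified.
Variable i : option k.
Hypothesis q1 : ord (w i) (qn i) = 1.

(** If qn i is a uniformiser at i, there is one place above i, ramified, with
    uniformiser yn i. *)
Definition spec_ram (f : F) (c : k) := exists A B,
  [/\ f = iota A + iota B * yn i, has_value (w i) A c & vge (w i) 0 B].

Let qv : has_value (w i) (qn i) 0.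
Proof. by rewrite has_value0 vgeE ?qn_neq0 // q1. Qed.

Lemma spec_ram_iota A a : has_value (w i) A a -> spec_ram (iota A) a.
Proof. by move=> Aa; exists A, 0; rewrite rmorph0 mul0r addr0 vge0. Qed.

Let q_part (m : int) A : (A == 0) || (m <= ord (w i) A) ->
  exists2 a, has_value (w i) (A / qn i ^ m) a & A != 0 -> ord (w i) A = m -> a != 0.
Proof.
move=> hA; have q0 := qn_neq0 i.
have [|a av] := @placeK_value _ _ _ tf_inj fracP i (A / qn i ^ m).
  rewrite mulrC vge_mul ?invr_eq0 ?expfz_neq0 //.
  by rewrite sub0r ordV opprK ordXz // q1 mul1r.
exists a => // A0 om; apply/eqP => a0; move: av.
rewrite a0 has_value0 vgeE ?mulf_neq0 ?invr_eq0 ?expfz_neq0 //.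
by rewrite ordF ?expfz_neq0 // ordXz // q1 mul1r om subrr.
Qed.

Let qnz m : iota (qn i ^ m) = yn i ^ (2 * m).
Proof. by rewrite fmorphXz -yn2 -exprz_exp. Qed.

Lemma local_ring_ram : local_ring kF spec_ram (yn i).
Proof.
have q0 := qn_neq0 i; have y0 := yn_neq0 i.
have one_v : has_value (w i) 1 1.
  by rewrite -(rmorph1 (cst tf)); apply: has_value_const.
split.
- by move=> c; rewrite kFE; apply: spec_ram_iota; apply: has_value_const.
- move=> f g c d [A [B [-> Aa Bb]]] [A' [B' [-> Aa' Bb']]].
  exists (A + A'), (B + B').
  split; [by rewrite !rmorphD; ring|exact: has_valueD|exact: vgeD].
- move=> f g c d [A [B [-> Aa Bb]]] [A' [B' [-> Aa' Bb']]].
  exists (A * A' + B * B' * qn i), (A * B' + A' * B).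
  split; first exact: mul_yn.
    rewrite -[c * d]addr0; apply: has_valueD; first exact: has_valueM.
    by rewrite has_value0; apply: vgeMl; [exact: vgeMl|rewrite -has_value0].
  have [vA vA'] := (has_value_vge Aa, has_value_vge Aa').
  by apply: vgeD; apply: vgeMl.
- move=> c [A [B [/esym/ind_yn[-> ->] A0 _]]].
  by apply: (has_value_inj A0); rewrite has_value0 vge0.
- exact: yn_neq0.
- exists 0, 1; rewrite rmorph0 rmorph1 mul1r add0r has_value0 vge0.
  by split=> //; apply: has_value_vge one_v.
move=> f f0; have [A [B fE]] := dec_yn i f.
have E1 : spec_ram 1 1 by rewrite -(rmorph1 iota); apply: spec_ram_iota.
(* The orders 2 * ord A and 2 * ord B + 1 of the two terms are distinct. *)
have [/andP[A0 le]|] := boolP ((A != 0) && ((B == 0) || (ord (w i) A <= ord (w i) B))).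
  have [|a av a0] := @q_part (ord (w i) A) A; first by rewrite lexx orbT.
  have [b bv _] := q_part le.
  exists (2 * ord (w i) A), (iota (A / qn i ^ ord (w i) A) +
    iota (B / qn i ^ ord (w i) A) * yn i).
  exists 1, a, 1; split; rewrite ?oner_neq0 ?a0 //.
    exists (A / qn i ^ ord (w i) A), (B / qn i ^ ord (w i) A).
    by split=> //; apply: has_value_vge bv.
  rewrite mulr1 -qnz fE !fmorph_div.
  have : iota (qn i ^ ord (w i) A) != 0 by rewrite fmorph_eq0 expfz_neq0.
  by move: (iota (qn i ^ _)) => u u0; field.
rewrite negb_and negbK negb_or -ltNge => hA.
have B0 : B != 0.
  case/orP: hA => [/eqP A0|/andP[//]]; apply: contraNneq f0 => B0.
  by rewrite fE A0 B0 !rmorph0 mul0r addr0.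
have {}hA : (A == 0) || (ord (w i) B + 1 <= ord (w i) A).
  by case/orP: hA => [->//|/andP[_ lt]]; rewrite lezD1 lt orbT.
have [|b bv b0] := @q_part (ord (w i) B) B; first by rewrite lexx orbT.
have [a av _] := q_part hA.
exists (2 * ord (w i) B + 1).
exists (iota (B / qn i ^ ord (w i) B) + iota (A / qn i ^ (ord (w i) B + 1)) * yn i).
exists 1, b, 1; split; rewrite ?oner_neq0 ?b0 //.
  exists (B / qn i ^ ord (w i) B), (A / qn i ^ (ord (w i) B + 1)).
  by split=> //; apply: has_value_vge av.
rewrite mulr1 [yn i ^ (_ + _)]expfzDr //
  -qnz expr1z fE !fmorph_div [qn i ^ (_ + 1)]expfzDr // rmorphM.
rewrite expr1z -yn2.
have : iota (qn i ^ ord (w i) B) != 0 by rewrite fmorph_eq0 expfz_neq0.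
by move: (iota (qn i ^ _)) => u u0; field; rewrite y0 u0.
Qed.

Variable P : place kF.
Hypothesis EP : forall f c, spec_ram f c -> has_value P f c.

Lemma fibre_point_ram : fibre_point P i 2.
Proof.
have q0 := qn_neq0 i; have y0 := yn_neq0 i.
have over : lies_over P i 2.
  move=> A; have [->|A0] := eqVneq A 0; first by rewrite rmorph0 !place_ord0 mulr0.
  have [|a av a0] := @q_part (ord (w i) A) A; first by rewrite lexx orbT.
  apply: (local_ord1 local_ring_ram EP (b := iota (A / qn i ^ ord (w i) A))
    (d := 1) (beta := a) (delta := 1)); rewrite ?fmorph_eq0 ?oner_neq0 ?a0 //.
  - exact: spec_ram_iota.
  - by rewrite -(rmorph1 iota); apply: spec_ram_iota; rewrite -(rmorph1 (cst tf));
    apply: has_value_const.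
  rewrite mulr1 -qnz fmorph_div.
  have : iota (qn i ^ ord (w i) A) != 0 by rewrite fmorph_eq0 expfz_neq0.
  by move: (iota (qn i ^ _)) => u u0; field.
have oy : ord P (yn i) = 1 := local_ord_unif local_ring_ram EP.
have dE : ord_der i 2 = 2 * pole_dx i - 1 by rewrite /ord_der; ring.
have iota_bound A : vge (w i) 0 A -> vge P (2 * pole_dx i) (iota (DK A)).
  by move=> vA; apply: (lies_over_vge _ over (DK_bound vA)).
(* As for any uniformiser of K, the derivative of qn i has the opposite order
   to dx. *)
have [Dq0 oDq] : DK (qn i) != 0 /\ ord (w i) (DK (qn i)) = pole_dx i.
  have u0 := unif_neq0K i; have [a av a0] := unit_part i q0.
  rewrite q1 expr1z in av; set r := qn i / unif i in av.
  have qE : qn i = unif i * r by rewrite mulrC divfK.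
  have [d0 od] := DK_unif tf_inj fracP i.
  have [r0 or] := has_value_ord0 av a0.
  have oE : ord (w i) (DK (unif i) * r) = pole_dx i by rewrite ordM // or addr0.
  rewrite qE (derM (derivation_DK tf_inj fracP)) -oE.
  apply: ordD; first by rewrite mulf_neq0.
  rewrite oE addrC; apply: vgeM; first by rewrite vgeE // ord_unif.
  exact: DK_bound (has_value_vge av).
have [Dy0 oDy] : DF (yn i) != 0 /\ ord P (DF (yn i)) = 2 * pole_dx i - 1.
  have c0 : 2%:R * yn i != 0 by rewrite mulf_neq0 ?two_neq0F.
  have e := DF_yn i.
  have D0 : DF (yn i) != 0.
    by apply: contraNneq Dq0 => D0; rewrite -(fmorph_eq0 iota) -e D0 mulr0.
  split=> //; move/(congr1 (ord P)): e; rewrite over oDq.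
  rewrite ordM // ordM ?two_neq0F // oy -(rmorph_nat kF) ord_const => <-; ring.
split=> //; first by right.
  rewrite dE; apply: (der_bound derivation_DF local_ring_ram EP) => f c.
  case=> A [B [-> Aa vB]].
  rewrite (derD derivation_DF) (derM derivation_DF) !DF_iota.
  have vA := has_value_vge Aa.
  have le1 : 2 * pole_dx i - 1 <= 2 * pole_dx i by rewrite gerBl.
  apply: vgeD; first exact: (vge_trans le1 (iota_bound _ vA)).
  apply: vgeD.
    apply: vgeMr; first exact: (vge_trans le1 (iota_bound _ vB)).
    by rewrite vgeE // oy.
  apply: vgeMl; last by rewrite -oDy vge_ord.
  by apply: (lies_over_vge (m := 0) _ over vB).
by exists (yn i); rewrite oDy dE.
Qed.

End Ramified.

(** There are two conjugate places above i if qn i is a unit, and one if it is a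
    uniformiser. In both cases the sum of the orders of f at them is the
    order of the norm at i, since the norm is the product of f and its
    conjugate. *)
Lemma fibre i : exists s : seq (place kF), [/\ uniq s,
  (forall P, P \in s -> exists e, fibre_point P i e),
  (forall P e, 0 < e -> lies_over P i e -> P \in s) &
  (forall f, f != 0 -> \sum_(P <- s) ord P f = ord (w i) (norm f))].
Proof.
have y0 := yn_neq0 i.
have [q0|q0] := eqVneq (ord (w i) (qn i)) 0.
  have [|c cv] := @placeK_value _ _ _ tf_inj fracP i (qn i).
    by rewrite vgeE ?qn_neq0 // q0.
  have c0 : c != 0.
    by apply/eqP => c0; move: cv; rewrite c0 has_value0 vgeE ?qn_neq0 // q0.
  have [b bE] : exists b, b ^+ 2 = c.
    have [|b] := closed_rootP ('X^2 - c%:P : {poly k}) _.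
      by rewrite size_XnsubC.
    by rewrite rootE !hornerE subr_eq0 => /eqP <-; exists b.
  rewrite -bE in cv; have b0 : b != 0.
    by apply: contraNneq c0 => b0; rewrite -bE b0 expr0n.
  have nb0 : - b != 0 by rewrite oppr_eq0.
  have cv' : has_value (w i) (qn i) ((- b) ^+ 2) by rewrite sqrrN.
  have lr := local_ring_split b0 cv; have lr' := local_ring_split nb0 cv'.
  have [P1 EP1] := local_place lr; have fp1 := fibre_point_split b0 cv EP1.
  have EP2 f e : spec_split i (- b) f e -> has_value (conj_place P1) f e.
    case=> A [B [al [be [-> Aa Bb ->]]]].
    rewrite /has_value vge_conj_place conjD conj_yn kFE -rmorphN conj_iota rmorphN -kFE.
    apply: EP1; exists A, (- B), al, (- be); rewrite rmorphN mulNr; split=> //.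
      exact: has_valueN.
    by ring.
  have fp2 := fibre_point_split nb0 cv' EP2.
  exists [:: P1; conj_place P1]; split.
  - rewrite /= andbT inE; apply/negP => /eqP PE.
    have one_v : has_value (w i) 1 1.
      by rewrite -(rmorph1 (cst tf)); apply: has_value_const.
    have yv1 : has_value P1 (yn i) b.
      apply: EP1; exists 0, 1, 0, 1; rewrite rmorph0 rmorph1 mul1r add0r mul1r add0r.
      by split=> //; rewrite has_value0 vge0.
    have yv2 : has_value P1 (yn i) (- b).
      rewrite PE; apply: EP2; exists 0, 1, 0, 1.
      rewrite rmorph0 rmorph1 mul1r add0r mul1r add0r.
      by split=> //; rewrite has_value0 vge0.
    have /eqP := has_value_inj yv1 yv2; rewrite -addr_eq0 -mulr2n -mulr_natl.
    by rewrite mulf_eq0 (negPf two_neq0) (negPf b0).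
  - by move=> P; rewrite !inE => /orP[] /eqP ->; exists 1.
  - move=> P e e0 over; have oy : ord P (yn i) = 0.
      have := over (qn i); rewrite -yn2 ordX // q0 mulr0 => /eqP.
    by rewrite mulf_eq0 orbF => /eqP.
    have iv A a := @lies_over_value P i e A a e0 over.
    have [a [av aE]] : exists a, has_value P (yn i) a /\ (a = b \/ a = - b).
      have := iv _ _ cv; rewrite -yn2 /has_value rmorphXn.
      have -> : yn i ^+ 2 - kF b ^+ 2 = (yn i - kF b) * (yn i - kF (- b)).
        by rewrite rmorphN; ring.
      have [e1 _|n1] := eqVneq (yn i - kF b) 0.
        by exists b; split; [rewrite e1 vge0|left].
      have [e2 _|n2] := eqVneq (yn i - kF (- b)) 0.
        by exists (- b); split; [rewrite e2 vge0|right].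
      rewrite vgeE ?mulf_neq0 // ordM // => le1.
      have [l1|l1] := leP 1 (ord P (yn i - kF b)).
        by exists b; split; [rewrite /has_value vgeE|left].
      exists (- b); split; last by right.
      rewrite /has_value vgeE //; apply: le_trans le1 _.
      by rewrite gerDr -ltzD1 add0r.
    have EP f a' : spec_split i a f a' -> has_value P f a'.
      case=> A [B [al [be [-> Aa Bb ->]]]].
      by apply: has_valueD; [exact: iv|apply: has_valueM => //; exact: iv].
    rewrite !inE; case: aE => aE; rewrite aE in EP.
      by rewrite (local_place_uniq lr EP1 EP) eqxx.
    by rewrite (local_place_uniq lr' EP2 EP) eqxx orbT.
  move=> f f0; rewrite big_cons big_seq1 ord_conj_place -ordM ?conj_eq0 //.
  by rewrite mul_conj (fp_over fp1) mul1r.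
have q1 : ord (w i) (qn i) = 1.
  by move: q0; rewrite ord_qn; have := modz_ge0 (ord (w i) Q) (isT : 2%:Z != 0);
    have := ltz_pmod (ord (w i) Q) (isT : 0 < 2%:Z); lia.
have lr := local_ring_ram q1.
have [P EP] := local_place lr; have fp := fibre_point_ram q1 EP.
exists [:: P]; split=> //.
- by move=> P'; rewrite inE => /eqP ->; exists 2.
- move=> P' e e0 over; have iv A a := @lies_over_value P' i e A a e0 over.
  rewrite inE; apply/eqP/(local_place_uniq lr EP) => f c [A [B [-> Aa vB]]].
  have yv : vge P' 1 (yn i).
    rewrite vgeE //; have := over (qn i); rewrite -yn2 ordX // q1 mulr1; lia.
  rewrite -[c]addr0; apply: has_valueD; first exact: iv.
  rewrite has_value0; apply: vgeMl => //.
  by rewrite -[0](mulr0 e); apply: (lies_over_vge (ltW e0) over vB).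
move=> f f0; rewrite big_seq1.
have EP' g c : spec_ram i g c -> has_value (conj_place P) g c.
  case=> A [B [-> Aa vB]].
  rewrite /has_value vge_conj_place conjD conj_yn kFE -rmorphN conj_iota rmorphN -kFE.
  by apply: EP; exists A, (- B); rewrite rmorphN mulNr vgeN.
have PE := local_place_uniq lr EP EP'.
have : ord P f + ord P (conj f) = 2 * ord (w i) (norm f).
  by rewrite -ordM ?conj_eq0 // mul_conj (fp_over fp).
by rewrite -ord_conj_place PE; lia.
Qed.

(** ** Logarithmic differentials and divisors *)

(** At every place P, the differential df / f has at most a simple pole, with
    residue ord P f in k. *)
Lemma dlog_regular P i e f : fibre_point P i e -> f != 0 ->
  vge P (ord_der i e) (DF f / f) = (p %| `|ord P f|)%N.
Proof.
move=> fp f0; have [t [t0 t1 Dt0 oDt]] := fp_unif fp.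
set d := ord_der i e in fp oDt *; have hD := derivation_DF.
have tm0 : t ^ ord P f != 0 by rewrite expfz_neq0.
set u := f / t ^ ord P f.
have u0 : u != 0 by rewrite mulf_neq0 ?invr_eq0.
have ou : ord P u = 0 by rewrite ordF // ordXz // t1 mul1r subrr.
have fE : f = t ^ ord P f * u by rewrite /u mulrC divfK.
have Du : vge P d (DF u / u).
  by rewrite mulrC vge_mul ?invr_eq0 // ordV ou oppr0 subr0 (fp_bound fp) // vgeE ?ou.
have -> : DF f / f = (DF t / t) *~ ord P f + DF u / u.
  by rewrite {1 2}fE (dlogM hD) // (dlogXz hD).
set m := ord P f; rewrite -charFE -[_ *~ m]mulrzr.
have [m0|m0] := eqVneq (m%:~R : F) 0; first by rewrite m0 mulr0 add0r Du.
apply/negP => h1; have := vgeB h1 Du; rewrite addrK mulrC vge_mul //.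
have -> : ord P (m%:~R : F) = 0 by rewrite -(rmorph_int kF) ord_const.
have q0 : DF t / t != 0 by rewrite mulf_neq0 ?invr_eq0.
by rewrite vgeE // ordF // oDt t1 subr0 lerBrDr gerDl.
Qed.

(** Orders in K are integers: rounding makes up for the loss of e - 1. *)
Lemma vge_descend P i e m A : fibre_point P i e ->
  vge P (e * m - (e - 1)) (iota A) -> vge (w i) m A.
Proof.
case=> e12 over _ _ _; rewrite /vge fmorph_eq0 over => /orP[->//|].
by case: e12 => -> h1; apply/orP; right; lia.
Qed.

Lemma fibre_inhabited i : exists P e, fibre_point P i e.
Proof.
have [s [_ sfp _ sE]] := fibre i; case: s sfp sE => [|P s] sfp sE.
  have u0 : iota (unif i) != 0 by rewrite fmorph_eq0 unif_neq0K.
  have := sE _ u0; rewrite big_nil.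
  have -> : norm (iota (unif i)) = unif i ^+ 2.
    by apply: (fmorph_inj iota); rewrite -mul_conj conj_iota rmorphXn.
  by rewrite ordX ?unif_neq0K // ord_unif.
by have [|e fp] := sfp P; [rewrite mem_head|exists P, e].
Qed.

Lemma fibre_pointP P : exists i e, fibre_point P i e.
Proof.
have [i [e [e0 over]]] := lies_overP P; have [s [_ sfp sin _]] := fibre i.
by have [e' fp] := sfp P (sin P e e0 over); exists i, e'.
Qed.

Lemma fibre_point_gt0 P i e : fibre_point P i e -> 0 < e.
Proof. by case=> [[]->]. Qed.

Lemma conj_fibre_point P i e : fibre_point P i e -> fibre_point (conj_place P) i e.
Proof.
move=> fp; have e0 := fibre_point_gt0 fp; have over := fp_over fp.
have over' : lies_over (conj_place P) i e.
  by move=> A; rewrite ord_conj_place conj_iota over.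
have [s [_ sfp sin _]] := fibre i.
have [e' fp'] := sfp _ (sin _ _ e0 over').
suff -> : e = e' by [].
have := fp_over fp' (unif i); rewrite ord_conj_place conj_iota over ord_unif.
by rewrite !mulr1.
Qed.

(** There is no nonzero regular differential on the projective line. *)
Lemma regular_dx_eq0 A : (forall i, vge (w i) (pole_dx i) A) -> A = 0.
Proof.
move=> reg; have [a aE] := @integralK _ _ _ tf_inj fracP A (fun a => reg (Some a)).
have := reg None; rewrite aE /=; have [->|a0] := eqVneq a 0; first by rewrite rmorph0.
by rewrite vgeE ?tf_eq0 // ord_inf //; lia.
Qed.

(** The part of a regular differential that is fixed by conjugation is a
    regular differential of the line, hence zero. So a regular differential is
    A dx / y for some A in K, and it remains to compute its orders. *)
Lemma regular_form h1 :
  (forall P i e, fibre_point P i e -> vge P (ord_der i e) h1) <->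
  exists2 A, h1 = iota A / y & forall i, vge (w i) (pole_dx i) (A * scale i).
Proof.
have y0 := y_neq0; split=> [reg|[A -> regA] P i e fp]; last first.
  have -> : iota A / y = (yn i)^-1 * iota (A * scale i).
    have s0 : iota (scale i) != 0 by rewrite fmorph_eq0 scale_neq0.
    by rewrite /yn rmorphM; move: (iota (scale i)) s0 => s s0; field; rewrite y0 s0.
  rewrite vge_mul ?invr_eq0 ?yn_neq0 // ordV (fp_yn fp) opprK /ord_der subrK.
  exact: (lies_over_vge (ltW (fibre_point_gt0 fp)) (fp_over fp)).
have regc P i e : fibre_point P i e -> vge P (ord_der i e) (conj h1).
  by move=> fp; rewrite -vge_conj_place; apply: reg; apply: conj_fibre_point.
have r0 : even_part h1 = 0.
  have := @regular_dx_eq0 (even_part h1 *+ 2) _; rewrite -mulr_natl => r0.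
  have /eqP : 2%:R * even_part h1 = 0.
    apply: r0 => i; have [P [e fp]] := fibre_inhabited i.
    apply: (vge_descend fp); rewrite mulr_natl -add_conj.
    by apply: vgeD; [apply: reg|apply: regc].
  by rewrite mulf_eq0 -(fmorph_eq0 iota) rmorph_nat (negPf two_neq0F) => /eqP.
have hE : h1 = iota (odd_part h1) * y by rewrite {1}(decE h1) r0 rmorph0 add0r.
exists (odd_part h1 * Q); first by rewrite rmorphM -y2 {1}hE; field.
move=> i; have [P [e fp]] := fibre_inhabited i; apply: (vge_descend fp).
have -> : iota (odd_part h1 * Q * scale i) = yn i * h1.
  by rewrite {2}hE /yn !rmorphM -y2; ring.
rewrite vge_mul ?yn_neq0 // (fp_yn fp); apply: vge_trans (reg _ _ _ fp).
by rewrite /ord_der; have := fibre_point_gt0 fp; lia.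
Qed.

Lemma integral_const A : (forall i, vge (w i) 0 A) -> DK A = 0.
Proof.
move=> int; have [a aE] := @integralK _ _ _ tf_inj fracP A (fun a => int (Some a)).
have := int None; rewrite aE /= DK_poly //.
have [->|a0] := eqVneq a 0; first by rewrite linear0 rmorph0.
rewrite vgeE ?tf_eq0 // ord_inf // => sa.
have [c ->] : exists c, a = c%:P.
  by exists a`_0; apply: size1_polyC; move: sa; set s := size a; lia.
by rewrite derivC rmorph0.
Qed.

(** The trace and the norm of f have no poles, hence are constant, and f is a
    root of a quadratic equation with constant coefficients. *)
Lemma ord0_const f : (forall P, ord P f = 0) -> DF f = 0.
Proof.
move=> f0; have int P : vge P 0 f by rewrite /vge f0 lexx orbT.
have intc P : vge P 0 (conj f) by rewrite -vge_conj_place int.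
have hD := derivation_DF.
have down A : (forall P, vge P 0 (iota A)) -> DK A = 0.
  move=> vA; apply: integral_const => i; have [P [e fp]] := fibre_inhabited i.
  apply: (vge_descend fp); apply: vge_trans (vA P).
  by rewrite mulr0 sub0r oppr_le0; have := fibre_point_gt0 fp; lia.
set T := even_part f *+ 2.
have DT : DF (iota T) = 0.
  by rewrite DF_iota down ?rmorph0 // => P; rewrite -add_conj vgeD.
have DN : DF (iota (norm f)) = 0.
  by rewrite DF_iota down ?rmorph0 // => P; rewrite -mul_conj vgeMl.
have cE : conj f = iota T - f by rewrite -add_conj; ring.
have : DF f * (iota T - f *+ 2) = 0.
  move: DN; rewrite -mul_conj cE (derM hD) (derB hD) DT sub0r => <-; ring.
move/eqP; rewrite mulf_eq0 => /orP[/eqP//|/eqP/subr0_eq TE].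
have : DF f *+ 2 = 0 by rewrite mulr2n -(derD hD) -mulr2n -TE.
by move/eqP; rewrite -mulr_natl mulf_eq0 (negPf two_neq0F) => /eqP.
Qed.

Lemma lies_over_inj P i j (e e' : int) : 0 < e -> 0 < e' ->
  lies_over P i e -> lies_over P j e' -> i = j.
Proof.
have sep a j' : j' != Some a -> ord (w j') (unif (Some a)) <= 0.
  case: j' => [b|] ab /=; last first.
    by rewrite ord_inf ?polyXsubC_eq0 // size_XsubC.
  rewrite ord_at ?polyXsubC_eq0 // mupNroot // root_XsubC.
  by apply: contraNneq ab => ->.
have key a j' d d' : 0 < d -> 0 < d' -> lies_over P (Some a) d -> lies_over P j' d' ->
    j' = Some a.
  move=> d0 d0' o o'; apply/eqP/negPn/negP => /sep le.
  have := o' (unif (Some a)); rewrite o ord_unif mulr1 => dE.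
  by have := mulr_ge0_le0 (ltW d0') le; rewrite -dE leNgt d0.
move=> e0 e0' o o'; case: i o => [a|] o; first by rewrite (key _ _ _ _ e0 e0' o o').
case: j o' => [b|//] o'; exact: (key _ _ _ _ e0' e0 o' o).
Qed.

(** At a pole of f where the trace is regular, the conjugate has the same pole,
    and so the norm has a pole. *)
Let integral_over P e a f : fibre_point P (Some a) e ->
  vge (w (Some a)) 0 (even_part f *+ 2) -> vge (w (Some a)) 0 (norm f) -> vge P 0 f.
Proof.
move=> fp vT vN; have over := fp_over fp; have e0 := ltW (fibre_point_gt0 fp).
have {}vT : vge P 0 (iota (even_part f *+ 2)) by rewrite -[0](mulr0 e);
  apply: lies_over_vge e0 over _.
have {}vN : vge P 0 (iota (norm f)) by rewrite -[0](mulr0 e);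
  apply: lies_over_vge e0 over _.
apply/negPn/negP => nf; have f0 : f != 0 by apply: contraNneq nf => ->; rewrite vge0.
rewrite vgeE // -ltNge in nf.
have [nc oc] : - f + iota (even_part f *+ 2) != 0 /\ ord P (- f +
  iota (even_part f *+ 2)) = ord P (- f).
  apply: ordD; rewrite ?oppr_eq0 // ordN; apply: vge_trans vT; lia.
have cE : - f + iota (even_part f *+ 2) = conj f by rewrite -add_conj; ring.
rewrite cE ordN in oc nc.
have := vN; rewrite -mul_conj vgeE ?mulf_neq0 // ordM // oc; lia.
Qed.

Let support A : exists s : seq k, forall a, a \notin s -> ord (w (Some a)) A = 0.
Proof.
have [->|A0] := eqVneq A 0; first by exists [::] => a; rewrite place_ord0.
by have [s [sA _]] := sum_ordK tf_inj fracP A0; exists s.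
Qed.

(** A principal divisor has finite support and degree 0: the latter follows
    from the product formula for the norm. *)
Lemma divisor_support f : f != 0 -> exists S : seq (place kF),
  [/\ uniq S, forall P, P \notin S -> ord P f = 0 & \sum_(P <- S) ord P f = 0].
Proof.
move=> f0; have n0 := norm_neq0 f0.
have [sN [supN sumN]] := sum_ordK tf_inj fracP n0.
have [sT supT] := support (even_part f *+ 2).
pose t i := sval (cid (fibre i)).
have tP i : [/\ uniq (t i), (forall P, P \in t i -> exists e, fibre_point P i e),
  (forall P e, 0 < e -> lies_over P i e -> P \in t i) &
  (forall f, f != 0 -> \sum_(P <- t i) ord P f = ord (w i) (norm f))].
  by rewrite /t; case: cid.
pose s := undup (sN ++ sT).
exists (flatten (map t (None :: map Some s))); split.
- apply: uniq_flatten_map => [|i|i j P].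
  + rewrite /= map_inj_uniq ?undup_uniq ?andbT; last by move=> a b [].
    by apply/mapP => -[].
  + by have [] := tP i.
  have [_ fpi _ _] := tP i; have [_ fpj _ _] := tP j => /fpi[e fp] /fpj[e' fp'].
  exact: (lies_over_inj (fibre_point_gt0 fp) (fibre_point_gt0 fp') (fp_over fp)
    (fp_over fp')).
- move=> P PS; have [i [e fp]] := fibre_pointP P.
  have iS : i \notin None :: map Some s.
    apply: contra PS => iS; apply/flatten_mapP; exists i => //.
    by have [_ _ sin _] := tP i; apply: (sin _ _ (fibre_point_gt0 fp) (fp_over fp)).
  case: i fp iS => [a|//] fp; rewrite inE /= mem_map; last by move=> ? ? [].
  rewrite mem_undup mem_cat negb_or => /andP[aN aT].
  have vT : vge (w (Some a)) 0 (even_part f *+ 2) by rewrite /vge supT // lexx orbT.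
  have oN := supN _ aN; have vN : vge (w (Some a)) 0 (norm f) by rewrite /vge oN
    lexx orbT.
  have := integral_over fp vT vN; have := integral_over (conj_fibre_point fp) vT vN.
  rewrite vge_conj_place !vgeE ?conj_eq0 // => h1 h2.
  have : ord P f + ord P (conj f) = 0.
    by rewrite -ordM ?conj_eq0 // mul_conj (fp_over fp) oN mulr0.
  by move: (ord P f) (ord P _) h1 h2 => o o' h1 h2; clear - h1 h2; lia.
rewrite big_flatten big_map (eq_bigr (fun i => ord (w i) (norm f))); last first.
  by move=> i _; have [_ _ _ ->] := tP i.
rewrite big_cons /= big_map addrC sumN ?undup_uniq //.
by move=> a aN; rewrite mem_undup mem_cat aN.
Qed.

Lemma divided_divisor f : f != 0 -> (forall P, (p %| `|ord P f|)%N) ->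
  exists D : Div0 kF, forall P, coeff P (divisor D) *+ p = ord P f.
Proof.
move=> f0 dvd; have [S [uS supS sumS]] := divisor_support f0.
have dvdE P : (ord P f %/ p)%Z *+ p = ord P f.
  by rewrite -mulr_natr natz divzK // dvdzE.
pose D : {freeg (place kF)} := \sum_(P <- S) << (ord P f %/ p)%Z *g P >>.
have coefD P : coeff P D *+ p = ord P f.
  rewrite raddf_sum /=; have [PS|PS] := boolP (P \in S); last first.
    rewrite supS // big_seq big1 ?mul0rn // => P' P'S.
    by rewrite coeffU; case: eqP => [PE|_]; [by rewrite -PE P'S in PS|exact: mulr0].
  rewrite (bigD1_seq P) //= coeffU eqxx mulr1 big1 ?addr0 // => P' /negPf nPP'.
  by rewrite coeffU nPP' mulr0.
have degD : degree0 D.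
  rewrite /degree0 raddf_sum /=; apply/eqP.
  have : (\sum_(P <- S) deg << (ord P f %/ p)%Z *g P >>) *+ p = 0.
    by rewrite -sumrMnl -[RHS]sumS; apply: eq_bigr => P _; rewrite degU dvdE.
  by move/eqP; rewrite mulrn_eq0 eqn0Ngt p_gt0 => /eqP.
by exists (MkDiv0 degD).
Qed.

(** ** The p-torsion of the Jacobian *)

(** A class killed by p is that of a divisor E with p E = div f, and is determined
    by df / f, since f is a p-th power if df = 0. The differentials A dx / y which
    arise are the regular ones, as p divides div f, that are fixed by the Cartier
    operator, by Jacobson's formula. *)
Lemma torsion_classes (V : seq K) : uniq V ->
    (forall A, (A \in V) <-> (forall i, vge (w i) (pole_dx i) (A * scale i)) /\
       iter p.-1 DF (iota A / y) + (iota A / y) ^+ p = 0) ->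
  exists L : seq (Pic0 kF),
    [/\ uniq L, size L = size V & forall x, (x \in L) <-> x *+ p = 0].
Proof.
move=> uV VP; have y0 := y_neq0; have hD := derivation_DF.
have cF : p \in [pchar F] by rewrite (fmorph_pchar kF).
have dlog h1 : (exists2 f, f != 0 & DF f / f = h1) <-> iter p.-1 DF h1 + h1 ^+ p = 0.
  exact: (dlogP hD cF iter_DFp).
pose rel A (D : Div0 kF) := exists f, [/\ f != 0, DF f / f = iota A / y &
  forall P, coeff P (divisor D) *+ p = ord P f].
have ex A : A \in V -> exists D, rel A D.
  case/VP => reg /dlog[f f0 fE]; have [|D DE] := @divided_divisor f f0.
    move=> P; have [i [e fp]] := fibre_pointP P; rewrite -(dlog_regular fp f0) fE.
    by have [_] := regular_form (iota A / y); apply=> //; exists A.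
  by exists D, f.
pose c A := if pselect (A \in V) is left AV then class_of (sval (cid (ex A AV))) else 0.
have cP A : A \in V -> exists2 D, rel A D & c A = class_of D.
  by rewrite /c; case: pselect => // AV _; case: cid => D /= r; exists D.
have coeffMn P (D : Div0 kF) : coeff P (divisor (D *+ p)) = coeff P (divisor D) *+ p.
  have coeff0P Q' : coeff Q' (divisor (0 : Div0 kF)) = 0 by exact: coeff0.
  elim: (p) => [|m IH]; first exact: coeff0P.
  by rewrite !mulrS -IH; exact: coeffD.
have coeffDB P (D E : Div0 kF) :
  coeff P (divisor (D - E)) =
    coeff P (divisor D) - coeff P (divisor E) by exact: coeffB.
have dlog_quot f g A B : f != 0 -> g != 0 -> DF f / f = iota A / y ->
    DF g / g = iota B / y -> DF (f / g) / (f / g) = (iota A - iota B) / y.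
  move=> f0 g0 fE gE; rewrite (dlogM hD) ?invr_eq0 // (dlogV hD) // fE gE.
  by rewrite mulrBl.
have pX g P : g != 0 -> ord P (g ^+ p) = ord P g *+ p.
  by move=> g0; rewrite ordX // -mulr_natr natz.
have mulpI (a b : int) : a *+ p = b *+ p -> a = b.
  move/eqP; rewrite -subr_eq0 -mulrnBl mulrn_eq0 eqn0Ngt p_gt0 subr_eq0 /=.
  by move/eqP.
exists (map c V); split; rewrite ?size_map //.
  rewrite map_inj_in_uniq // => A B /cP[D [f [f0 fE Df]] ->] /cP[E [g [g0 gE Eg]] ->].
  case/class_of_eq => u u0 uE.
  have : DF (f / (g * u ^+ p)) = 0.
    apply: ord0_const => P; rewrite ordF ?mulf_neq0 ?expf_neq0 // ordM ?expf_neq0 //.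
    by rewrite pX // -uE coeffDB mulrnBl Df Eg; ring.
  have up : DF (u ^+ p) = 0 by rewrite (der_char hD) // charF.
  have -> : f / (g * u ^+ p) = f / g * (u ^+ p)^-1 by rewrite invfM mulrA.
  have upV : DF (u ^+ p)^-1 = 0 by rewrite (derV hD) up oppr0 mul0r.
  rewrite (derMc hD _ upV) => /eqP;
    rewrite mulf_eq0 invr_eq0 expf_eq0 (negPf u0) andbF orbF.
  move=> /eqP D0; have := dlog_quot f g A B f0 g0 fE gE; rewrite D0 mul0r.
  move/esym/eqP; rewrite mulf_eq0 invr_eq0 (negPf y0) orbF subr_eq0 => /eqP.
  exact: fmorph_inj.
move=> x; split=> [/mapP[A /cP[D [f [f0 fE Df]] ->] ->]|xp].
  rewrite -class_ofMn -(class_of0 kF); apply/class_of_eq; exists f => // P.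
  by rewrite subr0 coeffMn.
have [D Dx] := class_ofP x; move: xp; rewrite -Dx -class_ofMn -(class_of0 kF).
case/class_of_eq => f f0; rewrite subr0 => Df.
have {}Df P : coeff P (divisor D) *+ p = ord P f by rewrite -Df coeffMn.
have [A fE reg] : exists2 A, DF f / f = iota A / y &
    forall i, vge (w i) (pole_dx i) (A * scale i).
  apply/regular_form => P i e fp; rewrite (dlog_regular fp f0) -Df.
  by rewrite -mulr_natr abszM natz absz_nat dvdn_mull.
have AV : A \in V by apply/VP; split=> //; apply/dlog; exists f.
apply/mapP; exists A => //; have [E [g [g0 gE Eg]] ->] := cP A AV.
have fg0 : f / g != 0 by rewrite mulf_neq0 ?invr_eq0.
have [|u uE] := @DF_ker (f / g).
  have := dlog_quot f g A A f0 g0 fE gE; rewrite subrr mul0r => /eqP.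
  by rewrite mulf_eq0 invr_eq0 (negPf fg0) orbF => /eqP.
have u0 : u != 0.
  by apply: contraNneq fg0 => u0; rewrite uE u0 expr0n eqn0Ngt p_gt0.
apply/class_of_eq; exists u => // P; apply: mulpI.
by rewrite -pX // -uE ordF // -Df -Eg coeffDB mulrnBl.
Qed.

(** ** The curve y ^ 2 = x ^ n + 1 *)

Section Curve.
Variable n : nat.
Hypotheses (n_gt0 : (0 < n)%N) (pn : ~~ (p %| n)%N) (QE : Q = ('X^n + 1)%:F).
Let q : {poly k} := 'X^n + 1.

Let size_q : size q = n.+1.
Proof. by rewrite /q -polyC1 size_XnaddC. Qed.

Let q_neq0 : q != 0.
Proof. by rewrite -size_poly_gt0 size_q. Qed.

Let mup_q b : (mup b q < 2)%N := mup_XnD1 b charp pn n_gt0.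

Let ord_Q_inf : ord (w None) Q = - n%:Z.
Proof. by rewrite QE ord_inf // size_q. Qed.

Let scale_at b : scale (Some b) = 1.
Proof.
rewrite /scale QE ord_at // -/q; case: (mup b q) (mup_q b) => [|[|]] //= _.
Qed.

Let ord_scale_inf : ord (w None) (scale None) = (uphalf n)%:Z.
Proof.
rewrite ord_scale ord_Q_inf.
have := divz_eq (- n%:Z) 2; have := ltz_pmod (- n%:Z) (isT : 0 < 2%:Z).
have := modz_ge0 (- n%:Z) (isT : 2%:Z != 0).
move: (divz _ _) (modz _ _) => d r; have := odd_double_half n.
rewrite uphalf_half -muln2; move: (odd n) (n./2) => o m; clear.
by case: o; rewrite /= ?add1n ?add0n; lia.
Qed.

(** A differential A dx / y is regular at finite distance if and only if A is a
    polynomial; regularity at infinity bounds the degree. *)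
Lemma regular_poly A : (forall i, vge (w i) (pole_dx i) (A * scale i)) <->
  exists2 a, A = a%:F & (2 * size a < n)%N.
Proof.
have bound a : a != 0 ->
    vge (w None) 2 (a%:F * scale None) = (2 * size a < n)%N.
  move=> a0; rewrite vgeE ?mulf_neq0 ?tf_eq0 ?scale_neq0 // ordM ?tf_eq0 ?scale_neq0 //.
  rewrite ord_inf // ord_scale_inf.
  move: a0; rewrite -size_poly_gt0; set s := size a => s0.
  by apply/idP/idP; have := odd_double_half n; rewrite uphalf_half -muln2; lia.
split=> [reg|[a -> sa] [b|]].
- have [a aE] : exists a, A = a%:F.
    have int b : vge (w (Some b)) 0 A by have := reg (Some b); rewrite scale_at mulr1.
    exact: (@integralK _ _ _ tf_inj fracP A int).
  exists a => //; have := reg None; rewrite aE /=.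
  have [-> _|a0] := eqVneq a 0; first by rewrite size_poly0.
  by rewrite bound.
- by rewrite scale_at mulr1 vge_at_poly.
have [->|a0] := eqVneq a 0; first by rewrite rmorph0 mul0r vge0.
by rewrite bound.
Qed.

(** In a / y = a * y ^ (p - 1) / y ^ p, the denominator is a constant of the
    derivation and y ^ (p - 1) is a polynomial in x. *)
Lemma cartier_poly a : iter p.-1 DF (iota a%:F / y) + (iota a%:F / y) ^+ p = 0 <->
  (a * q ^+ p./2)^`(p.-1) + a ^+ p = 0.
Proof.
have hD := derivation_DF; have z0 : z != 0 by rewrite expf_neq0 // y_neq0.
have Dz : DF z^-1 = 0 by rewrite (derV hD) (der_char hD) ?charF // oppr0 mul0r.
have -> : iota a%:F / y = iota (a * q ^+ p./2)%:F * z^-1.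
  have Q0 : iota Q != 0 by rewrite fmorph_eq0 Q_neq0.
  rewrite yp !rmorphM !rmorphXn /= -QE -/h.
  by have y0 := y_neq0; have Qh := expf_neq0 h Q0; field; rewrite y0 Qh.
have iterE m A : iter m DF (iota A) = iota (iter m DK A).
  by elim: m => //= m ->; rewrite DF_iota.
rewrite (iter_derMc hD _ _ Dz) iterE iter_DK_poly //.
have -> : (iota (a * q ^+ p./2)%:F / z) ^+ p = iota (a ^+ p)%:F / z.
  have -> : iota (a * q ^+ p./2)%:F = iota a%:F * y ^+ (2 * h).
    by rewrite !rmorphM !rmorphXn /= -QE -y2 -exprM.
  have zp : z ^+ p = y ^+ (2 * h) ^+ p * z.
    rewrite /z -!exprM -exprD; congr (y ^+ _).
    by rewrite addnC -mulSn -p_half.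
  rewrite expr_div_n exprMn zp !rmorphXn.
  have u0 : y ^+ (2 * h) ^+ p != 0 by rewrite !expf_neq0 // y_neq0.
  by move: (_ ^+ p) u0 => u u0; field; rewrite u0 z0.
rewrite -mulrDl -!rmorphD; split=> [/eqP|->]; last by rewrite !rmorph0 mul0r.
by rewrite mulf_eq0 invr_eq0 (negPf z0) orbF fmorph_eq0 tf_eq0 => /eqP.
Qed.

Lemma torsion_count (V : seq {poly k}) : uniq V ->
    (forall a, (a \in V) <->
       (2 * size a < n)%N /\ (a * q ^+ p./2)^`(p.-1) + a ^+ p = 0) ->
  exists L : seq (Pic0 kF),
    [/\ uniq L, size L = size V & forall x, (x \in L) <-> x *+ p = 0].
Proof.
move=> uV VP; rewrite -(size_map tf V); apply: torsion_classes.
  by rewrite map_inj_uniq.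
move=> A; split=> [/mapP[a /VP[sa ca] ->]|[/regular_poly[a -> sa] ca]].
  by split; [apply/regular_poly; exists a|apply/cartier_poly].
by apply: map_f; apply/VP; split=> //; apply/cartier_poly.
Qed.

End Curve.

End Quadratic.

(** * The function field of the curve *)

Lemma affine_poly_eq0 (R : nzRingType) (a b : R) :
  a%:P + b%:P * 'X = 0 -> a = 0 /\ b = 0.
Proof.
move/polyP=> e; have := e 0; have := e 1%N.
by rewrite !coefD !coefC !coefMX !coefC /= ?addr0 ?add0r => -> ->.
Qed.

Lemma fracP (R : idomainType) (f : {fraction R}) :
  exists n d, d != 0 /\ f = FracField.tofrac n / FracField.tofrac d.
Proof.
elim/quotW: f => x; exists \n_x, \d_x; split; first exact: denom_ratioP.
have d0 := denom_ratioP x.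
apply: (mulIf (x := FracField.tofrac \d_x)); first by rewrite tofrac_eq0.
rewrite divfK ?tofrac_eq0 //.
change (FracField.mul (\pi_(FracField.type R) x)%qT (FracField.tofrac \d_x) =
  FracField.tofrac \n_x).
rewrite !piE; apply/eqmodP; rewrite /= FracField.equivfE /FracField.mulf.
by rewrite !numden_Ratio ?oner_eq0 ?mulr1 // mulrC.
Qed.

Lemma tofrac_inj (R : idomainType) : injective (@FracField.tofrac R).
Proof. by move=> a b /eqP; rewrite tofrac_eq => /eqP. Qed.

Section FunctionField.
Variables (k : closedFieldType) (p n : nat).
Hypotheses (charp : p \in [pchar k]) (p_odd : odd p).
Hypotheses (n_gt0 : (0 < n)%N) (pn : ~~ (p %| n)%N).
Local Notation K := {fraction {poly k}}.
Local Notation q := ('X^n + 1 : {poly k}).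
Local Notation Q := (FracField.tofrac q).
Local Notation cp := (curve_poly k n).

Lemma curve_polyE : cp = 'X^2 - Q%:P. Proof. by []. Qed.

Lemma size_curve_poly : size cp = 3.
Proof. by rewrite curve_polyE size_XnsubC. Qed.

Lemma monic_curve_poly : cp \is monic.
Proof. by rewrite curve_polyE monicXnsubC. Qed.

(** A zero of the separable polynomial q is simple, so that q has odd order
    there and is not a square in k(x). *)
Lemma curve_poly_irreducible : monic_irreducible_poly cp.
Proof.
split; last exact: monic_curve_poly.
apply: cubic_irreducible; first by rewrite size_curve_poly.
move=> f; rewrite curve_polyE rootE !hornerE subr_eq0; apply/negP => /eqP fQ.
have q0 : q != 0 by rewrite -size_poly_gt0 -polyC1 size_XnaddC.
have [|b qb] := closed_rootP q _.
  by rewrite -polyC1 size_XnaddC // eqSS -lt0n.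
have mb : mup b q = 1%N.
  apply/eqP; rewrite eqn_leq -ltnS (mup_XnD1 b charp pn n_gt0) /=.
  by rewrite -XsubC_dvd ?dvdp_XsubCl.
have f0 : f != 0.
  by apply: contraNneq q0 => f0; rewrite -tofrac_eq0 -fQ f0 expr0n.
have : ord (placeK (@tofrac_inj {poly k}) (@fracP {poly k}) (Some b)) (f ^+ 2) =
  mup b q.
  by rewrite fQ; exact: ord_at.
by rewrite ordX // mb; move: (ord _ _) => o; lia.
Qed.

Local Notation F := (function_field curve_poly_irreducible).
Local Notation inF := (in_qpoly cp : {poly K} -> F).

Definition gen_y : F := inF 'X.

Let mkE : mk_monic cp = cp := mk_monicE curve_poly_irreducible.

Lemma in_qpolyC (A : K) : inF A%:P = in_alg F A.
Proof.
apply/val_inj; rewrite [LHS]in_qpoly_small; last first.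
  by rewrite mkE size_curve_poly ltnS (leq_trans (size_polyC_leq1 _)).
by rewrite -[RHS]/(A *: (1%:P : {poly K})) -mul_polyC mulr1.
Qed.

Lemma gen_y2 : gen_y ^+ 2 = in_alg F Q.
Proof.
have XE : 'X^2 = cp + Q%:P by rewrite curve_polyE subrK.
rewrite -in_qpolyC -[LHS](rmorphXn (in_qpoly cp)) XE [LHS](rmorphD (in_qpoly cp))
  -[RHS]add0r; congr (_ + _).
apply/val_inj; rewrite /= mkE Pdiv.RingMonic.rmodpp //; exact: monic_curve_poly.
Qed.

Lemma in_qpoly_decomposition A B :
  in_alg F A + in_alg F B * gen_y = inF (A%:P + B%:P * 'X).
Proof.
rewrite [RHS](rmorphD (in_qpoly cp)) [X in _ = _ + X](rmorphM (in_qpoly cp)).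
by rewrite -!in_qpolyC.
Qed.

Let small (A B : K) : (size (A%:P + B%:P * 'X)%R < size (mk_monic cp))%N.
Proof.
rewrite mkE size_curve_poly ltnS (leq_trans (size_polyD _ _)) //.
rewrite geq_max (leq_trans (size_polyC_leq1 _)) //.
by rewrite (leq_trans (size_polyMleq _ _)) // size_polyX addn2 ltnS size_polyC_leq1.
Qed.

Lemma gen_dec (f : F) : exists A B, f = in_alg F A + in_alg F B * gen_y.
Proof.
exists (polyn f)`_0, (polyn f)`_1; rewrite in_qpoly_decomposition.
have sf : (size (polyn f) <= 2)%N.
  by rewrite -ltnS; apply: leq_trans (size_mk_monic f) _; rewrite mkE size_curve_poly.
apply/val_inj; rewrite [RHS](in_qpoly_small (small _ _)).
apply/polyP => i; rewrite coefD coefC coefMX coefC.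
case: i => [|[|i]] /=; rewrite ?addr0 ?add0r //.
by rewrite nth_default // (leq_trans sf).
Qed.

Lemma gen_ind A B : in_alg F A + in_alg F B * gen_y = 0 -> A = 0 /\ B = 0.
Proof.
rewrite in_qpoly_decomposition => /(congr1 (fun f : {poly %/ cp} => polyn f)).
rewrite [LHS](in_qpoly_small (small _ _)).
exact: affine_poly_eq0.
Qed.

(** The equation says that the regular differential a dx / y is fixed by the
    Cartier operator. *)
Lemma curve_p_rank (V : seq {poly k}) (g : nat) : uniq V ->
    (forall a, (a \in V) <->
       (2 * size a < n)%N /\ (a * q ^+ p./2)^`(p.-1) + a ^+ p = 0) ->
    size V = (p ^ g)%N ->
  curve_has_p_rank k p n g.
Proof.
move=> uV VP sV; exists curve_poly_irreducible.
have [|L [uL sL LP]] := @torsion_count k K (@FracField.tofrac {poly k})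
  (@tofrac_inj _) (@fracP _) p charp p_odd F (constants curve_poly_irreducible)
  (in_alg F) _ gen_y Q gen_y2 gen_dec gen_ind n n_gt0 pn erefl V uV VP.
  by [].
apply: (elementary_abelian_basis (pcharf_prime charp) uL LP).
by rewrite sL.
Qed.

End FunctionField.

(** * Monomial semilinear systems *)

Section Semilinear.
Variables (k : closedFieldType) (p : nat).
Hypothesis charp : p \in [pchar k].
Let p_prime : prime p := pcharf_prime charp.

Lemma closed_roots_uniq (c : k) m : (0 < m)%N -> c != 0 ->
  exists s : seq k, [/\ uniq s, size s = (p ^ m)%N &
    forall x, (x \in s) = (x ^+ (p ^ m) == c * x)].
Proof.
move=> m_gt0 c0; set q : {poly k} := 'X^(p ^ m) - c *: 'X.
have pm : (1 < p ^ m)%N by rewrite -(exp1n m) ltn_exp2r // prime_gt1.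
have sc : (size (- (c *: 'X : {poly k})) < size ('X^(p ^ m) : {poly k}))%N.
  by rewrite size_polyN size_scale // size_polyX size_polyXn ltnS.
have sq : size q = (p ^ m).+1 by rewrite size_polyDl // size_polyXn.
have lq : lead_coef q = 1 by rewrite lead_coefDl // lead_coefXn.
have [s qE] := closed_field_poly_normal q; rewrite lq scale1r in qE.
have dq : q^`() = - c%:P.
  rewrite derivB derivXn derivZ derivX -mulr_natr (_ : _%:R = 0).
    by rewrite mulr0 sub0r alg_polyC.
  apply/eqP; rewrite -polyC_natr polyC_eq0 -(dvdn_pcharf charp).
  by rewrite -(prednK m_gt0) expnS dvdn_mulr.
exists s; split.
- rewrite -separable_prod_XsubC -qE unlock dq.
  by rewrite -scaleN1r -[c%:P]alg_polyC scalerA coprimepZr ?coprimep1 //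
    mulN1r oppr_eq0.
- by apply: succn_inj; rewrite -sq qE size_prod_XsubC.
by move=> x; rewrite -root_prod_XsubC -qE rootE !hornerE subr_eq0.
Qed.

Variables (T : finType) (f : T -> T) (c : T -> k) (S : pred T).
Hypotheses (f_inj : injective f) (c0 : forall x, c x != 0).
Hypothesis S_closed : forall x, S (f x) = S x.

Let S_iter m x : S (iter m f x) = S x.
Proof. by elim: m => //= m IH; rewrite S_closed. Qed.

Let fsym := fconnect_sym f_inj.

Let S_connect x y : fconnect f x y -> S y = S x.
Proof. by move=> /iter_findex <-; rewrite S_iter. Qed.

Let rconn x : fconnect f (froot f x) x.
Proof. by rewrite fsym connect_root. Qed.

(* The system determines the values along a cycle from the one at r. *)
Let Fixpoint orbit_val (r : T) (b : k) i :=
  if i is j.+1 then orbit_val r b j ^+ p / c (iter j f r) else b.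

(* The constant C such that b ^ (p ^ i) = C * orbit_val r b i. *)
Let Fixpoint orbit_const (r : T) i : k :=
  if i is j.+1 then orbit_const r j ^+ p * c (iter j f r) else 1.

Let const_neq0 r i : orbit_const r i != 0.
Proof. by elim: i => [|i IH] /=; rewrite ?oner_neq0 // mulf_neq0 ?expf_neq0. Qed.

Let orbit_valE r b i : orbit_val r b i = b ^+ (p ^ i) / orbit_const r i.
Proof.
elim: i => [|i IH] /=; first by rewrite divr1.
by rewrite IH expr_div_n -exprM -expnSr invfM mulrA.
Qed.

Let solution (u : {ffun T -> k}) :=
  forall x, u x ^+ p = c x * u (f x) /\ (~~ S x -> u x = 0).

Let solution_orbit u r i : solution u -> u (iter i f r) = orbit_val r (u r) i.
Proof.
move=> su; elim: i => //= i <-; have [-> _] := su (iter i f r).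
by rewrite mulrC mulKf.
Qed.

Let roots_of r : seq k := sval (cid (closed_roots_uniq (order_gt0 f r) (const_neq0
  r (order f r)))).

Let roots_ofP r : [/\ uniq (roots_of r), size (roots_of r) = (p ^ order f r)%N &
  forall b, (b \in roots_of r) = (orbit_val r b (order f r) == b)].
Proof.
rewrite /roots_of; case: cid => s /= [us ss sP]; split=> // b.
rewrite sP orbit_valE mulrC; apply/eqP/eqP => [->|{2}<-]; first by rewrite mulfK.
by rewrite divfK.
Qed.

Let R r := froots f r && S r.
Let size_of r := if R r then (p ^ order f r)%N else 1%N.
Let index_type := {dffun forall r : T, 'I_(size_of r)}.

Let of_index (e : index_type) : {ffun T -> k} :=
  [ffun x => if S x then
     let r := froot f x in orbit_val r (nth 0 (roots_of r) (e r)) (findex f r x)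
   else 0].

Let nth_roots (e : index_type) r : R r -> nth 0 (roots_of r) (e r) \in roots_of r.
Proof.
move=> Rr; apply: mem_nth; have [_ -> _] := roots_ofP r.
by apply: leq_trans (ltn_ord (e r)) _; rewrite /size_of Rr.
Qed.

Let R_root x : S x -> R (froot f x).
Proof. by move=> Sx; rewrite /R (roots_root fsym) -(S_connect (rconn x)). Qed.

Let of_index_solution e : solution (of_index e).
Proof.
move=> x; split; last by rewrite ffunE => /negPf ->.
rewrite !ffunE S_closed /=; case: ifP => Sx; last first.
  by rewrite mulr0 expr0n eqn0Ngt (prime_gt0 p_prime).
have rE : froot f (f x) = froot f x.
  by apply/esym/eqP; rewrite (root_connect fsym) fconnect1.
rewrite rE; set r := froot f x; set b := nth _ _ _.
have rx : fconnect f r x := rconn x.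
have lt := findex_max rx.
have step : orbit_val r b (findex f r x).+1 = orbit_val r b (findex f r x) ^+ p / c x.
  by rewrite /= iter_findex.
have -> : orbit_val r b (findex f r (f x)) = orbit_val r b (findex f r x).+1.
  rewrite -{1}(iter_findex rx) -iterS; move: lt; rewrite leq_eqVlt => /orP[/eqP e1|lt].
    rewrite e1 (iter_order f_inj) findex0.
    have [_ _ rP] := roots_ofP r; apply/esym/eqP; rewrite -rP.
    exact/nth_roots/R_root.
  by rewrite findex_iter.
by rewrite step mulrC divfK.
Qed.

Let of_index_inj : injective of_index.
Proof.
move=> e e' ee; apply/ffunP => r; apply: val_inj.
case Rr : (R r); last first.
  by case: (e r) (e' r); rewrite /size_of Rr => i /= + [j /=]; case: i; case: j.
have [fr Sr] := andP Rr; have [ur sr _] := roots_ofP r.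
have := congr1 (fun u : {ffun T -> k} => u r) ee; rewrite !ffunE Sr /=.
rewrite (eqP fr) findex0 /= => /eqP.
have lt (i : 'I_(size_of r)) : (i < size (roots_of r))%N.
  by rewrite sr; apply: leq_trans (ltn_ord i) _; rewrite /size_of Rr.
by rewrite nth_uniq // => /eqP.
Qed.

Let of_index_surj u : solution u -> exists e, of_index e = u.
Proof.
move=> su.
have hroot r : R r -> u r \in roots_of r.
  move=> Rr; have [_ _ ->] := roots_ofP r; rewrite -solution_orbit //.
  by rewrite (iter_order f_inj).
have gt0 r : (0 < size_of r)%N.
  by rewrite /size_of; case: ifP => // _; rewrite expn_gt0 (prime_gt0 p_prime).
pose e : index_type := [ffun r => insubd (Ordinal (gt0 r)) (index (u r) (roots_of r))].
exists e; apply/ffunP => x; rewrite ffunE /=; case: ifP => Sx; last first.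
  by have [_ ->] := su x; rewrite ?Sx.
have Rr := R_root Sx; set r := froot f x in Rr *.
have [_ sr _] := roots_ofP r.
have -> : nth 0 (roots_of r) (e r) = u r.
  have lt : (index (u r) (roots_of r) < size_of r)%N.
    by rewrite /size_of Rr -sr index_mem hroot.
  rewrite ffunE val_insubd lt.
  by rewrite nth_index // hroot.
by rewrite -solution_orbit // iter_findex // rconn.
Qed.

Let card_index : #|{: index_type}| = (p ^ #|S|)%N.
Proof.
rewrite card_dep_ffun foldrE big_map big_enum /=.
under eq_bigr => r _ do rewrite card_ord.
have -> : (\prod_(r : T) size_of r = \prod_(r | R r) p ^ order f r)%N.
  by rewrite [RHS]big_mkcond.
rewrite -expn_sum; congr (_ ^ _)%N.
rewrite -sum1_card [RHS](partition_big (froot f) R) => [|x xS]; last exact: (R_root xS).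
apply: eq_bigr => r /andP[fr Sr]; rewrite sum1_card; apply: eq_card => x.
apply/idP/idP => [rx|]; last by case/andP=> _ /eqP <-; exact: rconn.
apply/andP; split; first by rewrite -topredE /= (S_connect rx).
by rewrite -(eqP fr) eq_sym (root_connect fsym).
Qed.

(** Each cycle of length m contributes the p ^ m roots of a separable
    polynomial X ^ (p ^ m) - C * X. *)
Lemma semilinear_solutions : exists L : seq {ffun T -> k},
  [/\ uniq L, size L = (p ^ #|S|)%N & forall u, (u \in L) <->
    forall x, u x ^+ p = c x * u (f x) /\ (~~ S x -> u x = 0)].
Proof.
exists (map of_index (enum {: index_type})); split.
- by rewrite map_inj_uniq ?enum_uniq.
- by rewrite size_map -cardE card_index.
move=> u; split=> [/mapP[e _ ->]|/of_index_surj[e <-]]; first exact: of_index_solution.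
by apply: map_f; rewrite mem_enum.
Qed.

End Semilinear.

(** * Fixed points of the Cartier operator *)

Section CartierFixedPoints.
Variables (k : closedFieldType) (p n : nat).
Hypotheses (charp : p \in [pchar k]) (p_odd : odd p).
Hypotheses (n_gt0 : (0 < n)%N) (pn : coprime p n).
Local Notation q := ('X^n + 1 : {poly k}).
Let h := p./2.
Let p_prime : prime p := pcharf_prime charp.
Let p_gt0 : (0 < p)%N := prime_gt0 p_prime.
Let p2h : p = (2 * h).+1.
Proof. by rewrite /h -{1}(odd_double_half p) p_odd -mul2n. Qed.

(** The coefficient by which D^(p-1) multiplies X^(i+p-1): Wilson's theorem. *)
Lemma ffact_pred_mod i : ((i + p.-1) ^_ p.-1)%:R = if (p %| i)%N then -1 else 0 :> k.
Proof.
case: ifP => [pi|npi].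
  rewrite ffact_prod natr_prod.
  have -> : -1 = (p.-1 ^_ p.-1)%:R :> k.
    have := Wilson (prime_gt1 p_prime); rewrite p_prime => /esym.
    rewrite (dvdn_pcharf charp) -natr1 addr_eq0 ffactnn => /eqP ->.
    by [].
  rewrite ffact_prod natr_prod; apply: eq_bigr => j _.
  have jp : (j <= p.-1)%N by apply: ltnW.
  rewrite !natrB // ?(leq_trans jp) ?leq_addl // natrD.
  by have /eqP -> : i%:R == 0 :> k by [rewrite -(dvdn_pcharf charp)]; rewrite add0r.
apply/eqP; rewrite -(dvdn_pcharf charp).
have : (p %| (i + p.-1) ^_ p)%N.
  by rewrite -bin_ffact dvdn_mull // dvdn_fact // p_gt0 leqnn.
rewrite -{3}(prednK p_gt0) ffactnSr addnK Euclid_dvdM // npi orbF.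
by [].
Qed.

(** Both a p-th power and a (p-1)-st derivative only have exponents divisible
    by p. *)
Lemma coef_cartier (a : {poly k}) : (a * q ^+ h)^`(p.-1) + a ^+ p = 0 <->
  forall j, a`_j ^+ p = (a * q ^+ h)`_(p * j + p.-1).
Proof.
have cE (b : {poly k}) i : b^`(p.-1)`_i = if (p %| i)%N then - b`_(i + p.-1) else 0.
  rewrite coef_derivn addnC -mulr_natr ffact_pred_mod.
  by case: ifP => _; rewrite ?mulrN1 ?mulr0.
split=> [e j|e].
  have := congr1 (fun b : {poly k} => b`_(p * j)) e.
  rewrite coefD cE (coef_expp charp) dvdn_mulr // mulKn // coef0 addrC => /eqP.
  by rewrite subr_eq0 => /eqP.
apply/polyP => i; rewrite coefD cE (coef_expp charp) coef0.
case: ifP => [/dvdnP[j ->]|_]; last by rewrite addr0.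
by rewrite mulnK // e [(p * j)%N]mulnC addNr.
Qed.

Lemma coef_mul_power (a : {poly k}) m :
  (a * q ^+ h)`_m = \sum_(s < h.+1) (if (m < n * s)%N then 0 else a`_(m - n * s))
    *+ 'C(h, s).
Proof.
rewrite exprD1n mulr_sumr coef_sum; apply: eq_bigr => s _.
by rewrite -exprM mulrnAr coefMn coefMXn.
Qed.

(* Only the term s = p * l %/ n is in the range of the coefficients of a. *)
Lemma coef_mul_power_reg (a : {poly k}) l : (2 * size a < n)%N -> (0 < l)%N ->
  (a * q ^+ h)`_(p * l).-1 =
  if (2 * l < n)%N then a`_(p * l %% n).-1 *+ 'C(h, p * l %/ n) else 0.
Proof.
move=> sa l0; rewrite coef_mul_power.
have pl0 : (0 < p * l)%N by rewrite muln_gt0 p_gt0.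
case: ifP => ln; last first.
  rewrite big1 // => s _; case: ifP => [_|/negbT]; first by rewrite mul0rn.
  rewrite -leqNgt => le; rewrite nth_default ?mul0rn //.
  have sh : (s <= h)%N by rewrite -ltnS ltn_ord.
  have h1 : (n * s <= n * h)%N by rewrite leq_mul2l sh orbT.
  have h2 : (n * p <= 2 * (p * l))%N.
    by rewrite mulnCA [(n * p)%N]mulnC leq_mul2l leqNgt ln orbT.
  have h3 : (n * p = 2 * (n * h) + n)%N by rewrite {1}p2h mulnS mulnCA addnC.
  move: sa le h1 h2 h3 pl0; set sz := size a.
  by move: (n * s)%N (n * h)%N (p * l)%N (n * p)%N; clear => *; lia.
have r0 : (0 < p * l %% n)%N.
  rewrite lt0n -/(dvdn _ _) mulnC Gauss_dvdl 1?coprime_sym //.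
  by apply/negP => /dvdn_leq; lia.
have rn : (p * l %% n < n)%N by rewrite ltn_mod.
have eq := divn_eq (p * l) n; set d := (p * l %/ n)%N in eq *.
set r := (p * l %% n)%N in r0 rn eq *.
have dh : (d <= h)%N.
  rewrite -ltnS ltn_divLR // mulSn.
  have h2 : (2 * (p * l) < n * p)%N by rewrite mulnCA [(n * p)%N]mulnC ltn_pmul2l.
  have h3 : (n * p = 2 * (n * h) + n)%N by rewrite {1}p2h mulnS mulnCA addnC.
  by rewrite [(h * n)%N]mulnC; lia.
rewrite (bigD1 (inord d)) //= inordK ?ltnS // ltnNge eq.
have -> : ((d * n + r).-1 - n * d = r.-1)%N by rewrite mulnC; lia.
have -> : (n * d <= (d * n + r).-1)%N by rewrite mulnC; lia.
rewrite /= big1 ?addr0 // => s; rewrite -val_eqE /= inordK ?ltnS // => sd.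
case: ifP => [_|/negbT]; first by rewrite mul0rn.
rewrite -leqNgt => le; rewrite nth_default ?mul0rn //.
have lt : (s < d)%N.
  rewrite ltn_neqAle sd -ltnS -(ltn_pmul2l n_gt0) mulnS [(n * d)%N]mulnC.
  by move: le r0 rn; move: (n * s)%N (d * n)%N; clear => *; lia.
have : (n * s.+1 <= n * d)%N by rewrite leq_pmul2l.
rewrite mulnS [(n * d)%N]mulnC; move: sa le r0 rn; set sz := size a.
by move: (n * s)%N (d * n)%N; clear => *; lia.
Qed.

(** In the basis of the x ^ (l - 1) dx / y, the Cartier operator is monomial. *)
Lemma cartier_fixed (a : {poly k}) : (2 * size a < n)%N ->
  (a * q ^+ h)^`(p.-1) + a ^+ p = 0 <->
  forall l, (0 < l)%N -> (2 * l < n)%N ->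
    a`_l.-1 ^+ p = a`_(p * l %% n).-1 *+ 'C(h, p * l %/ n).
Proof.
have idx j : (p * j + p.-1 = (p * j.+1).-1)%N by rewrite mulnS; lia.
move=> sa; rewrite coef_cartier; split=> [e [//|j] _ ln|e j].
  by rewrite e idx coef_mul_power_reg // ln.
rewrite idx coef_mul_power_reg //; case: ifP => ln; first by rewrite -e.
rewrite nth_default ?expr0n ?eqn0Ngt ?p_gt0 //.
by move: sa ln; set sz := size a; clear; lia.
Qed.

Definition mulp (x : 'I_n) : 'I_n := Ordinal (ltn_pmod (p * x) n_gt0).

(** The indices l for which x ^ (l - 1) dx / y lies in the subspace on which the
    Cartier operator is bijective: it permutes the lines of these differentials
    as long as the orbit of l under multiplication by p stays below n / 2. *)
Definition stable : pred 'I_n := fun x =>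
  (0 < x)%N && [forall y, fconnect mulp x y ==> (2 * y < n)%N].

Lemma mulp_inj : injective mulp.
Proof.
move=> x y /(congr1 val) /= /eqP e; apply: val_inj; apply/eqP.
wlog le : x y e / (x <= y)%N.
  move=> H; case/orP: (leq_total x y) => le; first exact: (H x y).
  by rewrite eq_sym; apply: H => //; rewrite eq_sym.
move: e; rewrite eq_sym eqn_mod_dvd ?leq_mul2l ?le ?orbT // -mulnBr.
rewrite Gauss_dvdr 1?coprime_sym // eq_sym eqn_leq le andbT => dv.
have [|lt] := leqP y x; first by [].
have := dvdn_leq _ dv; rewrite subn_gt0 => /(_ lt); have := ltn_ord y; lia.
Qed.

Lemma mulp_gt0 x : (0 < mulp x)%N = (0 < x)%N.
Proof.
rewrite !lt0n -/(dvdn _ _) /= -/(dvdn _ _) mulnC Gauss_dvdl 1?coprime_sym //.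
congr (~~ _); apply/idP/eqP => [dv|->]; last exact: dvdn0.
by apply/eqP; rewrite eqn0Ngt; apply/negP => /dvdn_leq/(_ dv); rewrite leqNgt ltn_ord.
Qed.

Lemma stable_closed x : stable (mulp x) = stable x.
Proof.
rewrite /stable mulp_gt0; congr (_ && _); apply: eq_forallb => y.
by rewrite -(same_fconnect1 mulp_inj).
Qed.

Lemma stable_lt x : stable x -> (0 < x)%N /\ (2 * x < n)%N.
Proof. by case/andP=> x0 /forallP/(_ x); rewrite connect0. Qed.

Let c (x : 'I_n) : k := if (2 * x < n)%N then 'C(h, p * x %/ n)%:R else 1.

Let c_neq0 x : c x != 0.
Proof.
rewrite /c; case: ifP => [xn|_]; last exact: oner_neq0.
rewrite -(dvdn_pcharf charp); apply/negP => dv.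
have le : (p * x %/ n <= h)%N.
  rewrite -ltnS ltn_divLR // mulSn.
  have h2 : (2 * (p * x) < n * p)%N by rewrite mulnCA [(n * p)%N]mulnC ltn_pmul2l.
  have h3 : (n * p = 2 * (n * h) + n)%N by rewrite {1}p2h mulnS mulnCA addnC.
  by rewrite [(h * n)%N]mulnC; lia.
have : (p %| h`!)%N by rewrite -(bin_fact le) dvdn_mulr.
have nd m : (m < p)%N -> (p %| m`!)%N = false.
  elim: m => [|m IH] mp; first by rewrite fact0 dvdn1 gtn_eqF // prime_gt1.
  by rewrite factS Euclid_dvdM // IH 1?ltnW // orbF gtnNdvd.
by rewrite nd //; lia.
Qed.

Let val_at (u : {ffun 'I_n -> k}) i : k := if insub i is Some x then u x else 0.

Let val_atE u (x : 'I_n) : val_at u x = u x.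
Proof. by rewrite /val_at valK. Qed.

Let to_poly (u : {ffun 'I_n -> k}) : {poly k} := \poly_(i < n) val_at u i.+1.

Let coef_to_poly u (x : 'I_n) : (0 < x)%N -> (to_poly u)`_x.-1 = u x.
Proof.
move=> x0; have lt : (x.-1 < n)%N := leq_ltn_trans (leq_pred _) (ltn_ord x).
by rewrite coef_poly lt prednK // val_atE.
Qed.

(** A fixed point vanishes outside of the stable indices, where the conditions
    form a semilinear system that permutes the coordinates. *)
Lemma cartier_fixed_count : exists V : seq {poly k},
  [/\ uniq V, size V = (p ^ #|stable|)%N & forall a, (a \in V) <->
    (2 * size a < n)%N /\ (a * q ^+ h)^`(p.-1) + a ^+ p = 0].
Proof.
have [L [uL sL LP]] := semilinear_solutions charp mulp_inj c_neq0 stable_closed.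
have x0_unstable (x : 'I_n) : ~~ (0 < x)%N -> ~~ stable x by rewrite /stable =>
  /negPf ->.
exists (map to_poly L); split; rewrite ?size_map //.
  rewrite map_inj_in_uniq // => u v /LP su /LP sv uv; apply/ffunP => x.
  have [x0|x0] := boolP (0 < x)%N; first by rewrite -!coef_to_poly // uv.
  by have [_ ->] := su x; [have [_ ->] := sv x|]; rewrite ?x0_unstable.
move=> a; split=> [/mapP[u /LP su ->]|[sa]].
  have sz : (2 * size (to_poly u) < n)%N.
    suff : (size (to_poly u) <= n.-1./2)%N by have := odd_double_half n.-1; lia.
    apply/leq_sizeP => i le; rewrite coef_poly; case: ifP => // _.
    rewrite /val_at; case: insubP => // x _ xE; have [_ -> //] := su x.
    by apply/negP => /stable_lt[_]; rewrite xE; have := odd_double_half n.-1; lia.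
  split=> //; apply/(cartier_fixed sz) => l l0 ln.
  have ltn : (l < n)%N by lia.
  pose x := Ordinal ltn; have := coef_to_poly u (x := x) l0 => /= ->.
  have := coef_to_poly u (x := mulp x); rewrite mulp_gt0 => /(_ l0) /= ->.
  by have [-> _] := su x; rewrite /c ln mulrC mulr_natr.
move/(cartier_fixed sa) => fixa.
pose u : {ffun 'I_n -> k} := [ffun x : 'I_n => if (0 < x)%N then a`_x.-1 else 0].
have aE : to_poly u = a.
  apply/polyP => i; rewrite coef_poly; case: ifP => [lt|/negbT]; last first.
    by rewrite -leqNgt => le; rewrite nth_default //; move: sa le;
      set sz := size a; clear; lia.
  rewrite /val_at; case: insubP => [x _ xE|]; first by rewrite ffunE xE.
  by rewrite -leqNgt => le; rewrite nth_default //; move: sa le; set sz := size a;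
    clear; lia.
rewrite -aE; apply: map_f; apply/LP.
have big (x : 'I_n) : ~~ (2 * x < n)%N -> u x = 0.
  move=> xn; rewrite ffunE; case: ifP => // x0.
  by rewrite nth_default //; move: sa x0 xn; set s := size a; lia.
have step (x : 'I_n) : (0 < x)%N -> (2 * x < n)%N -> u x ^+ p = c x * u (mulp x).
  by move=> x0 xn; rewrite /c xn !ffunE mulp_gt0 x0 fixa // mulrC mulr_natr.
have back (x : 'I_n) : u (mulp x) = 0 -> u x = 0.
  move=> ux; have [x0|x0] := boolP (0 < x)%N; last by rewrite ffunE (negPf x0).
  have [xn|/big//] := boolP (2 * x < n)%N.
  by have /eqP := step x x0 xn; rewrite ux mulr0 expf_eq0 p_gt0 => /eqP.
(* Off the stable set, some iterate of x is too large to index a coefficient. *)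
have unst x : ~~ stable x -> u x = 0.
  rewrite negb_and; case/orP=> [x0|]; first by rewrite ffunE (negPf x0).
  rewrite negb_forall => /existsP[y]; rewrite negb_imply => /andP[/iter_findex <- /big].
  by elim: (findex _ _ _) => //= m IH /back.
move=> x; split; last exact: unst.
have [sx|sx] := boolP (stable x); first by have [] := stable_lt sx; exact: step.
by rewrite !unst ?stable_closed // mulr0 expr0n eqn0Ngt p_gt0.
Qed.

End CartierFixedPoints.

Local Close Scope ring_scope.
Local Open Scope nat_scope.

(** * Counting by digits *)

Section Digits.
Variables (p h : nat).
Hypothesis p2h : p = (2 * h).+1.

Fixpoint of_digits r (s : nat -> nat) :=
  if r is r'.+1 then s 0 + p * of_digits r' (fun i => s i.+1) else 0.

Lemma eq_of_digits r s s' : (forall i, i < r -> s i = s' i) -> of_digits r s =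
  of_digits r s'.
Proof.
elim: r s s' => //= r IH s s' e; rewrite e // (IH _ (fun i => s' i.+1)) // => i ir.
exact: e.
Qed.

Lemma of_digitsD r s s' : of_digits r (fun i =>
  s i + s' i) = of_digits r s + of_digits r s'.
Proof.
elim: r s s' => //= r IH s s'.
by rewrite (IH (fun i => s i.+1) (fun i => s' i.+1)) mulnDr addnACA.
Qed.

Lemma of_digits_cat a b s : of_digits (a + b) s =
  of_digits a s + p ^ a * of_digits b (fun i => s (a + i)).
Proof.
elim: a s => [|a IH] s /=; first by rewrite mul1n.
by rewrite (IH (fun i => s i.+1)) expnS mulnDr addnA mulnA.
Qed.

Lemma of_digitsSr r s : of_digits r.+1 s = of_digits r s + s r * p ^ r.
Proof. by rewrite -addn1 of_digits_cat /= muln0 !addn0 mulnC. Qed.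

Lemma leq_of_digits r s s' : (forall i,
  i < r -> s i <= s' i) -> of_digits r s <= of_digits r s'.
Proof.
elim: r s s' => //= r IH s s' e; rewrite leq_add ?e // leq_mul2l IH ?orbT // => i ir.
exact: e.
Qed.

Lemma of_digits_pred r : (of_digits r (fun=> p.-1)).+1 = p ^ r.
Proof. by elim: r => //= r IH; rewrite expnS -IH p2h /=; nia. Qed.

Lemma of_digits_half r : (2 * of_digits r (fun=> h)).+1 = p ^ r.
Proof.
rewrite mul2n -addnn -of_digitsD -[RHS]of_digits_pred; congr _.+1;
  apply: eq_of_digits => i _.
by rewrite p2h /= mul2n addnn.
Qed.

Lemma of_digits_expansion r m : m < p ^ r -> of_digits r (fun i => m %/ p ^ i %% p) = m.
Proof.
elim: r m => [|r IH] m /=; first by rewrite expn0 ltnS leqn0 => /eqP.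
rewrite expnS mulnC => lt; have p0 : 0 < p by rewrite p2h.
rewrite (eq_of_digits (s' := fun i => m %/ p %/ p ^ i %% p)) => [|i _]; last first.
  by rewrite expnS divnMA.
by rewrite IH ?ltn_divLR // divn1 mulnC addnC -divn_eq.
Qed.

(** There are no carries between digits that are less than p apart. *)
Lemma of_digits_inj r s s' :
    (forall i, i < r -> s i < s' i + p /\ s' i < s i + p) ->
    of_digits r s = of_digits r s' -> forall i, i < r -> s i = s' i.
Proof.
elim: r s s' => // r IH s s' close /= e.
have [c1 c2] := close 0 isT.
have e0 : s 0 = s' 0.
  move: e c1 c2; move: (of_digits _ _) (of_digits _ _) => a b.
  have [lt|lt|->] := ltngtP a b; last by move/addIn.
    by have := leq_mul (leqnn p) lt; rewrite mulnS; lia.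
  by have := leq_mul (leqnn p) lt; rewrite mulnS; lia.
case=> // i ir; apply: (IH (fun i => s i.+1) (fun i => s' i.+1)) => //.
  by move=> j jr; apply: close.
by move: e; rewrite e0 => /addnI/eqP; rewrite eqn_mul2l p2h => /eqP.
Qed.

(** ** Rotation of digits *)

Section Rotation.
Variables (N' : nat) (d : nat -> nat).
Let N := N'.+1.
Hypothesis d_period : forall t, d (t + N) = d t.

Let shift j t := d (t + j * N').

Let shift_period j t : shift j (t + N) = shift j t.
Proof. by rewrite /shift addnAC d_period. Qed.

Let of_digits_shift1 j : p * of_digits N (shift j) =
  of_digits N (shift j.+1) + shift j N' * (p ^ N).-1.
Proof.
have -> : of_digits N (shift j.+1) = shift j N' + p * of_digits N' (shift j).
  rewrite /N /=; congr (_ + _ * _).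
  apply: eq_of_digits => i _; rewrite -[RHS]shift_period /shift mulSn.
  by congr d; rewrite /N; move: (j * N'); clear; lia.
have pN : 0 < p ^ N by rewrite expn_gt0 p2h.
rewrite {1}/N of_digitsSr mulnDr mulnCA -expnS -/N -{1}(prednK pN) mulnS.
by rewrite addnA [p * _ + _]addnC.
Qed.

Lemma of_digits_shift j : p ^ j * of_digits N d =
  of_digits N (shift j) %[mod (p ^ N).-1].
Proof.
elim: j => [|j IH].
  by rewrite mul1n (eq_of_digits (s' := shift 0)) // => i _; rewrite /shift addn0.
rewrite expnS -mulnA -modnMmr IH modnMmr of_digits_shift1.
by rewrite addnC modnMDl.
Qed.

End Rotation.

(** ** Stable residues and digits *)

Section StableDigits.
Variables (n e N' : nat).
Let N := N'.+1.
Hypotheses (h_gt0 : 0 < h) (n_gt0 : 0 < n) (pn : coprime p n) (ne : n * e = (p ^ N).-1).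

Let pN_gt1 : 1 < p ^ N.
Proof. by rewrite -(exp1n N) ltn_exp2r // p2h; lia. Qed.

Let e_gt0 : 0 < e.
Proof. by rewrite lt0n; apply/eqP => e0; move: ne pN_gt1; rewrite e0; lia. Qed.

Lemma iter_mulp j (l : 'I_n) : iter j (mulp p n_gt0) l = p ^ j * l %% n :> nat.
Proof.
elim: j => [|j IH]; first by rewrite mul1n modn_small.
by rewrite /= IH modnMmr mulnA expnS.
Qed.

Lemma stable_iter (l : 'I_n) : stable p n_gt0 l <->
  0 < l /\ forall j, 2 * (p ^ j * l %% n) < n.
Proof.
rewrite /stable; split=> [/andP[l0 /forallP st]|[l0 st]].
  split=> // j; rewrite -iter_mulp.
  by have /implyP := st (iter j (mulp p n_gt0) l); apply; apply: fconnect_iter.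
rewrite l0; apply/forallP => y; apply/implyP => /iter_findex <-.
by rewrite iter_mulp.
Qed.

(** As l / n = l * e / (p ^ N - 1) has period N in base p, multiplying by p
    rotates its digits, and the digits are at most h = (p - 1) / 2 as soon as
    every rotation is at most 1 / 2. *)
Lemma stable_digits (l : 'I_n) : stable p n_gt0 l <->
  [/\ 0 < l, 2 * l != n & exists2 d, (forall t, d t <= h) & l * e = of_digits N d].
Proof.
have modE j m : p ^ j * (m * e) %% (p ^ N).-1 = (p ^ j * m %% n) * e.
  by rewrite -ne mulnA muln_modl.
have half_bound d : (forall t, d t <= h) -> 2 * of_digits N d <= (p ^ N).-1.
  by move=> dh; rewrite -(of_digits_half N) succnK leq_mul2l leq_of_digits.
rewrite stable_iter; split=> [[l0 st]|[l0 l2 [d0 dh0 lE0]]].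
  split=> //; first by have := st 0; rewrite mul1n modn_small // => /ltn_eqF ->.
  have le_lt : l * e < p ^ N.
    have : l * e < n * e by rewrite ltn_pmul2r.
    by rewrite ne; lia.
  pose d t := (l * e) %/ p ^ (t %% N) %% p.
  have dE : l * e = of_digits N d.
    rewrite -[LHS](of_digits_expansion le_lt); apply: eq_of_digits => i iN.
    by rewrite /d [i %% N]modn_small.
  have per t : d (t + N) = d t by rewrite /d modnDr.
  exists d => // t; rewrite -ltnS.
  have -> : d t = d (t %% N) by rewrite /d modn_mod.
  have tN : t %% N < N by rewrite ltn_mod.
  set t' := t %% N in tN *; set j := N' - t'.
  (* After j rotations, the digit t' comes first. *)
  have top : d (N' + j * N') = d t'.
    have per_mul i s : d (s + i * N) = d s.
      by elim: i => [|i IH]; rewrite ?addn0 // mulSn addnCA addnC per.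
    have -> : N' + j * N' = t' + j * N by rewrite /N mulnS /j; lia.
    exact: per_mul.
  pose v := of_digits N (fun s => d (s + j * N')).
  have vE : p ^ j * l %% n * e = v %% (p ^ N).-1.
    by rewrite -modE dE; exact: of_digits_shift per j.
  have v_le : v <= (p ^ N).-1.
    rewrite -(of_digits_pred N) succnK; apply: leq_of_digits => i _.
    have p_gt0 : 0 < p by rewrite p2h.
    by rewrite -ltnS (prednK p_gt0); exact: ltn_pmod.
  have v_top : d t' * p ^ N' <= v by rewrite /v of_digitsSr top leq_addl.
  have r_lt := st j; have r_gt0 : 0 < p ^ j * l %% n.
    rewrite lt0n -/(dvdn _ _) mulnC Gauss_dvdl; last by rewrite coprime_sym coprimeXl.
    by apply/negP => /(dvdn_leq l0); rewrite leqNgt ltn_ord.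
  have v_lt : v < (p ^ N).-1.
    rewrite ltn_neqAle v_le andbT; apply/negP => /eqP vP.
    by move: vE; rewrite vP modnn => /eqP; rewrite muln_eq0 !gtn_eqF.
  rewrite [v %% _]modn_small // in vE.
  have : 2 * (d t' * p ^ N') < p * p ^ N'.
    rewrite -expnS -/N; apply: leq_ltn_trans (_ : 2 * v < _).
      by rewrite leq_mul2l v_top.
    rewrite -vE mulnA; apply: (@leq_ltn_trans (n * e)).
      by rewrite leq_mul2r (ltnW r_lt) orbT.
    by rewrite ne prednK // ltnW.
  by rewrite mulnA ltn_pmul2r ?expn_gt0 ?p2h //; lia.
split=> // j; pose d t := d0 (t %% N).
have dh t : d t <= h by exact: dh0.
have per t : d (t + N) = d t by rewrite /d modnDr.
have lE : l * e = of_digits N d.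
  by rewrite lE0; apply: eq_of_digits => i iN; rewrite /d [i %% N]modn_small.
pose v := of_digits N (fun s => d (s + j * N')).
have vE : p ^ j * l %% n * e = v %% (p ^ N).-1.
  by rewrite -modE lE; exact: of_digits_shift per j.
have v_le : 2 * v <= (p ^ N).-1 by apply: half_bound.
rewrite [v %% _]modn_small in vE; last by move: v_le pN_gt1; clear; lia.
rewrite -(ltn_pmul2r e_gt0) -mulnA vE ne ltn_neqAle v_le andbT.
apply: contra l2 => /eqP vP.
have : n %| p ^ j * (2 * l).
  have half : 2 * (p ^ j * l %% n) = n.
    by apply/eqP; rewrite -(eqn_pmul2r e_gt0) -mulnA vE vP ne.
  by rewrite mulnCA /dvdn -modnMmr half modnn.
rewrite Gauss_dvdr; last by rewrite coprime_sym coprimeXl.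
case/dvdnP=> -[|[|c]] lc; rewrite ?mul1n in lc; first by lia.
  by rewrite lc.
by have := ltn_ord l; lia.
Qed.

End StableDigits.
End Digits.

(** * Columns of digits *)

Section Columns.
Variables (p h : nat).
Hypothesis p2h : p = (2 * h).+1.
Local Notation of_digits := (of_digits p).

(** The c * r digits are arranged in c blocks of length r, and the i-th column
    collects the i-th digits of all the blocks. *)
Variables (c r : nat) (Col : finType) (comp : Col -> nat -> nat).
Hypotheses (c_gt0 : 0 < c) (r_gt0 : 0 < r).
Hypothesis comp_le : forall x j, comp x j <= h.
Hypothesis comp_inj : forall x y, (forall j, j < c -> comp x j = comp y j) -> x = y.
Hypothesis comp_surj : forall s, (forall j, s j <= h) ->
  exists x, forall j, j < c -> comp x j = s j.
Implicit Types F : {ffun 'I_r -> Col}.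

(** The values of s may exceed p - 1: sums of several entries of a column are
    such values. *)
Definition layer (s : Col -> nat) F :=
  of_digits r (fun i => if insub i is Some x then s (F x) else 0).

Definition digit F j i := if insub i is Some x then comp (F x) j else 0.
Definition total F := of_digits (c * r) (fun t => digit F (t %/ r) (t %% r)).

Lemma digitE F j (i : 'I_r) : digit F j i = comp (F i) j.
Proof. by rewrite /digit valK. Qed.

Lemma digit_le F j i : digit F j i <= h.
Proof. by rewrite /digit; case: insub. Qed.

Lemma layer_le s b F : (forall x, s x <= b) -> layer s F <= of_digits r (fun=> b).
Proof. by move=> sb; apply: leq_of_digits => i _; case: insub. Qed.

Lemma layerD s s' F : layer s F + layer s' F = layer (fun x => s x + s' x) F.
Proof. by rewrite -of_digitsD; apply: eq_of_digits => i _; case: insub. Qed.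

Lemma layer_const a F : layer (fun=> a) F = of_digits r (fun=> a).
Proof. by apply: eq_of_digits => i ir; rewrite insubT. Qed.

(** A linear condition on layers without carries is a condition on columns. *)
Lemma layer_eq s s' F : (forall x, s x < s' x + p /\ s' x < s x + p) ->
  (layer s F == layer s' F) = [forall i, s (F i) == s' (F i)].
Proof.
move=> close; apply/eqP/forallP => [e1 i|e1].
  have := of_digits_inj p2h _ e1 (ltn_ord i); rewrite valK => -> // j _.
  by case: insubP => [x _ _|_]; [exact: close|rewrite p2h].
by apply: eq_of_digits => i ir; rewrite insubT (eqP (e1 _)).
Qed.

Fixpoint blocks F b j := if b is b'.+1 then layer (comp^~ j) F +
  p ^ r * blocks F b' j.+1 else 0.

Lemma total_blocks F : total F = blocks F c 0.
Proof.
suff gen b j : of_digits (b * r) (fun t =>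
  digit F (t %/ r + j) (t %% r)) = blocks F b j.
  by rewrite -gen /total; apply: eq_of_digits => i _; rewrite addn0.
elim: b j => [|b IH] j //=; rewrite mulSn of_digits_cat -IH; congr (_ + _ * _).
  by apply: eq_of_digits => i ir; rewrite divn_small // modn_small.
by apply: eq_of_digits => i _;
  rewrite divnDl ?dvdnn // divnn r_gt0 modnDl add1n addSnnS.
Qed.

Let close_le s s' : (forall i, s i <= h) -> (forall i, s' i <= h) ->
  forall i : nat, s i < s' i + p /\ s' i < s i + p.
Proof. by move=> sh sh' i; have := sh i; have := sh' i; rewrite p2h; lia. Qed.

Lemma total_inj : injective total.
Proof.
move=> F G e; apply/ffunP => i; apply: comp_inj => j jc.
have lt : j * r + i < c * r.
  by apply: (@leq_trans (j.+1 * r));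
    rewrite ?leq_mul2r ?jc ?orbT // mulSn addnC ltn_add2r.
have := of_digits_inj p2h _ e lt.
rewrite divnMDl // divn_small // addn0 modnMDl modn_small // !digitE; apply.
by move=> t _; apply: close_le => t'; apply: digit_le.
Qed.

Lemma total_surj d : (forall t, d t <= h) -> exists F, total F = of_digits (c * r) d.
Proof.
move=> dh.
have ex (i : 'I_r) : exists x, [forall j : 'I_c, comp x j == d (j * r + i)].
  have [x xE] := comp_surj (s := fun j => d (j * r + i)) (fun j => dh _).
  by exists x; apply/forallP => j; rewrite xE.
exists [ffun i => xchoose (ex i)]; apply: eq_of_digits => t tr.
have ir : t %% r < r by rewrite ltn_mod.
have jc : t %/ r < c by rewrite ltn_divLR.
rewrite -[t %% r]/(val (Ordinal ir)) digitE ffunE.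
have /forallP/(_ (Ordinal jc))/eqP -> := xchooseP (ex (Ordinal ir)).
by rewrite /= -divn_eq.
Qed.

Variables (n e : nat).
Hypotheses (h_gt0 : 0 < h) (n_gt0 : 0 < n) (pn : coprime p n) (ne : n * e =
  (p ^ (c * r)).-1).

Let cr_gt0 : 0 < c * r. Proof. by rewrite muln_gt0 c_gt0. Qed.
Let e_gt0 : 0 < e.
Proof.
have : 1 < p ^ (c * r) by rewrite -(exp1n (c * r)) ltn_exp2r // p2h; lia.
by rewrite lt0n; case: eqP => // e0;
  rewrite -[p ^ _]prednK -?ne ?e0 ?muln0 // expn_gt0 p2h.
Qed.

Let half_total F : 2 * total F <= n * e.
Proof.
rewrite ne -(of_digits_half p2h (c * r)) succnK leq_mul2l; apply/orP; right.
by apply: leq_of_digits => t _; apply: digit_le.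
Qed.

(** The number l * e of a stable residue l is the total of a unique matrix of
    digits. *)
Lemma stable_columns : #|stable p n_gt0| =
  #|[pred F | [&& e %| total F, total F != 0 & 2 * total F != n * e]]|.
Proof.
pose l0 := Ordinal n_gt0; pose g F : 'I_n := insubd l0 (total F %/ e).
have ne' : n * e = (p ^ (c * r).-1.+1).-1 by rewrite prednK.
set B := [pred F | _].
have gE F : F \in B -> g F * e = total F.
  case/and3P => eF t0 t2; rewrite val_insubd ltn_divLR //.
  have -> : total F < n * e by have := half_total F; move: t0 t2; lia.
  by rewrite divnK.
have gst F : F \in B -> stable p n_gt0 (g F).
  move=> FB; have gF := gE F FB; case/and3P: FB => eF t0 t2.
  apply/(stable_digits p2h h_gt0 n_gt0 pn ne'); split.
  - by rewrite lt0n; apply: contraNneq t0 => g0; rewrite -gF g0.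
  - by apply: contraNneq t2 => g2; rewrite -gF mulnA g2.
  exists (fun t => digit F (t %/ r) (t %% r)) => [t|]; first exact: digit_le.
  by rewrite gF prednK.
rewrite -(card_in_imset (f := g) (D := B)) => [|F G FB GB gFG]; last first.
  by apply: total_inj; rewrite -(gE F) // -(gE G) // gFG.
apply: eq_card => l; apply/idP/imsetP => [|[F FB ->]]; last exact: gst.
case/(stable_digits p2h h_gt0 n_gt0 pn ne') => l_gt0 l2 [d dh].
rewrite prednK // => lE; have [F FE] := total_surj dh; rewrite -FE in lE.
exists F; last by apply: val_inj; rewrite val_insubd -lE mulnK // ltn_ord.
rewrite inE -lE dvdn_mull // muln_eq0 negb_or -!lt0n l_gt0 e_gt0 /=.
by rewrite mulnA eqn_pmul2r.
Qed.

Lemma card_forall_columns (C : pred Col) :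
  #|[pred F : {ffun 'I_r -> Col} | [forall i, C (F i)]]| = #|C| ^ r.
Proof.
rewrite -[in RHS](card_ord r) -card_ffun_on; apply: eq_card => F.
by apply/forallP/ffun_onP => H i; have := H i.
Qed.

(** The two totals to be excluded, 0 and (p ^ (c * r) - 1) / 2, are those of
    constant words. *)
Lemma stable_columns_sub2 (C : pred Col) x0 xh :
    (forall j, comp x0 j = 0) -> (forall j, j < c -> comp xh j = h) ->
    C x0 -> C xh -> (forall F, (e %| total F) = [forall i, C (F i)]) ->
  #|stable p n_gt0| = #|C| ^ r - 2.
Proof.
move=> x0E xhE C0 Ch CE; rewrite stable_columns -card_forall_columns.
pose F0 : {ffun 'I_r -> Col} := [ffun => x0];
  pose Fh : {ffun 'I_r -> Col} := [ffun => xh].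
have tF0 : total F0 = 0.
  have -> : total F0 = of_digits (c * r) (fun=> 0).
    apply: eq_of_digits => t tr; have ir : t %% r < r by rewrite ltn_mod.
    by rewrite -[t %% r]/(val (Ordinal ir)) digitE ffunE.
  by elim: (c * r) => //= m ->; rewrite muln0.
have tFh : 2 * total Fh = n * e.
  rewrite ne -(of_digits_half p2h (c * r)) succnK; congr (_ * _).
  apply: eq_of_digits => t tr; have ir : t %% r < r by rewrite ltn_mod.
  have jc : t %/ r < c by rewrite ltn_divLR.
  by rewrite -[t %% r]/(val (Ordinal ir)) digitE ffunE xhE.
have F0h : F0 != Fh.
  by apply/eqP => F0h; move: tFh; rewrite -F0h tF0; have := muln_gt0 n e;
    rewrite n_gt0 e_gt0; lia.
have F0C : [forall i, C (F0 i)] by apply/forallP => i; rewrite ffunE.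
have FhC : [forall i, C (Fh i)] by apply/forallP => i; rewrite ffunE.
rewrite (cardD1 F0 [pred F : {ffun 'I_r -> Col} | [forall i, C (F i)]]) inE F0C add1n.
rewrite [in RHS](cardD1 Fh) !inE [Fh == F0]eq_sym F0h FhC add1n !subSS subn0.
apply: eq_card => F; rewrite !inE CE.
have -> : (total F == 0) = (F == F0) by rewrite -tF0 (inj_eq total_inj).
have -> : (2 * total F == n * e) = (F == Fh).
  by rewrite -tFh eqn_pmul2l // (inj_eq total_inj).
by case: (F == F0); case: (F == Fh); rewrite ?andbT ?andbF.
Qed.

End Columns.

(** * Numbers of columns *)

Lemma card_pairs (T U : finType) (P : T -> U -> bool) :
  #|[pred x : T * U | P x.1 x.2]| = \sum_(a : T) #|[pred b | P a b]|.
Proof.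
rewrite -sum1_card; under [RHS]eq_bigr => a _ do rewrite -sum1_card.
by rewrite (pair_big_dep xpredT (fun a b => P a b)).
Qed.

Lemma count_interval N lo hi : count (fun c =>
  lo <= c < hi) (iota 0 N) = minn hi N - lo.
Proof.
elim: N => [|N IH]; first by rewrite minn0.
rewrite -addn1 iotaD count_cat IH /= add0n addn0.
by case: (leqP lo N); case: (ltnP N hi); lia.
Qed.

Lemma card_interval N lo hi : #|[pred c : 'I_N | lo <= c < hi]| = minn hi N - lo.
Proof.
rewrite -count_interval -val_enum_ord count_map cardE {1}/enum_mem size_filter -enumT.
exact: eq_count.
Qed.

Lemma sum_sub N : 2 * \sum_(a < N) (N - a) = N * N.+1.
Proof.
elim: N => [|N IH]; first by rewrite big_ord0.
rewrite big_ord_recl subn0 (eq_bigr (fun i : 'I_N => N - i)) //.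
by rewrite mulnDr IH; lia.
Qed.

Lemma sum_dist N : 3 * (\sum_(a < N) \sum_(b < N) ((a - b) + (b - a))) + N = N * N * N.
Proof.
elim: N => [|N IH]; first by rewrite big_ord0.
rewrite big_ord_recr /=.
under eq_bigr => a _ do rewrite big_ord_recr /=.
rewrite big_split /= [\sum_(b < N.+1) _]big_ord_recr /= subnn !addn0.
have -> : \sum_(i < N) (i - N + (N - i)) = \sum_(i < N) (N - i).
  by apply: eq_bigr => i _; have := ltn_ord i; lia.
have -> : \sum_(b < N) (N - b + (b - N)) = \sum_(i < N) (N - i).
  by apply: eq_bigr => i _; have := ltn_ord i; lia.
move: IH (sum_sub N); set T := \sum_(a < N) \sum_(b < N) _;
  set A := \sum_(i < N) (N - i). nia.
Qed.

Section ColumnCounts.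
Variable h : nat.
Local Notation D := 'I_h.+1.

Lemma card_value (P : pred D) v : v <= h -> (forall b : D, P b =
  (b == v :> nat)) -> #|P| = 1.
Proof.
move=> vh PE; rewrite -(card1 (inord v : D)); apply: eq_card => b.
by rewrite -topredE /= PE inE -val_eqE /= inordK.
Qed.

Lemma card_pair_sum : #|[pred x : D * D | x.1 + x.2 == h]| = h.+1.
Proof.
rewrite (card_pairs (fun a b : D => a + b == h)).
rewrite (eq_bigr (fun=> 1)) ?sum1_card ?card_ord // => a _.
by apply: (card_value (v := h - a)) => [|b] /=; have := ltn_ord a; lia.
Qed.

Lemma card_pair_eq : #|[pred x : D * D | (x.1 == x.2 :> nat)]| = h.+1.
Proof.
rewrite (card_pairs (fun a b : D => a == b :> nat)).
rewrite (eq_bigr (fun=> 1)) ?sum1_card ?card_ord // => a _.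
by apply: (card_value (v := a)) => [|b] /=; have := ltn_ord a; lia.
Qed.

Lemma card_triple_sum :
  2 * #|[pred x : D * D * D | x.1.1 + x.1.2 + x.2 == h]| = h.+1 * h.+2.
Proof.
rewrite (card_pairs (fun (a : D * D) (b : D) => a.1 + a.2 + b == h)).
rewrite (eq_bigr (fun a : D * D => (a.1 + a.2 <= h) : nat)) => [|[a b] _ /=];
  last first.
  have [le|gt] := leqP (a + b) h.
    by apply: (card_value (v := h - (a + b))) => [|c] /=; lia.
  by apply: eq_card0 => c; apply/negbTE/negP => /eqP /=; lia.
rewrite -(pair_bigA _ (fun a b : D => (a + b <= h) : nat)) /=.
rewrite (eq_bigr (fun a : D => h.+1 - a)) ?sum_sub // => a _.
transitivity #|[pred b : D | 0 <= b < h.+1 - a]|; last first.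
  by rewrite card_interval subn0; apply/minn_idPl; exact: leq_subr.
rewrite -sum1_card [RHS]big_mkcond /=; apply: eq_bigr => b _; rewrite inE /=.
by rewrite ltn_subRL ltnS; case: (_ <= _).
Qed.

(** Replacing every entry by its complement to h reduces this to the previous
    count. *)
Lemma card_triple_sum_double :
  2 * #|[pred x : D * D * D | x.1.1 + x.1.2 + x.2 == 2 * h]| = h.+1 * h.+2.
Proof.
rewrite -card_triple_sum; congr (2 * _).
pose f (x : D * D * D) := (rev_ord x.1.1, rev_ord x.1.2, rev_ord x.2).
have fK : involutive f by case=> [[a b] c]; rewrite /f /= !rev_ordK.
rewrite -(card_image (inv_inj fK)); apply: eq_card => x.
rewrite -{1}(fK x) mem_image; last exact: inv_inj.
rewrite -!topredE /=; apply/eqP/eqP; move: (x.1.1) (x.1.2) (x.2) => a b c;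
  have := ltn_ord a; have := ltn_ord b; have := ltn_ord c; rewrite /=; lia.
Qed.

Lemma card_triple_sumE : #|[pred x : D * D * D | x.1.1 + x.1.2 + x.2 == h]| =
  (h.+1 * h.+2) %/ 2.
Proof. by rewrite -card_triple_sum mulKn. Qed.

Lemma card_triple_sum_doubleE :
  #|[pred x : D * D * D | x.1.1 + x.1.2 + x.2 == 2 * h]| = (h.+1 * h.+2) %/ 2.
Proof. by rewrite -card_triple_sum_double mulKn. Qed.

(** A pair with difference d is matched by the h + 1 - |d| pairs with the
    opposite difference. *)
Lemma card_quadruple :
  3 * #|[pred x : D * D * (D * D) | x.1.1 + x.2.1 == x.1.2 + x.2.2]| =
  h.+1 * (2 * h.+1 ^ 2 + 1).
Proof.
set N := h.+1.
rewrite (card_pairs (fun a b : D * D => a.1 + b.1 == a.2 + b.2)).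
rewrite (eq_bigr (fun a : D * D => N - ((a.1 - a.2) + (a.2 - a.1)))) => [|[a b] _ /=].
  rewrite -(pair_bigA _ (fun a b : D => N - ((a - b) + (b - a)))) /=.
  have : \sum_(a < N) \sum_(b < N) (N - ((a - b) + (b - a))) +
         \sum_(a < N) \sum_(b < N) ((a - b) + (b - a)) = N * N * N.
    transitivity (\sum_(a < N) \sum_(b < N) N); last first.
      by rewrite !sum_nat_const !card_ord mulnA.
    rewrite -big_split /=; apply: eq_bigr => a _; rewrite -big_split /=.
    apply: eq_bigr => b _; rewrite subnK //; move: (ltn_ord a) (ltn_ord b).
    by move: (nat_of_ord a) (nat_of_ord b) => i j; lia.
  have := sum_dist N; set T := \sum_(a < N) \sum_(b < N) (a - b + _);
    set A := \sum_(a < N) _.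
  by nia.
rewrite (card_pairs (fun c d : D => a + c == b + d)).
transitivity #|[pred c : D | b - a <= c < b + N - a]|; last first.
  by rewrite card_interval; have := ltn_ord a; have := ltn_ord b; lia.
rewrite -sum1_card [RHS]big_mkcond /=; apply: eq_bigr => c _; rewrite inE /=.
case: ifP => hc.
  by apply: (card_value (v := a + c - b)) => [|d] /=; lia.
by apply: eq_card0 => d; apply/negbTE/negP => /eqP /=; have := ltn_ord d; lia.
Qed.

End ColumnCounts.

(** * The six families of exponents *)

Lemma coprime_expn_pred p n e N : 0 < N -> 0 < p -> n * e = (p ^ N).-1 -> coprime p n.
Proof.
move=> N0 p0 ne; rewrite -(@coprime_pexpl N) //.
apply: (@coprime_dvdr n (p ^ N).-1); first by rewrite -ne dvdn_mulr.
by rewrite coprimenP // expn_gt0 p0.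
Qed.

(** The base 2 * H + 1 is 1 modulo H, so that divisibility by H only depends on
    the sum of the blocks. The excluded totals have sum of blocks 0 and 2 * H. *)
Lemma two_blocks_half H X Y : 0 < H -> X <= H -> Y <= H ->
  [&& H %| X + (2 * H).+1 * Y, X + (2 * H).+1 * Y != 0
    & 2 * (X + (2 * H).+1 * Y) != ((2 * H).+1 ^ 2).-1] = (X + Y == H).
Proof.
move=> H0 XH YH.
have -> : (H %| X + (2 * H).+1 * Y) = (H %| X + Y).
  have -> : X + (2 * H).+1 * Y = 2 * Y * H + (X + Y) by nia.
  by rewrite dvdn_addr // dvdn_mull.
apply/and3P/eqP => [[/dvdnP[m mE] T0 T2]|e].
  have m0 : m != 0.
    by apply: contraNneq T0 => m0; move: mE; rewrite m0 mul0n => /eqP;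
      rewrite addn_eq0 => /andP[/eqP-> /eqP->]; rewrite muln0.
  have m2 : m != 2 by apply: contraNneq T2 => m2; apply/eqP; nia.
  have : m <= 2 by rewrite -(leq_pmul2r H0) -mE; lia.
  by move: m0 m2 mE; case: m => [|[|[|]]] //; rewrite mul1n.
by rewrite e dvdnn; split=> //; apply/eqP; nia.
Qed.

(** The base is 1 modulo each divisor e of 2 * H, and the excluded totals have
    sum of blocks 0 and 3 * H. *)
Lemma three_blocks_half H X Y Z e m : 0 < H -> X <= H -> Y <= H -> Z <= H ->
    e * m = 2 * H ->
  let T := X + (2 * H).+1 * (Y + (2 * H).+1 * Z) in
  [&& e %| T, T != 0 & 2 * T != ((2 * H).+1 ^ 3).-1] =
  [&& e %| X + Y + Z, X + Y + Z != 0 & X + Y + Z != 3 * H].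
Proof.
move=> H0 XH YH ZH eE T.
have TE : T = (Y + (2 * H + 2) * Z) * (2 * H) + (X + Y + Z) by rewrite /T; ring.
have -> : (e %| T) = (e %| X + Y + Z).
  by rewrite TE -eE dvdn_addr // mulnCA dvdn_mulr.
have -> : (T == 0) = (X + Y + Z == 0) by rewrite /T !(addn_eq0, muln_eq0) /= andbA.
suff -> : (2 * T == ((2 * H).+1 ^ 3).-1) = (X + Y + Z == 3 * H) by [].
have -> : ((2 * H).+1 ^ 3).-1 = 2 * (H + (2 * H).+1 * (H + (2 * H).+1 * H)).
  by apply: succn_inj; rewrite prednK //; ring.
rewrite eqn_pmul2l //; apply/eqP/eqP => [|e3].
  by rewrite /T; nia.
by rewrite /T; have [-> [-> ->]] : X = H /\ Y = H /\ Z = H by lia.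
Qed.

Lemma three_sum H X Y Z : 0 < H -> X <= H -> Y <= H -> Z <= H ->
  [&& H %| X + Y + Z, X + Y + Z != 0 & X + Y + Z != 3 * H] =
  (X + Y + Z == 1 * H) || (X + Y + Z == 2 * H).
Proof.
move=> H0 XH YH ZH; have : X + Y + Z <= 3 * H by lia.
move: (X + Y + Z) => S SH; apply/and3P/orP => [[/dvdnP[m mE]]|].
  have : m <= 3 by rewrite -(leq_pmul2r H0) -mE.
  rewrite mE; case: m {mE} => [|[|[|[|]]]] // _;
    by [rewrite mul0n|rewrite eqxx|left|right].
by case=> /eqP->; rewrite dvdn_mull // -lt0n muln_gt0 H0 eqn_pmul2r.
Qed.

Lemma three_sum_even H X Y Z : 0 < H -> X <= H -> Y <= H -> Z <= H ->
  [&& 2 * H %| X + Y + Z, X + Y + Z != 0 & X + Y + Z != 3 * H] = (X + Y + Z == 2 * H).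
Proof.
move=> H0 XH YH ZH; have : X + Y + Z <= 3 * H by lia.
move: (X + Y + Z) => S SH; apply/and3P/eqP => [[/dvdnP[m mE]]|->].
  have : m <= 1.
    by rewrite -ltnS -(ltn_pmul2r (_ : 0 < 2 * H)) -?mE ?muln_gt0 //; lia.
  by rewrite mE; case: m {mE} => [|[|]] // _; rewrite mul1n.
by rewrite dvdnn -lt0n muln_gt0 H0 eqn_pmul2r.
Qed.

Section Families.
Variables (p h r : nat).
Hypotheses (p2h : p = (2 * h).+1) (h_gt0 : 0 < h) (r_gt0 : 0 < r).
Let D := 'I_h.+1.
Let H := of_digits p r (fun=> h).

Let q_eq : p ^ r = (2 * H).+1.
Proof. by rewrite /H (of_digits_half p2h). Qed.

Let H_gt0 : 0 < H.
Proof.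
have : 1 < p ^ r by rewrite -(exp1n r) ltn_exp2r // p2h; lia.
by rewrite q_eq; case: H.
Qed.

Let p_gt0 : 0 < p. Proof. by rewrite p2h. Qed.

Let entry (s : seq D) j : nat := nth ord0 s j.

Let entry_le s j : entry s j <= h.
Proof. by rewrite -ltnS /entry ltn_ord. Qed.

Let comp1 (x : D) := entry [:: x].
Let comp2 (x : D * D) := entry [:: x.1; x.2].
Let comp3 (x : D * D * D) := entry [:: x.1.1; x.1.2; x.2].
Let comp4 (x : D * D * (D * D)) := entry [:: x.1.1; x.1.2; x.2.1; x.2.2].

Let le1 x j : comp1 x j <= h. Proof. exact: entry_le. Qed.
Let le2 x j : comp2 x j <= h. Proof. exact: entry_le. Qed.
Let le3 x j : comp3 x j <= h. Proof. exact: entry_le. Qed.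
Let le4 x j : comp4 x j <= h. Proof. exact: entry_le. Qed.

Let inj1 x y : (forall j, j < 1 -> comp1 x j = comp1 y j) -> x = y.
Proof. by move/(_ 0 isT) => /val_inj. Qed.

Let inj2 x y : (forall j, j < 2 -> comp2 x j = comp2 y j) -> x = y.
Proof.
case: x y => [a b] [a' b'] e.
by have /val_inj /= -> := e 0 isT; have /val_inj /= -> := e 1 isT.
Qed.

Let inj3 x y : (forall j, j < 3 -> comp3 x j = comp3 y j) -> x = y.
Proof.
case: x y => [[a b] c] [[a' b'] c'] e; have /val_inj /= -> := e 0 isT.
by have /val_inj /= -> := e 1 isT; have /val_inj /= -> := e 2 isT.
Qed.

Let inj4 x y : (forall j, j < 4 -> comp4 x j = comp4 y j) -> x = y.
Proof.
case: x y => [[a b] [c d]] [[a' b'] [c' d']] e; have /val_inj /= -> := e 0 isT.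
have /val_inj /= -> := e 1 isT; have /val_inj /= -> := e 2 isT.
by have /val_inj /= -> := e 3 isT.
Qed.

Let surj1 s : (forall j, s j <= h) -> exists x, forall j, j < 1 -> comp1 x j = s j.
Proof. by move=> sh; exists (inord (s 0)); case=> // _;
  rewrite /comp1 /entry /= inordK ?ltnS. Qed.

Let surj2 s : (forall j, s j <= h) -> exists x, forall j, j < 2 -> comp2 x j = s j.
Proof.
move=> sh; exists (inord (s 0), inord (s 1)).
by do 2![case=> [_|]; first by rewrite /comp2 /entry /= inordK ?ltnS].
Qed.

Let surj3 s : (forall j, s j <= h) -> exists x, forall j, j < 3 -> comp3 x j = s j.
Proof.
move=> sh; exists (inord (s 0), inord (s 1), inord (s 2)).
by do 3![case=> [_|]; first by rewrite /comp3 /entry /= inordK ?ltnS].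
Qed.

Let surj4 s : (forall j, s j <= h) -> exists x, forall j, j < 4 -> comp4 x j = s j.
Proof.
move=> sh; exists (inord (s 0), inord (s 1), (inord (s 2), inord (s 3))).
by do 4![case=> [_|]; first by rewrite /comp4 /entry /= inordK ?ltnS].
Qed.

Lemma stable_pred n (n_gt0 : 0 < n) : n = (p ^ r).-1 ->
  coprime p n /\ #|stable p n_gt0| = h.+1 ^ r - 2.
Proof.
move=> nE; have ne : n * 1 = (p ^ (1 * r)).-1 by rewrite muln1 mul1n.
have pn : coprime p n by apply: coprime_expn_pred ne; rewrite ?mul1n.
split=> //.
have z0 j : comp1 ord0 j = 0 by case: j => [|[|]].
have zh j : j < 1 -> comp1 ord_max j = h by case: j.
have CE F : (1 %| total p 1 comp1 F) = [forall i : 'I_r, predT (F i)].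
  by rewrite dvd1n; apply/esym/forallP.
rewrite (stable_columns_sub2 p2h (isT : 0 < 1) r_gt0 le1 inj1 surj1
  h_gt0 n_gt0 pn ne z0 zh isT isT CE).
by rewrite cardT size_enum_ord.
Qed.

(** As p ^ r is -1 modulo the divisor H + 1, which exceeds all layers, the
    condition is that the two layers agree. *)
Lemma stable_double_pred n (n_gt0 : 0 < n) : n = 2 * (p ^ r).-1 ->
  coprime p n /\ #|stable p n_gt0| = h.+1 ^ r - 2.
Proof.
move=> nE; have ne : n * H.+1 = (p ^ (2 * r)).-1.
  by rewrite nE mulnC [2 * r]mulnC expnM q_eq; nia.
have pn : coprime p n by apply: coprime_expn_pred ne; rewrite ?muln_gt0.
split=> //.
have z0 j : comp2 (ord0, ord0) j = 0 by case: j => [|[|[|]]].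
have zh j : j < 2 -> comp2 (ord_max, ord_max) j = h by case: j => [|[|]].
pose C (x : D * D) := comp2 x 0 == comp2 x 1.
have CE F : (H.+1 %| total p 2 comp2 F) = [forall i : 'I_r, C (F i)].
  rewrite -(layer_eq p2h (s := comp2^~ 0) (s' := comp2^~ 1)) => [|x]; last first.
    by move: (le2 x 0) (le2 x 1); move: (comp2 x 0) (comp2 x 1); rewrite p2h;
      clear; lia.
  have XH : layer p (comp2^~ 0) F <= H by apply: layer_le => x; apply: le2.
  have YH : layer p (comp2^~ 1) F <= H by apply: layer_le => x; apply: le2.
  rewrite (total_blocks _ _ _ r_gt0) /= muln0 addn0 q_eq.
  set X := layer p (comp2^~ 0) F in XH *; set Y := layer p (comp2^~ 1) F in YH *.
  have : X + (2 * H).+1 * Y + Y = 2 * Y * H.+1 + X by nia.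
  move/(congr1 (modn^~ H.+1)); rewrite modnMDl [X %% _]modn_small // => e.
  apply/idP/eqP => [/eqP dv|->]; first by move: e; rewrite -modnDml dv add0n modn_small.
  by apply/dvdnP; exists (2 * Y); nia.
have C0 : C (ord0, ord0) by apply: eqxx.
have Ch : C (ord_max, ord_max) by apply: eqxx.
rewrite (stable_columns_sub2 p2h (isT : 0 < 2) r_gt0 le2 inj2 surj2
  h_gt0 n_gt0 pn ne z0 zh C0 Ch CE).
by rewrite card_pair_eq.
Qed.

(** As p ^ r is -1 modulo the divisor, which exceeds all sums of two layers, the
    condition is that the alternating sum of the four layers vanishes. *)
Lemma stable_alternating n (n_gt0 : 0 < n) :
    n = p ^ (3 * r) - p ^ (2 * r) + p ^ r - 1 ->
  coprime p n /\ #|stable p n_gt0| = (h.+1 * (2 * h.+1 ^ 2 + 1) %/ 3) ^ r - 2.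
Proof.
have q3 : p ^ (3 * r) = (2 * H).+1 ^ 3 by rewrite mulnC expnM q_eq.
have q2 : p ^ (2 * r) = (2 * H).+1 ^ 2 by rewrite mulnC expnM q_eq.
have q4 : p ^ (4 * r) = (2 * H).+1 ^ 4 by rewrite mulnC expnM q_eq.
rewrite q3 q2 q_eq => nE; have ne : n * (2 * H).+2 = (p ^ (4 * r)).-1.
  rewrite q4 nE; clear; move: H => m.
  have -> : (2 * m).+1 ^ 3 = (2 * m).+1 ^ 2 + 2 * m * (2 * m).+1 ^ 2.
    by rewrite expnS -[X in X + _]mul1n -mulnDl add1n.
  rewrite addKn addnS subn1 succnK !expnS expn0 !muln1.
  by apply: succn_inj; rewrite prednK //; ring.
have small a b : a <= H -> b <= H -> a + b < (2 * H).+2.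
  by move=> aH bH; rewrite mul2n -addnn ltnS leqW ?leq_add.
have pn : coprime p n by apply: coprime_expn_pred ne; rewrite ?muln_gt0.
split=> //.
have z0 j : comp4 (ord0, ord0, (ord0, ord0)) j = 0 by case: j => [|[|[|[|[|]]]]].
have zh j : j < 4 -> comp4 (ord_max, ord_max, (ord_max, ord_max)) j = h.
  by case: j => [|[|[|[|]]]].
pose C (x : D * D * (D * D)) := comp4 x 0 + comp4 x 2 == comp4 x 1 + comp4 x 3.
have CE F : ((2 * H).+2 %| total p 4 comp4 F) = [forall i : 'I_r, C (F i)].
  rewrite -(layer_eq p2h (s := fun x => comp4 x 0 + comp4 x 2)
    (s' := fun x => comp4 x 1 + comp4 x 3)) => [|x]; last first.
    move: (le4 x 0) (le4 x 1) (le4 x 2) (le4 x 3).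
    by move: (comp4 x 0) (comp4 x 1) (comp4 x 2) (comp4 x 3); rewrite p2h; clear; lia.
  have Ll j : layer p (comp4^~ j) F <= H by apply: layer_le => x; apply: le4.
  rewrite -!layerD (total_blocks _ _ _ r_gt0) /= muln0 addn0 q_eq.
  move: (Ll 0) (Ll 1) (Ll 2) (Ll 3).
  set X := layer p (comp4^~ 0) F; set Y := layer p (comp4^~ 1) F.
  set Z := layer p (comp4^~ 2) F; set W := layer p (comp4^~ 3) F.
  move=> XH YH ZH WH; set T := X + _.
  have : T + (Y + W) = (Y + (2 * H) * Z + ((2 * H) ^ 2 + 2 * H +
    1) * W) * (2 * H).+2 + (X + Z).
    by rewrite /T; ring.
  move/(congr1 (modn^~ (2 * H).+2)); rewrite modnMDl [(X + Z) %% _]modn_small ?small //.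
  move=> e; have YW : (Y + W) %% (2 * H).+2 = Y + W by rewrite modn_small ?small.
  apply/idP/eqP => [/eqP dv|XZ]; first by move: e; rewrite -modnDml dv add0n YW.
  have : T + (Y + W) == 0 + (Y + W) %[mod (2 * H).+2] by rewrite e add0n YW XZ.
  by rewrite eqn_modDr mod0n.
have C0 : C (ord0, ord0, (ord0, ord0)) by apply: eqxx.
have Ch : C (ord_max, ord_max, (ord_max, ord_max)) by apply: eqxx.
rewrite (stable_columns_sub2 p2h (isT : 0 < 4) r_gt0 le4 inj4 surj4
  h_gt0 n_gt0 pn ne z0 zh C0 Ch CE).
by rewrite -(card_quadruple h) mulKn.
Qed.

Lemma stable_double_succ n (n_gt0 : 0 < n) : n = 2 * (p ^ r).+1 ->
  coprime p n /\ #|stable p n_gt0| = h.+1 ^ r.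
Proof.
have q2 : p ^ (2 * r) = (2 * H).+1 ^ 2 by rewrite mulnC expnM q_eq.
rewrite q_eq => nE; have ne : n * H = (p ^ (2 * r)).-1 by rewrite q2 nE; nia.
have pn : coprime p n by apply: coprime_expn_pred ne; rewrite ?muln_gt0.
split=> //.
rewrite (stable_columns p2h (isT : 0 < 2) r_gt0 le2 inj2 surj2 h_gt0 n_gt0 pn ne).
rewrite -[in RHS](card_pair_sum h) -card_forall_columns; apply: eq_card => F.
rewrite !inE ne q2 (total_blocks _ _ _ r_gt0) /= muln0 addn0 q_eq.
rewrite two_blocks_half //; try by apply: layer_le => x; apply: le2.
rewrite layerD /H -(layer_const p h F) (layer_eq p2h) // => x.
by move: (le2 x 0) (le2 x 1); move: (comp2 x 0) (comp2 x 1); rewrite p2h; clear; lia.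
Qed.

Lemma layer_three_eq m (F : {ffun 'I_r -> D * D * D}) : 0 < m <= 2 ->
  (layer p (comp3^~ 0) F + layer p (comp3^~ 1) F + layer p (comp3^~ 2) F == m * H) =
  [forall i, (F i).1.1 + (F i).1.2 + (F i).2 == m * h].
Proof.
move=> m12; have -> : m * H = layer p (fun=> m * h) F.
  elim: m {m12} => [|m IH]; last by rewrite mulSn IH /H -(layer_const p h F) layerD.
  by rewrite mul0n [RHS]layer_const; elim: (r) => //= t <-; rewrite muln0.
rewrite !layerD (layer_eq p2h) // => x.
move: (le3 x 0) (le3 x 1) (le3 x 2); move: (comp3 x 0) (comp3 x 1) (comp3 x 2).
by rewrite p2h; case: m m12 => [|[|[|]]] //; clear; lia.
Qed.

Lemma stable_three n (n_gt0 : 0 < n) : n = p ^ (2 * r) + p ^ r + 1 ->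
  coprime p n /\ #|stable p n_gt0| = (h.+1 * h.+2 %/ 2) ^ r.
Proof.
have q2 : p ^ (2 * r) = (2 * H).+1 ^ 2 by rewrite mulnC expnM q_eq.
have q3 : p ^ (3 * r) = (2 * H).+1 ^ 3 by rewrite mulnC expnM q_eq.
rewrite q2 q_eq => nE; have ne : n * (2 * H) = (p ^ (3 * r)).-1.
  by rewrite q3 nE; apply: succn_inj; rewrite prednK //; ring.
have pn : coprime p n by apply: coprime_expn_pred ne; rewrite ?muln_gt0.
split=> //.
rewrite (stable_columns p2h (isT : 0 < 3) r_gt0 le3 inj3 surj3 h_gt0 n_gt0 pn ne).
rewrite -card_triple_sum_doubleE -card_forall_columns; apply: eq_card => F.
rewrite !inE ne q3 (total_blocks _ _ _ r_gt0) /= muln0 addn0 q_eq -layer_three_eq //.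
have Ll j : layer p (comp3^~ j) F <= H by apply: layer_le => x; apply: le3.
rewrite (@three_blocks_half _ _ _ _ _ 1) ?muln1 //.
exact: three_sum_even.
Qed.

Lemma stable_double_three n (n_gt0 : 0 < n) : n = 2 * (p ^ (2 * r) + p ^ r + 1) ->
  coprime p n /\ #|stable p n_gt0| = 2 * (h.+1 * h.+2 %/ 2) ^ r.
Proof.
have q2 : p ^ (2 * r) = (2 * H).+1 ^ 2 by rewrite mulnC expnM q_eq.
have q3 : p ^ (3 * r) = (2 * H).+1 ^ 3 by rewrite mulnC expnM q_eq.
rewrite q2 q_eq => nE; have ne : n * H = (p ^ (3 * r)).-1.
  by rewrite q3 nE; apply: succn_inj; rewrite prednK //; ring.
have pn : coprime p n by apply: coprime_expn_pred ne; rewrite ?muln_gt0.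
split=> //.
rewrite (stable_columns p2h (isT : 0 < 3) r_gt0 le3 inj3 surj3 h_gt0 n_gt0 pn ne).
rewrite mul2n -addnn -[in X in X + _]card_triple_sumE -card_triple_sum_doubleE.
rewrite -!card_forall_columns.
set A := [pred F | _]; set B := [pred F | _]; set B2 := [pred F | _].
have BE F : (F \in B) = (layer p (comp3^~ 0) F + layer p (comp3^~ 1) F +
  layer p (comp3^~ 2) F == 1 * H).
  by rewrite layer_three_eq // mul1n.
have B2E F : (F \in B2) = (layer p (comp3^~ 0) F + layer p (comp3^~ 1) F +
  layer p (comp3^~ 2) F == 2 * H).
  by rewrite layer_three_eq.
rewrite -cardUI [X in _ + X]eq_card0 ?addn0 => [|F]; last first.
  rewrite -[LHS]/((F \in B) && (F \in B2)) BE B2E; apply/negbTE/negP => /andP[/eqP -> ].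
  by rewrite eqn_pmul2r.
apply: eq_card => F; rewrite -[RHS]/((F \in B) || (F \in B2)) BE B2E inE.
rewrite ne q3 (total_blocks _ _ _ r_gt0) /= muln0 addn0 q_eq.
have Ll j : layer p (comp3^~ j) F <= H by apply: layer_le => x; apply: le3.
rewrite (@three_blocks_half _ _ _ _ _ 2) ?[H * 2]mulnC //.
exact: three_sum.
Qed.

End Families.

(** * The six p-ranks *)

Lemma stable_p_rank (p : nat) (p_prime : prime p) (p_odd : odd p)
    (k : closedFieldType) (FptoK : {rmorphism 'F_p -> k}) n (n_gt0 : 0 < n) :
  coprime p n -> curve_has_p_rank k p n #|stable p n_gt0|.
Proof.
move=> pn; have charp : p \in [pchar k]%R by rewrite (fmorph_pchar FptoK) pchar_Fp.
have [V [uV cV memV]] := cartier_fixed_count charp p_odd n_gt0 pn.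
by apply: (curve_p_rank charp p_odd n_gt0 _ uV memV cV); rewrite -prime_coprime.
Qed.

(* k is an algebraic closure of 'F_p. All the divisions are exact and the
   subtractions are not truncated. *)
Theorem corollary5p2 (p : nat) (p_prime : prime p) (p_odd : odd p)
    (k : closedFieldType) (FptoK : {rmorphism 'F_p -> k})
    (k_algebraic : integralRange FptoK) (r : nat) (r_gt0 : 0 < r) :
  [/\ curve_has_p_rank k p (p ^ r - 1) (((p + 1) %/ 2) ^ r - 2),
      curve_has_p_rank k p (2 * (p ^ r + 1)) (((p + 1) %/ 2) ^ r),
      curve_has_p_rank k p (2 * (p ^ r - 1)) (((p + 1) %/ 2) ^ r - 2),
      curve_has_p_rank k p (p ^ (2 * r) + p ^ r + 1)
        (((p + 3) * (p + 1) %/ 8) ^ r) &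
      curve_has_p_rank k p (2 * (p ^ (2 * r) + p ^ r + 1))
        (2 * ((p + 3) * (p + 1) %/ 8) ^ r)] /\
  curve_has_p_rank k p (p ^ (3 * r) - p ^ (2 * r) + p ^ r - 1)
    (((p ^ 2 + 2 * p + 3) * (p + 1) %/ 12) ^ r - 2).
Proof.
pose h := p./2; have p2h : p =
  (2 * h).+1 by rewrite mul2n -add1n -[LHS]odd_double_half p_odd.
have h_gt0 : 0 < h.
  by rewrite lt0n; apply: contraTneq (prime_gt1 p_prime) => h0; rewrite p2h h0.
have E2 : (p + 1) %/ 2 = h.+1 by rewrite -[RHS](mulKn _ (isT : 0 < 2)) p2h;
  congr (_ %/ 2); ring.
have E8 : (p + 3) * (p + 1) %/ 8 = h.+1 * h.+2 %/ 2.
  by rewrite -(@divnMl 4 _ 2) //; congr (_ %/ 8); rewrite p2h; ring.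
have E12 : (p ^ 2 + 2 * p + 3) * (p + 1) %/ 12 = h.+1 * (2 * h.+1 ^ 2 + 1) %/ 3.
  by rewrite -(@divnMl 4 _ 3) //; congr (_ %/ 12); rewrite p2h; ring.
have q_gt1 : 1 < p ^ r by rewrite -(exp1n r) ltn_exp2r ?prime_gt1.
have rank n g : 0 < n ->
    (forall n_gt0 : 0 < n, coprime p n /\ #|stable p n_gt0| = g) ->
    curve_has_p_rank k p n g.
  by move=> n_gt0 /(_ n_gt0)[pn <-]; exact: stable_p_rank.
rewrite E2 E8 E12; split; [split|]; apply: rank.
- by rewrite subn_gt0.
- by move=> n_gt0; apply: (stable_pred p2h) => //; rewrite subn1.
- by rewrite muln_gt0 addn1.
- by move=> n_gt0; apply: (stable_double_succ p2h) => //; rewrite addn1.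
- by rewrite muln_gt0 subn_gt0.
- by move=> n_gt0; apply: (stable_double_pred p2h) => //; rewrite subn1.
- by rewrite addn1.
- by move=> n_gt0; apply: (stable_three p2h).
- by rewrite muln_gt0 addn1.
- by move=> n_gt0; apply: (stable_double_three p2h).
- by rewrite subn_gt0 (leq_trans q_gt1) // leq_addl.
- by move=> n_gt0; apply: (stable_alternating p2h).
Qed.
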